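(* Let $(\mathcal M,\mathcal N,\mathcal D)$ be a Cartan triple with associated extension $\mathcal P\hookrightarrow\mathcal G\overset{q}{\twoheadrightarrow}\mathcal S$. Then $(\mathcal M,\mathcal N,\mathcal D)$ satisfies Fulman's condition if and only if there exists a homomorphism of inverse semigroups $\alpha:\mathcal S\to\operatorname{pAut}(\mathcal N,\mathcal D)$ such that $\pi\circ\alpha=\theta$, where $\pi:\operatorname{pAut}(\mathcal N,\mathcal D)\to\operatorname{Fund}(\operatorname{pAut}(\mathcal N,\mathcal D))$ is the quotient by the Munn relation and $\theta:\mathcal S\to\operatorname{Fund}(\operatorname{pAut}(\mathcal N,\mathcal D))$ is the canonical homomorphism (defined in the context).
   Context: Von Neumann subalgebras are understood to contain the unit of the ambient algebra. For von Neumann algebras $\mathcal L\subseteq\mathcal M$, put $\mathcal{GN}(\mathcal M,\mathcal L)=\{v\in\mathcal M: v\text{ is a partial isometry and } v^*\mathcal Lv\cup v\mathcal Lv^*\subseteq\mathcal L\}$; $\mathcal L$ is regular in $\mathcal M$ if the linear span of $\mathcal{GN}(\mathcal M,\mathcal L)$ is weak-$*$ dense in $\mathcal M$. A Cartan triple $(\mathcal M,\mathcal N,\mathcal D)$ consists of von Neumann algebras such that (1) $\mathcal D$ is an abelian and regular von Neumann subalgebra of $\mathcal M$; (2) $\mathcal N$ is the relative commutant of $\mathcal D$ in $\mathcal M$; (3) there exists a faithful normal conditional expectation $E:\mathcal M\to\mathcal N$. For an inverse semigroup $\mathcal R$ with idempotents $\mathcal E(\mathcal R)$, the Munn relation is $\{(v,w):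 vev^\dagger=wew^\dagger\ \forall e\in\mathcal E(\mathcal R)\}$, a congruence. The extension associated to $(\mathcal M,\mathcal N,\mathcal D)$: $\mathcal G=\mathcal{GN}(\mathcal M,\mathcal D)$, $\mathcal P=\mathcal{GN}(\mathcal N,\mathcal D)$ (inverse semigroups with inverse $v^*$ and idempotents $\operatorname{proj}(\mathcal D)$), $\mathcal S$ is the quotient of $\mathcal G$ by the Munn relation, $q:\mathcal G\to\mathcal S$ the quotient map. Fulman's condition: $(\mathcal M,\mathcal N,\mathcal D)$ satisfies Fulman's condition if it has a regularizer, i.e. a subgroup $R$ of the unitary group $\mathcal U(\mathcal M)$ such that (a) $\mathcal U(\mathcal N)\subseteq R\subseteq\mathcal{GN}(\mathcal M,\mathcal D)$; (b) $\operatorname{span}R$ is weak-$*$ dense in $\mathcal M$; (c) there is a homomorphism $\alpha:R\to\operatorname{Aut}(\mathcal N)$ such that (i) if $p$ is a projection in $\mathcal D$ with $\alpha_u|_{\mathcal Dp}=\mathrm{id}|_{\mathcal Dp}$, then $\alpha_u|_{\mathcal Np}=\mathrm{id}|_{\mathcal Np}$; and (ii) $\alpha_u(d)=udu^*$ for all $u\in R$ and $d\in\mathcal D$. $\operatorname{pAut}(\mathcal N,\mathcal D)$ (with $\mathcal D$ a von Neumann subalgebra of $\mathcal Z(\mathcal N)$) is the set of partial automorphisms: triples $(e,\alpha,f)$ with $e,f\in\operatorname{proj}(\mathcal D)$ and $\alpha:f\mathcal N\to e\mathcal N$ a normal $*$-isomorphism with $\alpha(f\mathcal D)=e\mathcal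 D$. It is an inverse monoid with $(e,\alpha,f)^\dagger=(f,\alpha^{-1},e)$ and $(e_1,\alpha_1,f_1)(e_2,\alpha_2,f_2)=(\alpha_1(f_1e_2),(\alpha_1\circ\alpha_2)|_{\alpha_2^{-1}(f_1e_2)\mathcal N},\alpha_2^{-1}(f_1e_2))$; its idempotents are $(e,\mathrm{id}|_{e\mathcal N},e)$, $e\in\operatorname{proj}(\mathcal D)$. $\operatorname{Fund}(\operatorname{pAut}(\mathcal N,\mathcal D))$ is its quotient by the Munn relation, $\pi$ the quotient map, and $[e,\alpha,f]=\pi(e,\alpha,f)$. For $v\in\mathcal G$ let $\operatorname{ad}_v:v^*v\mathcal N\to vv^*\mathcal N$, $\operatorname{ad}_v(x)=vxv^*$; then $(vv^*,\operatorname{ad}_v,v^*v)\in\operatorname{pAut}(\mathcal N,\mathcal D)$, and $\theta(s)=[vv^*,\operatorname{ad}_v,v^*v]$ for any $v\in\mathcal G$ with $q(v)=s$ (independent of the choice of $v$). *)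

(* Defs.v *)
From HB Require Import structures.
From mathcomp Require Import all_boot all_order all_algebra.
From mathcomp Require Import generic_quotient complex.
From mathcomp Require Import all_classical all_reals topology normedtype sequences.

Set Implicit Arguments.
Unset Strict Implicit.
Unset Printing Implicit Defensive.

Import Order.TTheory GRing.Theory Num.Theory.
Import numFieldNormedType.Exports.

Local Open Scope classical_set_scope.
Local Open Scope ring_scope.

(* The inner product is linear in the first and conjugate-linear in the second
   variable.  No separability is assumed. *)
HB.mixin Record isHilbert (R : realType) H & CompleteNormedModule R[i] H := {
  ip : {dot H for @Num.conj R[i]};
  ip_norm : forall x : H, `|x| ^+ 2 = ip x x
}.

#[short(type="hilbertType")]
HB.structure Definition Hilbert (R : realType) :=
  {H of isHilbert R H & CompleteNormedModule R[i] H}.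

Arguments ip {R H} : rename.
Arguments ip_norm {R H} x : rename.

Section HilbertTheory.
Variables (R : realType) (H : hilbertType R).
Local Notation C := R[i].
Implicit Types (x y z : H) (a : C).

Lemma ipDl x y z : ip (x + y) z = ip x z + ip y z.
Proof. exact: linearDl. Qed.

Lemma ipDr x y z : ip z (x + y) = ip z x + ip z y.
Proof. exact: linearDr. Qed.

Lemma ipZl a x y : ip (a *: x) y = a * ip x y.
Proof. exact: linearZl_LR. Qed.

Lemma ipZr a x y : ip x (a *: y) = a^* * ip x y.
Proof. exact: linearZr_LR. Qed.

Lemma ipC x y : ip x y = (ip y x)^*.
Proof. by rewrite hermC /= expr0 mul1r. Qed.

Lemma ip0l x : ip 0 x = 0.
Proof. by rewrite -(scale0r (0 : H)) ipZl mul0r. Qed.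

Lemma ip0r x : ip x 0 = 0.
Proof. by rewrite ipC ip0l conjC0. Qed.

Lemma ipBl x y z : ip (x - y) z = ip x z - ip y z.
Proof. by rewrite ipDl -scaleN1r ipZl mulN1r. Qed.

Lemma ipBr x y z : ip z (x - y) = ip z x - ip z y.
Proof. by rewrite ipDr -scaleN1r ipZr rmorphN1 mulN1r. Qed.

Lemma ip_ext x y : (forall z, ip z x = ip z y) -> x = y.
Proof.
move=> h; apply/eqP; rewrite -subr_eq0 -normr_eq0 -sqrf_eq0 ip_norm.
by rewrite ipBr h subrr.
Qed.

Lemma normD2 x y : `|x + y| ^+ 2 = `|x| ^+ 2 + `|y| ^+ 2 + (ip x y + ip y x).
Proof. by rewrite !ip_norm ipDl !ipDr [ip y x + _]addrC addrACA. Qed.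

Lemma parallelogram x y :
  `|x + y| ^+ 2 + `|x - y| ^+ 2 = (`|x| ^+ 2 + `|y| ^+ 2) *+ 2.
Proof.
rewrite !normD2 normrN -scaleN1r ipZr ipZl rmorphN1 !mulN1r -opprD.
by rewrite addrACA subrr addr0 mulr2n.
Qed.

Lemma norm_proj x y : y != 0 ->
  `|x - (ip x y / `|y| ^+ 2) *: y| ^+ 2 = `|x| ^+ 2 - `|ip x y| ^+ 2 / `|y| ^+ 2.
Proof.
move=> y0; have nz : `|y| ^+ 2 != 0 by rewrite sqrf_eq0 normr_eq0.
set b := `|y| ^+ 2 in nz *.
have bb : b^* = b by rewrite conj_Creal // rpredX // normr_real.
rewrite ip_norm ipBl !ipBr !ipZl !ipZr -!ip_norm -/b [ip y x]ipC.
rewrite fmorph_div /= bb normCK divfK //.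
by rewrite subrr subr0; congr (_ - _); rewrite mulrAC [_^* * _]mulrC.
Qed.

Lemma cauchy_schwarz x y : `|ip x y| <= `|x| * `|y|.
Proof.
have [->|y0] := eqVneq y 0; first by rewrite ip0r !normr0 mulr0.
rewrite -(@ler_pXn2r _ 2) ?nnegrE ?mulr_ge0 // exprMn.
have y2 : 0 < `|y| ^+ 2 by rewrite exprn_gt0 // normr_gt0.
by rewrite -ler_pdivrMr // -subr_ge0 -norm_proj // exprn_ge0.
Qed.

Section Riesz.
Variable f : H -> C.
Hypotheses (fD : {morph f : x y / x + y}) (fZ : forall a x, f (a *: x) = a * f x).
Variable M : C.
Hypothesis fM : forall x, `|f x| <= M * `|x|.

Let rn x : R := complex.Re `|x|.
Let rnE x : `|x| = (rn x)%:C%C.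
Proof. by rewrite /rn RRe_real // normr_real. Qed.
Let rn_ge0 x : 0 <= rn x.
Proof. by rewrite -lecR -rnE; apply: normr_ge0. Qed.

Let D := [set rn x | x in [set x | f x = 1]].
Let d := inf D.

Lemma min_norm : (exists x, f x != 0) ->
  exists2 z, f z = 1 & forall x, f x = 1 -> `|z| <= `|x|.
Proof.
move=> [x0 fx0].
have D0 : D !=set0.
  by exists (rn ((f x0)^-1 *: x0)), ((f x0)^-1 *: x0); rewrite //= fZ mulVf.
have Dlb : has_inf D by split=> //; exists 0 => _ [x _ <-].
have d_ge0 : 0 <= d by apply: lb_le_inf => // _ [x _ <-].
have dle x : f x = 1 -> d <= rn x.
  by move=> fx; apply: ge_inf; [case: Dlb|exists x].
pose B (e : R) := [set x | f x = 1 /\ rn x ^+ 2 < d ^+ 2 + e].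
pose F := filter_from [set e : R | 0 < e] B.
have B0 e : 0 < e -> B e !=set0.
  move=> e0.
  have [|_ [x fx <-]] := @inf_lt _ D (Num.sqrt (d ^+ 2 + e)) D0.
    rewrite -/d -[ltLHS](@ger0_norm _ d) // -sqrtr_sqr ltr_sqrt ?ltrDl //.
    by rewrite ltr_pwDr // sqr_ge0.
  move=> lt; exists x; split => //.
  rewrite -[ltRHS]sqr_sqrtr; last by rewrite addr_ge0 ?sqr_ge0 // ltW.
  by rewrite ltr_pXn2r // nnegrE ?sqrtr_ge0.
have FF : ProperFilter F.
  apply: filter_from_proper => //; apply: filter_from_filter; first by exists 1 => /=.
  move=> e1 e2 /= h1 h2; exists (Num.min e1 e2); first by rewrite /= lt_min h1.
  by move=> x [fx lt]; split; split => //; apply: lt_le_trans lt _;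
    rewrite lerD2l ge_min lexx ?orbT.
have par x y e : B e x -> B e y -> rn (x - y) ^+ 2 < e *+ 4.
  move=> [fx hx] [fy hy].
  have hm : d ^+ 2 *+ 4 <= rn (x + y) ^+ 2.
    have := dle (2^-1 *: (x + y)); rewrite fZ fD fx fy mulVf ?pnatr_eq0 //.
    move=> /(_ erefl) h.
    have -> : rn (x + y) = rn (2^-1 *: (x + y)) *+ 2.
      apply: complexI; rewrite -rnE rmorphMn /= -rnE normrZ -mulrnAl.
      by rewrite normfV ger0_norm // -mulr_natl divff ?mul1r ?pnatr_eq0.
    rewrite exprMn_n -[(2 ^ 2)%N]/4%N lerMn2r /=.
    by rewrite ler_pXn2r // nnegrE.
  have pl : rn (x + y) ^+ 2 + rn (x - y) ^+ 2 = (rn x ^+ 2 + rn y ^+ 2) *+ 2.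
    apply: complexI; rewrite !(rmorphMn, rmorphD, rmorphXn) /= -!rnE.
    exact: parallelogram.
  have -> : rn (x - y) ^+ 2 = (rn x ^+ 2 + rn y ^+ 2) *+ 2 - rn (x + y) ^+ 2.
    by rewrite -pl [X in _ = X - _]addrC addrK.
  rewrite ltrBlDr; apply: (@lt_le_trans _ _ (e *+ 4 + d ^+ 2 *+ 4)); last by rewrite lerD2l.
  rewrite -mulrnDl (mulrnA _ 2 2) ltrMn2r /= mulr2n.
  by rewrite [e + _]addrC ltrD.
have Fc : cauchy F.
  apply/cauchy_ballP => e e0.
  have eR : e = (complex.Re e)%:C%C by rewrite RRe_real // gtr0_real.
  have e0' : 0 < complex.Re e by rewrite -ltcR -eR.
  set r := complex.Re e in eR e0'.
  have r4 : 0 < r ^+ 2 / 4 by rewrite divr_gt0 // exprn_gt0.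
  exists (B (r ^+ 2 / 4), B (r ^+ 2 / 4)).
    by split; exists (r ^+ 2 / 4).
  move=> [x y] /= [Bx By]; rewrite /= -ball_normE /ball_ /= rnE eR ltcR.
  have r4E : r ^+ 2 / 4 *+ 4 = r ^+ 2 by rewrite -[LHS]mulr_natr divfK ?pnatr_eq0.
  have := par _ _ _ Bx By; rewrite r4E.
  by rewrite ltr_pXn2r // nnegrE // ltW.
have /cauchy_cvg Fcv := Fc.
pose z := lim F.
have near e r : 0 < e -> 0 < r -> exists2 x, B e x & rn (z - x) < r.
  move=> e0 r0.
  have Fz : F (ball z r%:C%C).
    by apply: Fcv; apply: nbhsx_ballx; rewrite ltcR.
  have Fe : F (B e) by exists e.
  have [x [Bx]] := filter_ex (filterI Fe Fz).
  by rewrite -ball_normE /ball_ /= rnE ltcR => ?; exists x.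
have fB x y : f (x - y) = f x - f y.
  by rewrite fD -scaleN1r fZ mulN1r.
have fz : f z = 1.
  apply/eqP; rewrite -subr_eq0 -normr_le0; apply/ler_addgt0Pl => e e0; rewrite addr0.
  have M0 : 0 <= M.
    have := fM x0; have x00 : 0 < `|x0|.
      rewrite normr_gt0; apply: contra fx0 => /eqP ->.
      by rewrite -(scale0r (0:H)) fZ mul0r.
    by move=> /(le_trans (normr_ge0 _)); rewrite pmulr_lge0.
  have M1 : 0 < M + 1 by rewrite ltr_wpDl.
  have eM : 0 < e / (M + 1) by rewrite divr_gt0.
  have eE : e / (M + 1) = (complex.Re (e / (M + 1)))%:C%C.
    by rewrite RRe_real // gtr0_real.
  have eM' : 0 < complex.Re (e / (M + 1)) by rewrite -ltcR -eE.
  have [x [fx _] hx] := near 1 _ ltr01 eM'.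
  rewrite -fx -fB; apply: le_trans (fM _) _.
  apply: (@le_trans _ _ ((M + 1) * (e / (M + 1)))).
    rewrite ler_pM // ?lerDl // rnE eE lecR; exact: ltW.
  by rewrite mulrC divfK // gt_eqF.
exists z => // x fx.
suff zd : rn z <= d by rewrite !rnE lecR; apply: le_trans zd (dle _ fx).
apply/ler_addgt0Pl => e e0.
have e2 : 0 < e / 2 by rewrite divr_gt0.
have e3 : 0 < (d + e / 2) ^+ 2 - d ^+ 2.
  by rewrite subr_gt0 ltr_pXn2r // ?nnegrE ?addr_ge0 ?ltrDl // ltW.
have [y [fy hy] hzy] := near _ _ e3 e2.
have : rn z <= rn y + rn (z - y).
  rewrite -lecR rmorphD /= -!rnE -[in leLHS](subrK y z) addrC; exact: ler_normD.
move=> /le_trans; apply.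
rewrite addrC subrK in hy.
have hy' : rn y < d + e / 2.
  by move: hy; rewrite ltr_pXn2r // ?nnegrE ?addr_ge0 // ltW.
apply: (@le_trans _ _ (d + e / 2 + e / 2)); first by rewrite lerD // ltW.
by rewrite -addrA -splitr addrC.
Qed.

Lemma riesz : exists y, forall x, f x = ip x y.
Proof.
have [f0|] := pselect (forall x, f x = 0).
  by exists 0 => x; rewrite ip0r.
move=> /existsNP [x0 /eqP fx0].
have [z fz zmin] := min_norm (ex_intro _ x0 fx0).
have perp k : f k = 0 -> ip k z = 0.
  move=> fk; have [->|k0] := eqVneq k 0; first exact: ip0l.
  have := zmin (z - (ip z k / `|k| ^+ 2) *: k) _.
  rewrite fD -scaleN1r !fZ fk !mulr0 addr0 => /(_ fz).
  rewrite scaleN1r => h.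
  have : `|z| ^+ 2 <= `|z - (ip z k / `|k| ^+ 2) *: k| ^+ 2.
    by rewrite ler_pXn2r // nnegrE.
  rewrite norm_proj // lerDl oppr_ge0 => h2.
  have k2 : 0 < `|k| ^+ 2 by rewrite exprn_gt0 // normr_gt0.
  move: h2; rewrite pmulr_lle0 ?invr_gt0 // => h2.
  have : `|ip z k| ^+ 2 == 0 by rewrite eq_le h2 exprn_ge0.
  by rewrite sqrf_eq0 normr_eq0 => /eqP e; rewrite ipC e conjC0.
have z0 : `|z| ^+ 2 != 0.
  rewrite sqrf_eq0 normr_eq0; apply/eqP => z0; move: fz.
  by rewrite z0 -(scale0r (0:H)) fZ mul0r => /esym/eqP; rewrite oner_eq0.
exists ((`|z| ^+ 2)^-1 *: z) => x.
have := perp (x - f x *: z); rewrite ipBl fD -scaleN1r !fZ fz mulr1 mulN1r subrr.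
move=> /(_ erefl)/eqP; rewrite subr_eq0 ipZl -ip_norm => /eqP e.
rewrite ipZr e fmorphV /= conj_Creal ?rpredX ?normr_real // mulrC.
by rewrite mulfK.
Qed.

End Riesz.
End HilbertTheory.

Section BoundedOperators.
Variables (R : realType) (H : hilbertType R).
Local Notation C := R[i].

Implicit Types x y : H.
Definition bounded_op : {pred (H -> H)} := fun f =>
  `[< linear f /\ exists2 M : C, 0 <= M & forall x, `|f x| <= M * `|x| >].

(* B(H).  The subtype carries the pointwise module structure, and multiplication
   in the ring structure below is composition. *)
Record bop := Bop { bop_fun :> H -> H; _ : bop_fun \in bounded_op }.

HB.instance Definition _ := [isSub for bop_fun].
HB.instance Definition _ := [Choice of bop by <:].

Lemma bounded_op_submod : submod_closed bounded_op.
Proof.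
split; first by apply/asboolP; split; [move=> a x y; rewrite /= scaler0 addr0|
  exists 0 => // x; rewrite mul0r normr0].
move=> a f g /asboolP[fl [M M0 fM]] /asboolP[gl [N N0 gN]]; apply/asboolP; split.
  move=> b x y; rewrite !fctE fl gl !scalerDr !scalerA addrACA [b * a]mulrC.
  by [].
exists (`|a| * M + N); first by rewrite addr_ge0 // mulr_ge0.
move=> x; rewrite !fctE mulrDl -mulrA.
by apply: le_trans (ler_normD _ _) _; rewrite normrZ lerD // ler_wpM2l.
Qed.

HB.instance Definition _ :=
  GRing.isSubmodClosed.Build C (H -> H) bounded_op bounded_op_submod.
HB.instance Definition _ := [SubChoice_isSubLmodule of bop by <:].

Lemma bop_linear (T : bop) : linear T.
Proof. by have /asboolP[] := valP T. Qed.

HB.instance Definition _ (T : bop) :=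
  GRing.isLinear.Build C H H _ T (bop_linear T).

Lemma bop_bounded (T : bop) :
  exists2 M : C, 0 <= M & forall x, `|T x| <= M * `|x|.
Proof. by have /asboolP[] := valP T. Qed.

Lemma bopP (S T : bop) : (forall x, S x = T x) -> S = T.
Proof. by move=> e; apply: val_inj; apply/funext. Qed.

Lemma bop1_subproof : id \in bounded_op.
Proof. by apply/asboolP; split => //; exists 1 => // x; rewrite mul1r. Qed.

Lemma bopM_subproof (S T : bop) : S \o T \in bounded_op.
Proof.
apply/asboolP; split; first by move=> a x y /=; rewrite !linearP.
have [M M0 SM] := bop_bounded S; have [N N0 TN] := bop_bounded T.
exists (M * N) => [|x]; first exact: mulr_ge0.
by apply: le_trans (SM _) _; rewrite -mulrA ler_wpM2l.
Qed.

Definition bop1 := Bop bop1_subproof.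
Definition bopM S T := Bop (bopM_subproof S T).

Lemma bopDE (S T : bop) x : (S + T) x = S x + T x. Proof. by []. Qed.
Lemma bopNE (T : bop) x : (- T) x = - T x. Proof. by []. Qed.
Lemma bopZE a (T : bop) x : (a *: T) x = a *: T x. Proof. by []. Qed.

Fact bopMA : associative bopM. Proof. by move=> S T U; apply: bopP. Qed.
Fact bop1M : left_id bop1 bopM. Proof. by move=> T; apply: bopP. Qed.
Fact bopM1 : right_id bop1 bopM. Proof. by move=> T; apply: bopP. Qed.
Fact bopMDl : left_distributive bopM +%R.
Proof. by move=> S T U; apply: bopP. Qed.
Fact bopMDr : right_distributive bopM +%R.
Proof. by move=> S T U; apply: bopP => x; rewrite /= linearD. Qed.

HB.instance Definition _ := GRing.Zmodule_isPzRing.Build bop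
  bopMA bop1M bopM1 bopMDl bopMDr.

Fact bop_scalerAl a (S T : bop) : a *: (S * T) = a *: S * T.
Proof. exact: bopP. Qed.
Fact bop_scalerAr a (S T : bop) : a *: (S * T) = S * (a *: T).
Proof. by apply: bopP => x; rewrite /= linearZ. Qed.
Lemma bopME (S T : bop) x : (S * T) x = S (T x). Proof. by []. Qed.
Lemma bop1E x : (1 : bop) x = x. Proof. by []. Qed.

Definition is_adj (T S : bop) := forall x y, ip (T x) y = ip x (S y).

Implicit Types S T : bop.

Lemma adj_exists T : exists S, is_adj T S.
Proof.
have [M M0 TM] := bop_bounded T.
have ex y : exists z, forall x, ip (T x) y = ip x z.
  apply: (@riesz _ _ _ _ _ (M * `|y|)) => [x x'|a x|x].
  - by rewrite linearD ipDl.
  - by rewrite linearZ ipZl.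
  - apply: le_trans (cauchy_schwarz _ _) _.
    by rewrite mulrAC ler_wpM2r.
have [S SP] := choice ex.
have Sb : S \in bounded_op.
  apply/asboolP; split.
    by move=> a y z; apply: ip_ext => x; rewrite ipDr ipZr -!SP ipDr ipZr.
  exists M => // y.
  have [->|Sy] := eqVneq (S y) 0; first by rewrite normr0 mulr_ge0.
  have : `|S y| ^+ 2 <= `|S y| * (M * `|y|).
    rewrite -[leLHS]ger0_norm ?exprn_ge0 // ip_norm -SP.
    apply: le_trans (cauchy_schwarz _ _) _.
    by rewrite mulrCA mulrA ler_wpM2r.
  by rewrite expr2 ler_pM2l ?normr_gt0.
by exists (Bop Sb).
Qed.

(* Existence is the Riesz representation theorem (adj_exists), so the default
   value is never used. *)
Definition adj (T : bop) : bop := xget 0 [set S | is_adj T S].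

Lemma adjP T x y : ip (T x) y = ip x (adj T y).
Proof. by have := xgetPex 0 (adj_exists T); apply. Qed.

Lemma adj_uniq T S : (forall x y, ip (T x) y = ip x (S y)) -> adj T = S.
Proof. by move=> h; apply: bopP => y; apply: ip_ext => x; rewrite -adjP h. Qed.

Lemma adjK : involutive adj.
Proof. by move=> T; apply: adj_uniq => x y; rewrite ipC -adjP -ipC. Qed.

Lemma adjM S T : adj (S * T) = adj T * adj S.
Proof. by apply: adj_uniq => x y; rewrite !bopME !adjP. Qed.

Lemma adjD S T : adj (S + T) = adj S + adj T.
Proof. by apply: adj_uniq => x y; rewrite !bopDE ipDl ipDr !adjP. Qed.

Lemma adjZ a T : adj (a *: T) = a^* *: adj T.
Proof. by apply: adj_uniq => x y; rewrite !bopZE ipZl ipZr conjCK adjP. Qed.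

Lemma adj1 : adj 1 = 1.
Proof. exact: adj_uniq. Qed.

Lemma adj0 : adj 0 = 0.
Proof. by apply: adj_uniq => x y; rewrite ip0l ip0r. Qed.

Lemma adjN T : adj (- T) = - adj T.
Proof. by rewrite -scaleN1r adjZ rmorphN1 scaleN1r. Qed.
End BoundedOperators.

(* Inverse semigroups presented as regular semigroups with commuting idempotents;
   dag_uniq gives the uniqueness of the generalized inverse. *)
HB.mixin Record Semigroup_isInverse G & Semigroup G := {
  dag : G -> G;
  mulg_dagK : forall x : G, (x * dag x * x)%g = x;
  dag_mulgK : forall x : G, (dag x * x * dag x)%g = dag x;
  idem_mulgC : forall e f : G, (e * e = e -> f * f = f -> e * f = f * e)%g
}.

#[short(type="invSemigroupType")]
HB.structure Definition InvSemigroup :=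
  {G of Semigroup_isInverse G & Semigroup G}.

Section InvSemigroupTheory.
Local Open Scope group_scope.
Local Open Scope quotient_scope.
Variable G : invSemigroupType.
Implicit Types (v w e f : G).

Lemma idemC e f : e * e = e -> f * f = f -> e * f = f * e.
Proof. exact: idem_mulgC. Qed.

Lemma dag_idemr v : (v * dag v) * (v * dag v) = v * dag v.
Proof. by rewrite mulgA mulg_dagK. Qed.

Lemma dag_ideml v : (dag v * v) * (dag v * v) = dag v * v.
Proof. by rewrite mulgA dag_mulgK. Qed.

Lemma dag_uniq v w : v * w * v = v -> w * v * w = w -> w = dag v.
Proof.
move=> vwv wvw.
have iwv : (w * v) * (w * v) = w * v by rewrite mulgA wvw.
have ivw : (v * w) * (v * w) = v * w by rewrite mulgA vwv.
have e1 : w * v = dag v * v.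
  transitivity ((dag v * v) * (w * v)).
    by rewrite (idemC (dag_ideml v) iwv) -mulgA [v * _]mulgA mulg_dagK.
  by rewrite -mulgA [v * _]mulgA vwv.
have e2 : v * w = v * dag v.
  transitivity ((v * w) * (v * dag v)).
    by rewrite (idemC ivw (dag_idemr v)) mulgA mulg_dagK.
  by rewrite mulgA vwv.
by rewrite -wvw e1 -mulgA e2 mulgA dag_mulgK.
Qed.

Lemma dagK v : dag (dag v) = v.
Proof. by apply/esym/dag_uniq; rewrite ?mulg_dagK ?dag_mulgK. Qed.

Lemma dagM v w : dag (v * w) = dag w * dag v.
Proof.
have c := idemC (dag_ideml v) (dag_idemr w).
apply/esym/dag_uniq.
  transitivity (v * ((w * dag w) * (dag v * v)) * w); first by rewrite !mulgA.
  by rewrite -c !mulgA mulg_dagK -!mulgA [w * _]mulgA mulg_dagK.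
transitivity (dag w * ((dag v * v) * (w * dag w)) * dag v).
  by rewrite !mulgA.
by rewrite c !mulgA dag_mulgK -!mulgA [dag v * _]mulgA dag_mulgK.
Qed.

Lemma idem_dag e : e * e = e -> dag e = e.
Proof. by move=> ee; apply/esym/dag_uniq; rewrite !ee. Qed.

Lemma idem_conj v e : e * e = e -> (v * e * dag v) * (v * e * dag v) = v * e * dag v.
Proof.
move=> ee; have c := idemC ee (dag_ideml v).
have -> : v * e * dag v * (v * e * dag v) = v * (e * (dag v * v)) * (e * dag v).
  by rewrite !mulgA.
rewrite c !mulgA mulg_dagK -[_ * e * e]mulgA ee //.
Qed.

Definition munn : rel G := fun v w =>
  `[< forall e, e * e = e -> v * e * dag v = w * e * dag w >].

Lemma munn_refl : reflexive munn. Proof. by move=> v; apply/asboolP. Qed.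
Lemma munn_sym : symmetric munn.
Proof. by move=> v w; apply/asboolP/asboolP => h e ee; rewrite h. Qed.
Lemma munn_trans : transitive munn.
Proof.
move=> w v u /asboolP vw /asboolP wu; apply/asboolP => e ee.
by rewrite vw ?wu.
Qed.
Canonical munn_equiv := EquivRel munn munn_refl munn_sym munn_trans.

Definition munn_quot := {eq_quot munn_equiv}.
HB.instance Definition _ := Quotient.on munn_quot.
HB.instance Definition _ := Choice.on munn_quot.

Definition munn_pi (v : G) : munn_quot := \pi_munn_quot v.

Lemma munn_piP v w :
  munn_pi v = munn_pi w <-> forall e, e * e = e -> v * e * dag v = w * e * dag w.
Proof.
split; first by move/eqmodP/asboolP.
by move=> h; apply/eqmodP/asboolP.
Qed.

(* The Munn relation is a congruence (munn_piM), so the choice of representatives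
   is immaterial. *)
Definition munn_mul (x y : munn_quot) : munn_quot := munn_pi (repr x * repr y).
Definition munn_dag (x : munn_quot) : munn_quot := munn_pi (dag (repr x)).

Lemma munn_repr (x : munn_quot) : munn_pi (repr x) = x.
Proof. exact: reprK. Qed.

Lemma munn_pi_surj x : exists v, x = munn_pi v.
Proof. by exists (repr x); rewrite munn_repr. Qed.

Lemma munn_piM v w : munn_pi (v * w) = munn_mul (munn_pi v) (munn_pi w).
Proof.
have /munn_piP hv := munn_repr (munn_pi v).
have /munn_piP hw := munn_repr (munn_pi w).
apply/munn_piP => e ee; rewrite !dagM.
have -> (a b : G) : a * b * e * (dag b * dag a) = a * (b * e * dag b) * dag a.
  by rewrite !mulgA.
rewrite -hw // -hv; last exact: idem_conj.
by rewrite !mulgA.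
Qed.

Fact munn_mulA : associative munn_mul.
Proof.
move=> x y z; rewrite -[x]munn_repr -[y]munn_repr -[z]munn_repr.
by rewrite -!munn_piM mulgA.
Qed.

HB.instance Definition _ := isSemigroup.Build munn_quot munn_mulA.

Fact munn_dagK (x : munn_quot) : x * munn_dag x * x = x.
Proof.
by rewrite -[in LHS](munn_repr x) /munn_dag -[LHS]/(munn_mul (munn_mul _ _) _)
  -!munn_piM munn_repr mulg_dagK munn_repr.
Qed.

Fact munn_Kdag (x : munn_quot) : munn_dag x * x * munn_dag x = munn_dag x.
Proof.
rewrite -[x in _ * x * _](munn_repr x) /munn_dag.
by rewrite -[LHS]/(munn_mul (munn_mul _ _) _) -!munn_piM dag_mulgK.
Qed.

Fact munn_idem (x : munn_quot) : x * x = x -> exists2 e, e * e = e & x = munn_pi e.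
Proof.
move=> xx; set v := repr x; set y := munn_dag x.
have pM (a b : G) : munn_pi (a * b) = munn_pi a * munn_pi b by exact: munn_piM.
have xE : x = munn_pi v by rewrite munn_repr.
have yE : y = munn_pi (dag v) by [].
set e := dag v * v; set f := v * dag v.
have ee : e * e = e by exact: dag_ideml.
have ff : f * f = f by exact: dag_idemr.
have eE : munn_pi e = y * x by rewrite pM -xE.
have fE : munn_pi f = x * y by rewrite pM -xE.
have ef : e * f = f * e by exact: idemC.
have gg : e * f * (e * f) = e * f by rewrite {1}ef mulgA -[f * e * e]mulgA ee -ef -mulgA ff.
exists (e * f) => //.
have yef : y = munn_pi (e * f).
  rewrite pM eE fE -mulgA [x * (x * y)]mulgA xx mulgA.
  by rewrite munn_Kdag.
have yy : y * y = y by rewrite yef -pM gg.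
have eq1 : y = x * y * (y * x).
  rewrite {1}yef ef pM eE fE //.
by rewrite -yef [RHS]eq1 mulgA -[x * y * y]mulgA yy; exact/esym/munn_dagK.
Qed.

Fact munn_idemC (x y : munn_quot) : x * x = x -> y * y = y -> x * y = y * x.
Proof.
move=> /munn_idem[e ee ->] /munn_idem[f ff ->].
by rewrite -[LHS]munn_piM -[RHS]munn_piM idemC.
Qed.

HB.instance Definition _ :=
  Semigroup_isInverse.Build munn_quot munn_dagK munn_Kdag munn_idemC.

End InvSemigroupTheory.

Lemma multiplicative_dag (G G' : invSemigroupType) (f : {multiplicative G -> G'})
  (x : G) : f (dag x) = dag (f x).
Proof. by apply: dag_uniq; rewrite -!gmulfM ?mulg_dagK ?dag_mulgK. Qed.

Section VonNeumann.
Variables (R : realType) (H : hilbertType R).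
Local Notation C := R[i].
Local Notation B := (bop H).
Implicit Types (A L : set B) (S T u v w x y : B).

(* The weak-* topology of a von Neumann algebra on H is the restriction of the
   ultraweak topology of B(H), i.e. of the coarsest topology making continuous all
   T |-> \sum_n <T xi_n, eta_n> with (xi_n), (eta_n) square-summable. *)
Definition l2seq := {xi : nat -> H | cvgn (series (fun n => `|xi n| ^+ 2 : C^o))}.

Definition uw_eval T : {ptws (l2seq * l2seq) -> C^o} := fun p =>
  limn (series (fun n => ip (T (sval p.1 n)) (sval p.2 n) : C^o)).

Definition ultraweak := initial_topology uw_eval.

Definition lspan A : set B := [set x | exists n (c : 'I_n -> C) (a : 'I_n -> B),
  (forall i, A (a i)) /\ x = \sum_i c i *: a i].

Definition weakstar_dense A L :=
  L `<=` (closure (A : set ultraweak) : set ultraweak).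

Definition commutant A : set B := [set T | forall S, A S -> T * S = S * T].

(* Dixmier's definition.  Being a commutant, A is automatically a subalgebra
   containing the unit of B(H) (vN1, vND, vNM, vNZ below), so the inclusion
   D `<=` M of two von Neumann algebras is automatically unital. *)
Record von_neumann A : Prop := VonNeumann {
  vN_adj : forall x, A x -> A (adj x);
  vN_bicommutant : commutant (commutant A) = A
}.

Definition projections A : set B := [set p | [/\ A p, p * p = p & adj p = p]].
Definition partial_isometry v := v * adj v * v = v.
Definition unitary u := adj u * u = 1 /\ u * adj u = 1.
Definition unitaries A : set B := [set u | A u /\ unitary u].

Definition GN A L : set B := [set v | [/\ A v, partial_isometry v,
  (forall d, L d -> L (adj v * d * v)) & (forall d, L d -> L (v * d * adj v))]].

(* The order of A is the C*-algebraic one: the positive elements of A are the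
   x^* x with x in A. *)
Definition psd A : set B := [set adj x * x | x in A].

Definition psd_le A x y := psd A (y - x).

Definition alg_lub A (X : set B) s :=
  [/\ A s, (forall x, X x -> psd_le A x s) &
      forall t, A t -> (forall x, X x -> psd_le A x t) -> psd_le A s t].

Definition updirected A (X : set B) :=
  X !=set0 /\ forall x y, X x -> X y -> exists z, [/\ X z, psd_le A x z & psd_le A y z].

(* Preservation of suprema of increasing nets of self-adjoint elements.  The
   increasing net is given by its range X; a supremum s in A makes X bounded. *)
Definition normal_map A L (phi : B -> B) := forall (X : set B) s,
  X `<=` A -> (forall x, X x -> adj x = x) -> updirected A X -> alg_lub A X s ->
  alg_lub L (phi @` X) (phi s).

(* A map defined on a subset of B(H) is represented by a total function on B(H), of
   which only the values on that subset are constrained. *)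
Record cond_exp A L (E : B -> B) : Prop := CondExp {
  ce_fun : forall x, A x -> L (E x);
  ce_add : forall x y, A x -> A y -> E (x + y) = E x + E y;
  ce_scale : forall (a : C) x, A x -> E (a *: x) = a *: E x;
  ce_pos : forall x, psd A x -> psd L (E x);
  ce_id : forall x, L x -> E x = x;
  ce_bimod : forall a x b, L a -> A x -> L b -> E (a * x * b) = a * E x * b
}.

Definition faithful A (E : B -> B) := forall x, psd A x -> E x = 0 -> x = 0.

Record star_iso A L (phi : B -> B) : Prop := StarIso {
  si_bij : set_bij A L phi;
  si_add : forall x y, A x -> A y -> phi (x + y) = phi x + phi y;
  si_scale : forall (a : C) x, A x -> phi (a *: x) = a *: phi x;
  si_mul : forall x y, A x -> A y -> phi (x * y) = phi x * phi y;
  si_adj : forall x, A x -> phi (adj x) = adj (phi x)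
}.

Record cartan_triple (M N D : set B) : Prop := CartanTriple {
  ct_vNM : von_neumann M;
  ct_vNN : von_neumann N;
  ct_vND : von_neumann D;
  ct_sub : D `<=` M;
  ct_abelian : forall x y, D x -> D y -> x * y = y * x;
  ct_regular : weakstar_dense (lspan (GN M D)) M;
  ct_relcomm : N = M `&` commutant D;
  ct_exp : exists E, [/\ cond_exp M N E, faithful M E & normal_map M N E]
}.

Definition corner p A : set B := [set p * x | x in A].

Record regularizer (M N D : set B) (G : set B) : Prop := Regularizer {
  rg_unitary : G `<=` unitaries M;
  rg1 : G 1;
  rgM : forall u v, G u -> G v -> G (u * v);
  rgV : forall u, G u -> G (adj u);
  rg_unitN : unitaries N `<=` G;
  rg_GN : G `<=` GN M D;
  rg_dense : weakstar_dense (lspan G) M;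
  rg_action : exists alpha : B -> B -> B,
    [/\ forall u, G u -> star_iso N N (alpha u),
        forall u v x, G u -> G v -> N x -> alpha (u * v) x = alpha u (alpha v x),
        forall u p, G u -> projections D p ->
          (forall x, corner p D x -> alpha u x = x) ->
          forall x, corner p N x -> alpha u x = x
      & forall u d, G u -> D d -> alpha u d = u * d * adj u]
}.

Definition fulman_condition (M N D : set B) := exists G, regularizer M N D G.

Section vNTheory.
Variables (M : set B) (vM : von_neumann M).

Lemma vN_in x : (forall y, commutant M y -> x * y = y * x) -> M x.
Proof. by move=> h; rewrite -(vN_bicommutant vM). Qed.

Lemma vN_comm x y : M x -> commutant M y -> x * y = y * x.
Proof. by move=> Mx /(_ _ Mx) ->. Qed.

Lemma vN1 : M 1.
Proof. by apply: vN_in => y _; rewrite mul1r mulr1. Qed.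

Lemma vN0 : M 0.
Proof. by apply: vN_in => y _; rewrite mul0r mulr0. Qed.

Lemma vND x y : M x -> M y -> M (x + y).
Proof.
move=> Mx My; apply: vN_in => z hz.
by rewrite mulrDl mulrDr !(vN_comm _ hz).
Qed.

Lemma vNM x y : M x -> M y -> M (x * y).
Proof.
move=> Mx My; apply: vN_in => z hz.
by rewrite -mulrA (vN_comm My hz) !mulrA (vN_comm Mx hz).
Qed.

Lemma vNZ (a : C) x : M x -> M (a *: x).
Proof.
move=> Mx; apply: vN_in => z hz.
by rewrite -bop_scalerAl -bop_scalerAr (vN_comm Mx hz).
Qed.

Lemma vNN x : M x -> M (- x).
Proof. by rewrite -scaleN1r; apply: vNZ. Qed.

Lemma vN_adjE x : M (adj x) = M x.
Proof.
by apply/propext; split=> [/(vN_adj vM)|]; [rewrite adjK|exact: vN_adj].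
Qed.

End vNTheory.

Lemma star_iso_bij A L phi x : star_iso A L phi -> A x -> L (phi x).
Proof. by move=> h; case: (si_bij h) => + _ _; apply. Qed.

Lemma star_iso_inj A L phi x y :
  star_iso A L phi -> A x -> A y -> phi x = phi y -> x = y.
Proof.
by move=> h Ax Ay; case: (si_bij h) => _ /(_ x y) + _; rewrite !inE; apply.
Qed.

Lemma star_iso_surj A L phi y : star_iso A L phi -> L y -> exists2 x, A x & phi x = y.
Proof. by move=> h Ly; case: (si_bij h) => _ _ /(_ _ Ly) []x; exists x. Qed.

Record star_alg A : Prop := StarAlg {
  saD : forall x y, A x -> A y -> A (x + y);
  saM : forall x y, A x -> A y -> A (x * y);
  saN : forall x, A x -> A (- x);
  saA : forall x, A x -> A (adj x)
}.

Lemma star_iso_normal A L phi : star_alg A -> star_iso A L phi -> normal_map A L phi.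
Proof.
move=> sA iso X s XA Xsa _ [As ub lub].
have pD x y : A x -> A y -> phi (x - y) = phi x - phi y.
  move=> Ax Ay; apply/eqP; rewrite eq_sym subr_eq; apply/eqP.
  by rewrite -(si_add iso) ?subrK //; apply: saD => //; apply: saN.
have ple x y : A x -> A y -> psd_le A x y -> psd_le L (phi x) (phi y).
  move=> Ax Ay [z Az zE]; exists (phi z); first exact: (star_iso_bij iso Az).
  by rewrite -(si_adj iso) // -(si_mul iso) ?zE ?pD //; apply: saA.
split; first exact: (star_iso_bij iso As).
  by move=> _ [x Xx <-]; exact: (ple _ _ (XA _ Xx) As (ub _ Xx)).
move=> t /(star_iso_surj iso)[t' At' <-] h; apply: ple => //; apply: lub => // x Xx.
have Ax := XA _ Xx.
have [z Lz zE] := h _ (imageP phi Xx).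
have [z' Az' z'E] := star_iso_surj iso Lz.
exists z' => //; apply: (star_iso_inj iso).
- by apply: saM => //; apply: saA.
- by apply: saD => //; apply: saN.
by rewrite (si_mul iso) ?(si_adj iso) // ?z'E ?zE ?pD //; apply: saA.
Qed.

End VonNeumann.

Section PartialAutomorphisms.
Variables (R : realType) (H : hilbertType R).
Local Notation C := R[i].
Local Notation B := (bop H).

Record central_subalgebra (N D : set B) : Prop := CentralSubalgebra {
  cs_vNN : von_neumann N;
  cs_vND : von_neumann D;
  cs_sub : D `<=` N;
  cs_central : forall d x, D d -> N x -> d * x = x * d
}.

(* The triples (e, alpha, f).  The map alpha : fN -> eN is extended by 0 outside fN,
   so that two elements of pAut are equal iff the triples are. *)
Record pAut (N D : set B) (c : central_subalgebra N D) := PAut {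
  pa_e : B;
  pa_f : B;
  pa_map :> B -> B;
  pa_eP : projections D pa_e;
  pa_fP : projections D pa_f;
  pa_iso : star_iso (corner pa_f N) (corner pa_e N) pa_map;
  pa_normal : normal_map (corner pa_f N) (corner pa_e N) pa_map;
  pa_D : pa_map @` corner pa_f D = corner pa_e D;
  pa_out : forall x, ~ corner pa_f N x -> pa_map x = 0
}.

Section Theory.
Variables (N D : set B) (c : central_subalgebra N D).
Local Notation pA := (pAut c).
Local Notation vN := (cs_vNN c).
Local Notation vD := (cs_vND c).
Implicit Types (p q x y : B) (a b : pA).

HB.instance Definition _ := gen_eqMixin pA.
HB.instance Definition _ := gen_choiceMixin pA.

Lemma proj_in p : projections D p -> D p. Proof. by case. Qed.
Lemma proj_id p : projections D p -> p * p = p. Proof. by case. Qed.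
Lemma proj_N p : projections D p -> N p. Proof. by move/proj_in/(cs_sub c). Qed.

Lemma cornerP p x : projections D p -> corner p N x <-> N x /\ p * x = x.
Proof.
move=> pP; split=> [[y Ny <-]|[Nx px]]; last by exists x.
by rewrite mulrA proj_id //; split=> //; apply: (vNM vN) => //; apply: proj_N.
Qed.

Lemma cornerDP p x : projections D p -> corner p D x <-> D x /\ p * x = x.
Proof.
move=> pP; split=> [[y Ny <-]|[Nx px]]; last by exists x.
by rewrite mulrA proj_id //; split=> //; apply: (vNM vD) => //; apply: proj_in.
Qed.

Lemma corner_D p x : corner p D x -> corner p N x.
Proof. by move=> [y /(cs_sub c) Dy <-]; exists y. Qed.

Lemma corner_self p : projections D p -> corner p N p.
Proof. by move=> pP; apply/cornerP => //; rewrite proj_id //; split=> //; apply: proj_N. Qed.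

Lemma corner_selfD p : projections D p -> corner p D p.
Proof. by move=> pP; apply/cornerDP => //; rewrite proj_id //; split=> //; apply: proj_in. Qed.

Lemma projC p x : projections D p -> N x -> p * x = x * p.
Proof. by move=> /proj_in Dp; apply: (cs_central c). Qed.

Lemma corner_star p : projections D p -> star_alg (corner p N).
Proof.
move=> pP; split=> [x y|x y|x|x]; rewrite !cornerP //.
- by move=> [Nx px] [Ny py]; rewrite mulrDr px py; split=> //; apply: (vND vN).
- by move=> [Nx px] [Ny py]; rewrite mulrA px; split=> //; apply: (vNM vN).
- by move=> [Nx px]; rewrite mulrN px; split=> //; apply: (vNN vN).
move=> [Nx px]; split; first exact: (vN_adj vN).
by rewrite projC //; [rewrite -{1}(_ : adj p = p) -?adjM ?px //; case: pP|
  exact: (vN_adj vN)].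
Qed.

Lemma corner_inj p q : projections D p -> projections D q -> corner p N = corner q N -> p = q.
Proof.
move=> pP qP e.
have : corner q N p by rewrite -e; apply: corner_self.
have : corner p N q by rewrite e; apply: corner_self.
rewrite !cornerP // => -[Nq pq] [Np qp].
by rewrite -qp -{2}pq projC.
Qed.

Lemma projM p q : projections D p -> projections D q -> projections D (p * q).
Proof.
move=> pP qP; have pq : p * q = q * p by apply: projC => //; apply: proj_N.
split; first by apply: (vNM vD); apply: proj_in.
  by rewrite {1}pq mulrA -[q * p * p]mulrA proj_id // -pq -mulrA proj_id.
by case: pP qP => _ _ ep [_ _ eq]; rewrite adjM ep eq.
Qed.

Lemma pa_in a x : corner (pa_f a) N x -> corner (pa_e a) N (a x).
Proof. exact: (star_iso_bij (pa_iso a)). Qed.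

Lemma pa_inj a x y : corner (pa_f a) N x -> corner (pa_f a) N y ->
  a x = a y -> x = y.
Proof. exact: (star_iso_inj (pa_iso a)). Qed.

Lemma pa_surj a y : corner (pa_e a) N y ->
  exists2 x, corner (pa_f a) N x & a x = y.
Proof. exact: (star_iso_surj (pa_iso a)). Qed.

Lemma pa_mul a x y : corner (pa_f a) N x -> corner (pa_f a) N y ->
  a (x * y) = a x * a y.
Proof. exact: (si_mul (pa_iso a)). Qed.

Lemma iso_unit p q phi : projections D p -> projections D q ->
  star_iso (corner p N) (corner q N) phi -> phi p = q.
Proof.
move=> pP qP iso; have pp := corner_self pP.
have [x xp xq] := star_iso_surj iso (corner_self qP).
have [Nx px] := (cornerP x pP).1 xp.
have [Nfp qfp] := (cornerP (phi p) qP).1 (star_iso_bij iso pp).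
rewrite -qfp projC // -[in LHS]xq -(si_mul iso) //.
by rewrite px.
Qed.

Lemma pa_unit a : a (pa_f a) = pa_e a.
Proof. exact: iso_unit (pa_fP a) (pa_eP a) (pa_iso a). Qed.

Lemma pAutP a b : (forall x, corner (pa_f a) N x <-> corner (pa_f b) N x) ->
  (forall x, corner (pa_f a) N x -> a x = b x) -> a = b.
Proof.
move=> dom eqab.
have ef : pa_f a = pa_f b.
  apply: corner_inj; [exact: pa_fP..|].
  by apply/seteqP; split=> x /dom.
have em : (a : B -> B) = b.
  apply/funext => x; have [xa|xa] := pselect (corner (pa_f a) N x); first exact: eqab.
  by rewrite !pa_out -?ef.
have ee : pa_e a = pa_e b by rewrite -!pa_unit em ef.
case: a b ef em ee {dom eqab} => [e f m ? ? ? ? ? ?] [e' f' m' ? ? ? ? ? ?] /=.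
move=> ef em ee; subst e' f' m'; congr PAut; exact: Prop_irrelevance.
Qed.

(* alpha^-1 : eN -> fN, again extended by 0: off eN no x qualifies and xget returns
   its default. *)
Definition pa_inv a : B -> B :=
  fun y => xget 0 [set x | corner (pa_f a) N x /\ a x = y].

Lemma pa_invK a x : corner (pa_f a) N x -> pa_inv a (a x) = x.
Proof.
move=> xa; apply: (@xget_subset1 _ _ _ x) => //.
by move=> y z [ya ey] [za ez]; apply: (pa_inj ya za); rewrite ey ez.
Qed.

Lemma pa_inv_in a y : corner (pa_e a) N y -> corner (pa_f a) N (pa_inv a y).
Proof. by move=> /pa_surj[x xa <-]; rewrite pa_invK. Qed.

Lemma pa_Kinv a y : corner (pa_e a) N y -> a (pa_inv a y) = y.
Proof. by move=> /pa_surj[x xa <-]; rewrite pa_invK. Qed.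

Lemma pa_D_in a x : corner (pa_f a) D x -> corner (pa_e a) D (a x).
Proof. by move=> xa; rewrite -(pa_D a); exists x. Qed.

Lemma pa_inv_D a y : corner (pa_e a) D y -> corner (pa_f a) D (pa_inv a y).
Proof.
rewrite -(pa_D a) => -[x xa <-]; rewrite pa_invK //; exact: corner_D.
Qed.

Fact pa_dag_iso a : star_iso (corner (pa_e a) N) (corner (pa_f a) N) (pa_inv a).
Proof.
have sf := corner_star (pa_fP a).
have iso := pa_iso a.
split.
- split; first exact: pa_inv_in.
    by move=> x y; rewrite !inE => xa ya e; rewrite -(pa_Kinv xa) e pa_Kinv.
  by move=> x xa; exists (a x); [exact: pa_in|exact: pa_invK].
- move=> _ _ /pa_surj[x xa <-] /pa_surj[y ya <-].
  by rewrite -(si_add iso) ?pa_invK //; apply: saD.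
- move=> k _ /pa_surj[x xa <-]; rewrite -(si_scale iso) ?pa_invK //.
  have [z Nz <-] := xa; exists (k *: z); first exact: (vNZ vN).
  by rewrite -bop_scalerAr.
- move=> _ _ /pa_surj[x xa <-] /pa_surj[y ya <-].
  by rewrite -pa_mul ?pa_invK //; apply: saM.
- move=> _ /pa_surj[x xa <-].
  by rewrite -(si_adj iso) ?pa_invK //; apply: saA.
Qed.

Fact pa_dag_normal a : normal_map (corner (pa_e a) N) (corner (pa_f a) N) (pa_inv a).
Proof. exact: (star_iso_normal (corner_star (pa_eP a)) (pa_dag_iso a)). Qed.

Fact pa_dag_D a : pa_inv a @` corner (pa_e a) D = corner (pa_f a) D.
Proof.
apply/seteqP; split=> [_ [y ye <-]|x xa]; first exact: pa_inv_D.
by exists (a x); [exact: pa_D_in|rewrite pa_invK //; exact: corner_D].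
Qed.

Fact pa_dag_out a y : ~ corner (pa_e a) N y -> pa_inv a y = 0.
Proof. by move=> ya; apply: xgetPN => x [xa ax]; apply: ya; rewrite -ax; apply: pa_in. Qed.

Definition pa_dag a : pA := PAut c (pa_fP a) (pa_eP a)
  (pa_dag_iso a) (@pa_dag_normal a) (pa_dag_D a) (@pa_dag_out a).

Section Mul.
Variables a1 a2 : pA.

Definition pa_mul_f := pa_inv a2 (pa_f a1 * pa_e a2).
Definition pa_mul_e := a1 (pa_f a1 * pa_e a2).
Definition pa_mul_map := patch (fun=> 0) (corner pa_mul_f N) (a1 \o a2).

Let f1 := pa_f a1.
Let e2 := pa_e a2.
Let fe_proj : projections D (f1 * e2). Proof. by apply: projM; [exact: pa_fP|exact: pa_eP]. Qed.
Let fe_f1 : corner f1 D (f1 * e2). Proof. by exists e2 => //; case: (pa_eP a2). Qed.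
Let fe_e2 : corner e2 D (f1 * e2).
Proof.
apply/cornerDP; first exact: pa_eP.
split; first exact: proj_in.
rewrite projC; [|exact: pa_eP|exact: proj_N].
by rewrite -mulrA proj_id //; apply: pa_eP.
Qed.

Let im_proj a p : projections D p -> corner (pa_f a) D p -> projections D (a p).
Proof.
move=> [Dp pp sp] pa; have pa' := corner_D pa; split.
- by have [] := (cornerDP _ (pa_eP a)).1 (pa_D_in pa).
- by rewrite -pa_mul // pp.
- by rewrite -(si_adj (pa_iso a)) // sp.
Qed.

Fact pa_mul_eP : projections D pa_mul_e. Proof. exact: im_proj. Qed.

Fact pa_mul_fP : projections D pa_mul_f.
Proof. exact: (@im_proj (pa_dag a2)). Qed.

Fact pa_mul_fcorner : corner (pa_f a2) N pa_mul_f.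
Proof. by apply: pa_inv_in; apply: corner_D. Qed.

Fact pa_mul_fE : a2 pa_mul_f = f1 * e2.
Proof. by apply: pa_Kinv; apply: corner_D. Qed.

Fact pa_mul_dom x :
  corner pa_mul_f N x <-> corner (pa_f a2) N x /\ corner f1 N (a2 x).
Proof.
have f2P := pa_fP a2; have mP := pa_mul_fP; have f1P := pa_fP a1.
split.
  move=> /(cornerP _ mP)[Nx mx].
  have xf2 : corner (pa_f a2) N x.
    apply/cornerP => //; split => //.
    by have /(cornerP _ f2P)[_ h] := pa_mul_fcorner; rewrite -mx mulrA h.
  split => //; rewrite -mx pa_mul //; last exact: pa_mul_fcorner.
  rewrite pa_mul_fE -mulrA; exists (e2 * a2 x) => //.
  apply: (vNM vN); first by apply: proj_N; exact: pa_eP.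
  by have [] := (cornerP _ (pa_eP a2)).1 (pa_in xf2).
move=> [xf2 /(cornerP _ f1P)[Na2x h]].
have [Nx _] := (cornerP _ f2P).1 xf2.
apply/cornerP => //; split => //.
have mc := pa_mul_fcorner.
apply: (@pa_inj a2) => //; first by apply: (saM (corner_star f2P)).
rewrite pa_mul // pa_mul_fE -mulrA.
by have [_ ->] := (cornerP _ (pa_eP a2)).1 (pa_in xf2).
Qed.

Fact pa_mul_mapE x : corner pa_mul_f N x -> pa_mul_map x = a1 (a2 x).
Proof. by move=> h; rewrite /pa_mul_map /patch mem_set. Qed.

Fact pa_mul_in x : corner pa_mul_f N x -> corner pa_mul_e N (a1 (a2 x)).
Proof.
move=> xm; have [xf2 xf1] := (pa_mul_dom x).1 xm.
have [Nx mx] := (cornerP _ pa_mul_fP).1 xm.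
rewrite -mx pa_mul //; last exact: pa_mul_fcorner.
rewrite pa_mul_fE pa_mul //; last exact: corner_D.
exists (a1 (a2 x)) => //.
by have [] := (cornerP _ (pa_eP a1)).1 (pa_in xf1).
Qed.

Fact pa_mul_surj y : corner pa_mul_e N y ->
  exists2 x, corner pa_mul_f N x & a1 (a2 x) = y.
Proof.
move=> /(cornerP _ pa_mul_eP)[Ny ey].
have e1P := pa_eP a1.
have me1 : corner (pa_e a1) N pa_mul_e by apply: pa_in; apply: corner_D.
have ye1 : corner (pa_e a1) N y.
  apply/cornerP => //; split => //.
  by have [_ h] := (cornerP _ e1P).1 me1; rewrite -ey mulrA h.
have [z zf1 zy] := pa_surj ye1.
have fz : f1 * e2 * z = z.
  apply: (@pa_inj a1) => //; first by apply: (saM (corner_star (pa_fP a1))) => //; apply: corner_D.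
  by rewrite pa_mul //; [rewrite zy ey|apply: corner_D].
have [Nz f1z] := (cornerP _ (pa_fP a1)).1 zf1.
have ze2 : corner e2 N z.
  apply/cornerP; first exact: pa_eP.
  by split=> //; rewrite -fz mulrA; have [_ ->] := (cornerDP _ (pa_eP a2)).1 fe_e2.
have [x xf2 xz] := pa_surj ze2.
by exists x; [apply/pa_mul_dom; rewrite xz|rewrite xz].
Qed.

Fact pa_mul_iso : star_iso (corner pa_mul_f N) (corner pa_mul_e N) pa_mul_map.
Proof.
have sa := corner_star pa_mul_fP.
have i1 := pa_iso a1; have i2 := pa_iso a2.
split.
- split.
  + by move=> x xm; rewrite /= pa_mul_mapE //; apply: pa_mul_in.
  + move=> x y; rewrite !inE => xm ym; rewrite !pa_mul_mapE //.
    move: xm ym => /pa_mul_dom[x2 x1] /pa_mul_dom[y2 y1].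
    by move=> /(pa_inj x1 y1)/(pa_inj x2 y2).
  + by move=> y /pa_mul_surj[x xm <-]; exists x => //; apply: pa_mul_mapE.
- move=> x y xm ym; rewrite !pa_mul_mapE //; last exact: (saD sa).
  move: xm ym => /pa_mul_dom[x2 x1] /pa_mul_dom[y2 y1].
  by rewrite (si_add i2) ?(si_add i1).
- move=> k x xm; rewrite !pa_mul_mapE //; last first.
    by have [z Nz <-] := xm; exists (k *: z); [exact: (vNZ vN)|rewrite -bop_scalerAr].
  move: xm => /pa_mul_dom[x2 x1].
  by rewrite (si_scale i2) ?(si_scale i1).
- move=> x y xm ym; rewrite !pa_mul_mapE //; last exact: (saM sa).
  move: xm ym => /pa_mul_dom[x2 x1] /pa_mul_dom[y2 y1].
  by rewrite (si_mul i2) ?(si_mul i1).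
- move=> x xm; rewrite !pa_mul_mapE //; last exact: (saA sa).
  move: xm => /pa_mul_dom[x2 x1].
  by rewrite (si_adj i2) ?(si_adj i1).
Qed.

Fact pa_mul_normal : normal_map (corner pa_mul_f N) (corner pa_mul_e N) pa_mul_map.
Proof. exact: (star_iso_normal (corner_star pa_mul_fP) pa_mul_iso). Qed.

Fact pa_mul_D : pa_mul_map @` corner pa_mul_f D = corner pa_mul_e D.
Proof.
have inD a x : corner (pa_f a) N x -> D x -> D (a x).
  move=> /(cornerP _ (pa_fP a))[_ fx] Dx.
  have /pa_D_in : corner (pa_f a) D x by apply/cornerDP => //; exact: pa_fP.
  by move=> /(cornerDP _ (pa_eP a))[].
have inD' a x : corner (pa_f a) N x -> D (a x) -> D x.
  move=> xa; rewrite -{2}(pa_invK xa).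
  exact: (inD (pa_dag a) _ (pa_in xa)).
apply/seteqP; split=> [_ [x xm <-]|y ym].
  have xN := corner_D xm; rewrite pa_mul_mapE //.
  have [Dx _] := (cornerDP _ pa_mul_fP).1 xm.
  have [x2 x1] := (pa_mul_dom x).1 xN.
  apply/(cornerDP _ pa_mul_eP); split; first exact: (inD a1 _ x1 (inD a2 _ x2 Dx)).
  by have [] := (cornerP _ pa_mul_eP).1 (pa_mul_in xN).
have [x xm xy] := pa_mul_surj (corner_D ym).
exists x; last by rewrite pa_mul_mapE.
have [x2 x1] := (pa_mul_dom x).1 xm.
apply/(cornerDP _ pa_mul_fP); split; last by have [] := (cornerP _ pa_mul_fP).1 xm.
apply: (inD' a2 _ x2); apply: (inD' a1 _ x1); rewrite xy.
by have [] := (cornerDP _ pa_mul_eP).1 ym.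
Qed.

Fact pa_mul_out x : ~ corner pa_mul_f N x -> pa_mul_map x = 0.
Proof. by move=> h; rewrite /pa_mul_map /patch memNset. Qed.

Definition pa_comp : pA := PAut c pa_mul_eP pa_mul_fP
  pa_mul_iso pa_mul_normal pa_mul_D pa_mul_out.

Lemma pa_compE x : corner (pa_f pa_comp) N x -> pa_comp x = a1 (a2 x).
Proof. exact: pa_mul_mapE. Qed.

Lemma pa_compP x : corner (pa_f pa_comp) N x <->
  corner (pa_f a2) N x /\ corner (pa_f a1) N (a2 x).
Proof. exact: pa_mul_dom. Qed.

End Mul.

Fact pa_compA : associative pa_comp.
Proof.
move=> a1 a2 a3.
have d x : corner (pa_f (pa_comp a1 (pa_comp a2 a3))) N x <->
    corner (pa_f (pa_comp (pa_comp a1 a2) a3)) N x.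
  split=> [/pa_compP[/[dup] h1 /pa_compP[h2 h3]]|/pa_compP[h1 /pa_compP[h2 h3]]].
    by rewrite pa_compE // => h4; apply/pa_compP; split=> //; apply/pa_compP.
  have h : corner (pa_f (pa_comp a2 a3)) N x by apply/pa_compP.
  by apply/pa_compP; split => //; rewrite pa_compE.
apply: pAutP => // x xd; have /pa_compP[h1 h2] := xd.
have /pa_compP[h3 h4] := (d x).1 xd.
by rewrite (pa_compE xd) (pa_compE h1) (pa_compE ((d x).1 xd)) (pa_compE h4).
Qed.

HB.instance Definition _ := isSemigroup.Build pA pa_compA.

Lemma pa_dagE a x : corner (pa_e a) N x -> a (pa_dag a x) = x.
Proof. exact: pa_Kinv. Qed.

Fact pa_comp_dagK a : pa_comp (pa_comp a (pa_dag a)) a = a.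
Proof.
have h x : corner (pa_f a) N x -> corner (pa_f (pa_comp a (pa_dag a))) N (a x).
  move=> xa; apply/pa_compP; split; first exact: pa_in.
  by rewrite /= pa_invK.
have d x : corner (pa_f (pa_comp (pa_comp a (pa_dag a)) a)) N x <-> corner (pa_f a) N x.
  by split=> [/pa_compP[]//|xa]; apply/pa_compP; split=> //; apply: h.
by apply: pAutP => // x xd; rewrite pa_compE // pa_compE ?pa_dagE //;
  [apply: pa_in|apply: h]; apply/d.
Qed.

Fact pa_dag_dag a : pa_dag (pa_dag a) = a.
Proof.
by apply: pAutP => //= x xa; rewrite -{1}(pa_invK xa) [LHS](@pa_invK (pa_dag a)) //=;
  apply: pa_in.
Qed.

Fact pa_dag_compK a : pa_comp (pa_comp (pa_dag a) a) (pa_dag a) = pa_dag a.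
Proof. by rewrite -{2}(pa_dag_dag a) pa_comp_dagK. Qed.

Lemma pa_idemP a : pa_comp a a = a <-> forall x, corner (pa_f a) N x -> a x = x.
Proof.
split=> [aa x xa|h].
  have : corner (pa_f (pa_comp a a)) N x by rewrite aa.
  move=> /[dup] xaa /pa_compP[_ axa].
  by apply: (pa_inj axa xa); rewrite -pa_compE // aa.
have d x : corner (pa_f (pa_comp a a)) N x <-> corner (pa_f a) N x.
  by split=> [/pa_compP[]//|xa]; apply/pa_compP; rewrite h.
by apply: pAutP => // x xaa; rewrite pa_compE // !h //; apply/d.
Qed.

Fact pa_idemC a b : pa_comp a a = a -> pa_comp b b = b -> pa_comp a b = pa_comp b a.
Proof.
move=> /pa_idemP ha /pa_idemP hb.
have d x : corner (pa_f (pa_comp a b)) N x <-> corner (pa_f (pa_comp b a)) N x.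
  by split=> /pa_compP[h1]; rewrite ?ha ?hb // => h2; apply/pa_compP; rewrite ?ha ?hb.
apply: pAutP => // x xab; have /pa_compP[h1 h2] := xab.
rewrite (pa_compE xab) (pa_compE ((d x).1 xab)).
by rewrite hb // in h2 *; rewrite ha // hb.
Qed.

HB.instance Definition _ := Semigroup_isInverse.Build pA
  pa_comp_dagK pa_dag_compK pa_idemC.

End Theory.
End PartialAutomorphisms.

Section Extension.
Variables (R : realType) (H : hilbertType R).
Local Notation C := R[i].
Local Notation B := (bop H).

(* The inverse semigroup GN(M, D); the argument c provides what is needed for it to
   be closed under multiplication. *)
Record gn (M N D : set B) (c : cartan_triple M N D) := Gn {
  gn_val :> B;
  gn_valP : gn_val \in GN M D
}.

HB.instance Definition _ (M N D : set B) (c : cartan_triple M N D) :=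
  [isSub for @gn_val M N D c].
HB.instance Definition _ (M N D : set B) (c : cartan_triple M N D) :=
  [Choice of gn c by <:].

Section Theory.
Variables (M N D : set B) (c : cartan_triple M N D).
Local Notation vM := (ct_vNM c).
Local Notation vD := (ct_vND c).
Implicit Types (v w : gn c) (x y d : B).

Lemma gnP v : GN M D v.
Proof. exact: set_mem (gn_valP v). Qed.

Lemma gn_pi v : (v : B) * adj v * v = v. Proof. by case: (gnP v). Qed.
Lemma gn_ipi v : adj v * (v : B) * adj v = adj v.
Proof. by rewrite -[in RHS](gn_pi v) !adjM adjK mulrA. Qed.
Lemma gn_l v d : D d -> D (adj v * d * v). Proof. by case: (gnP v) => _ _ + _; apply. Qed.
Lemma gn_r v d : D d -> D ((v : B) * d * adj v). Proof. by case: (gnP v) => _ _ _; apply. Qed.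
Lemma gn_ini v : D (adj v * v).
Proof. by have := gn_l v (vN1 vD); rewrite mulr1. Qed.
Lemma gn_fin v : D ((v : B) * adj v).
Proof. by have := gn_r v (vN1 vD); rewrite mulr1. Qed.

Lemma gn_iniP v : projections D (adj v * v).
Proof. by split; [exact: gn_ini|rewrite mulrA gn_ipi|rewrite adjM adjK]. Qed.

Lemma gn_finP v : projections D ((v : B) * adj v).
Proof. by split; [exact: gn_fin|rewrite mulrA gn_pi|rewrite adjM adjK]. Qed.

Fact gn_mul_subproof v w : (v : B) * w \in GN M D.
Proof.
apply/mem_set; split.
- by apply: (vNM vM); [case: (gnP v)|case: (gnP w)].
- rewrite /partial_isometry adjM.
  transitivity ((v : B) * (((w : B) * adj w) * (adj v * v)) * w); first by rewrite !mulrA.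
  rewrite (ct_abelian c (gn_fin w) (gn_ini v)) !mulrA gn_pi -!mulrA.
  by rewrite [(w : B) * _]mulrA gn_pi.
- move=> d Dd; rewrite adjM.
  rewrite (_ : _ * _ = adj w * (adj v * d * v) * w); first by apply: gn_l; apply: gn_l.
  by rewrite !mulrA.
- move=> d Dd; rewrite adjM.
  rewrite (_ : _ * _ = (v : B) * ((w : B) * d * adj w) * adj v); first by apply: gn_r; apply: gn_r.
  by rewrite !mulrA.
Qed.

Fact gn_dag_subproof v : adj v \in GN M D.
Proof.
apply/mem_set; split.
- by apply: (vN_adj vM); case: (gnP v).
- by rewrite /partial_isometry adjK gn_ipi.
- by move=> d; rewrite adjK; apply: gn_r.
- by move=> d; rewrite adjK; apply: gn_l.
Qed.

Definition gn_mul v w : gn c := Gn c (gn_mul_subproof v w).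
Definition gn_dag v : gn c := Gn c (gn_dag_subproof v).

Fact gn_mulA : associative gn_mul.
Proof. by move=> u v w; apply: val_inj; rewrite /= mulrA. Qed.

HB.instance Definition _ := isSemigroup.Build (gn c) gn_mulA.

Fact gn_dagK v : gn_mul (gn_mul v (gn_dag v)) v = v.
Proof. by apply: val_inj; rewrite /= gn_pi. Qed.

Fact gn_Kdag v : gn_mul (gn_mul (gn_dag v) v) (gn_dag v) = gn_dag v.
Proof. by apply: val_inj; rewrite /= gn_ipi. Qed.

Lemma gn_idemP v : gn_mul v v = v -> projections D v.
Proof.
move=> /(congr1 (@gn_val _ _ _ c)) /= vv.
have aa : adj v * adj v = adj v by rewrite -adjM vv.
have pq : (adj v * v) * ((v : B) * adj v) = adj v.
  by rewrite mulrA -[adj v * v * v]mulrA vv -mulrA -[RHS]gn_ipi mulrA.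
have qp := ct_abelian c (gn_ini v) (gn_fin v).
have sa : adj v = v.
  rewrite -[RHS]adjK -[in RHS]pq !adjM !adjK -[LHS]pq.
  exact: qp.
split=> //; rewrite -sa -pq; apply: (vNM vD); [exact: gn_ini|exact: gn_fin].
Qed.

Fact gn_idemC v w : gn_mul v v = v -> gn_mul w w = w -> gn_mul v w = gn_mul w v.
Proof.
move=> /gn_idemP[Dv _ _] /gn_idemP[Dw _ _].
by apply: val_inj; apply: (ct_abelian c).
Qed.

HB.instance Definition _ := Semigroup_isInverse.Build (gn c)
  gn_dagK gn_Kdag gn_idemC.

Lemma cartan_central : central_subalgebra N D.
Proof.
split; [exact: ct_vNN c|exact: ct_vND c| |].
  move=> d Dd; rewrite (ct_relcomm c); split; first exact: (ct_sub c).
  by move=> x Dx; apply: (ct_abelian c).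
by move=> d x Dd; rewrite {1}(ct_relcomm c) => -[_ /(_ _ Dd)].
Qed.
Local Notation cc := cartan_central.
Local Notation vN := (ct_vNN c).

Lemma ad_in v x : N x -> N ((v : B) * x * adj v).
Proof.
rewrite {1 2}(ct_relcomm c) => -[Mx xD].
have Mv : M v by case: (gnP v).
split; first by apply: (vNM vM); [exact: (vNM vM)|exact: (vN_adj vM)].
move=> d Dd.
have e1 : d * v = (v : B) * (adj v * d * v).
  by rewrite -[in LHS](gn_pi v) mulrA (ct_abelian c Dd (gn_fin v)) !mulrA.
have e2 : adj v * d = (adj v * d * v) * adj v.
  rewrite -[in LHS](gn_ipi v) -!mulrA [(v : B) * (adj v * d)]mulrA.
  by rewrite (ct_abelian c (gn_fin v) Dd) !mulrA.
have Dw := gn_l v Dd; set w := adj v * d * v in e1 e2 Dw.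
by rewrite -mulrA e2 [RHS]mulrA [in RHS]mulrA e1 -[(v : B) * w * x]mulrA -(xD _ Dw) !mulrA.
Qed.

Definition ad_map v : B -> B :=
  patch (fun=> 0) (corner (adj v * v) N) (fun x => (v : B) * x * adj v).

Lemma ad_mapE v x : corner (adj v * v) N x -> ad_map v x = (v : B) * x * adj v.
Proof. by move=> h; rewrite /ad_map /patch mem_set. Qed.

Fact ad_iso v :
  star_iso (corner (adj v * v) N) (corner ((v : B) * adj v) N) (ad_map v).
Proof.
have iP := gn_iniP v; have fP := gn_finP v; have sa := corner_star cc iP.
have xK x : corner (adj v * v) N x -> adj v * ((v : B) * x * adj v) * v = x.
  move=> /(cornerP cc _ iP)[Nx px].
  by rewrite !mulrA px -mulrA -(projC cc iP Nx).
have dagin x : N x -> N (adj v * x * v).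
  by move=> /(ad_in (gn_dag v)) /=; rewrite adjK.
split.
- split.
  + move=> x xi; rewrite /= ad_mapE //.
    have [Nx _] := (cornerP cc x iP).1 xi.
    by apply/(cornerP cc _ fP); rewrite !mulrA gn_pi; split => //; apply: ad_in.
  + move=> x y; rewrite !inE => xi yi; rewrite !ad_mapE // => e.
    by rewrite -(xK x) // e xK.
  + move=> y /(cornerP cc _ fP)[Ny qy].
    have xi : corner (adj v * v) N (adj v * y * v).
      by apply/(cornerP cc _ iP); rewrite !mulrA gn_ipi; split => //; apply: dagin.
    exists (adj v * y * v) => //; rewrite ad_mapE // !mulrA qy.
    by rewrite -mulrA -(projC cc fP Ny).
- move=> x y xi yi; rewrite !ad_mapE //; last exact: (saD sa).
  by rewrite mulrDr mulrDl.
- move=> k x xi; rewrite !ad_mapE //; first by rewrite -bop_scalerAr -bop_scalerAl.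
  by have [z Nz <-] := xi; exists (k *: z); [exact: (vNZ vN)|rewrite -bop_scalerAr].
- move=> x y xi yi; rewrite !ad_mapE //; last exact: (saM sa).
  have [Ny py] := (cornerP cc y iP).1 yi.
  by rewrite -{1}py !mulrA.
- move=> x xi; rewrite !ad_mapE //; last exact: (saA sa).
  by rewrite !adjM adjK mulrA.
Qed.

Fact ad_normal v :
  normal_map (corner (adj v * v) N) (corner ((v : B) * adj v) N) (ad_map v).
Proof. exact: (star_iso_normal (corner_star cc (gn_iniP v)) (ad_iso v)). Qed.

Fact ad_D v : ad_map v @` corner (adj v * v) D = corner ((v : B) * adj v) D.
Proof.
have iP := gn_iniP v; have fP := gn_finP v.
apply/seteqP; split=> [_ [x xi <-]|y /(cornerDP cc _ fP)[Dy qy]].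
  rewrite ad_mapE; last exact: (corner_D cc).
  have [Dx px] := (cornerDP cc x iP).1 xi.
  by apply/(cornerDP cc _ fP); rewrite !mulrA gn_pi; split => //; apply: gn_r.
have xi : corner (adj v * v) D (adj v * y * v).
  by apply/(cornerDP cc _ iP); rewrite !mulrA gn_ipi; split => //; apply: gn_l.
exists (adj v * y * v) => //; rewrite ad_mapE; last exact: (corner_D cc).
by rewrite !mulrA qy -mulrA -(projC cc fP (cs_sub cc Dy)).
Qed.

Fact ad_out v x : ~ corner (adj v * v) N x -> ad_map v x = 0.
Proof. by move=> h; rewrite /ad_map /patch memNset. Qed.

Definition ad v : pAut cartan_central := PAut cartan_central
  (gn_finP v) (gn_iniP v) (ad_iso v) (@ad_normal v) (ad_D v) (@ad_out v).

Lemma adE v x : corner (adj v * v) N x -> ad v x = (v : B) * x * adj v.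
Proof. exact: ad_mapE. Qed.

(* By theta_pi below, the value does not depend on the representative of s. *)
Definition theta (s : munn_quot (gn c)) : munn_quot (pAut cartan_central) :=
  munn_pi (ad (repr s)).

Fact proj_gn_subproof p : projections D p -> p \in GN M D.
Proof.
move=> [Dp pp sp]; apply/mem_set; rewrite /GN /partial_isometry /= sp.
by split; rewrite ?pp //; first exact: (ct_sub c); move=> d Dd; do 2!apply: (vNM vD) => //.
Qed.

Lemma ad_conj_dom v (e : pAut cc) x : (e * e = e)%g ->
  corner (pa_f (ad v * e * dag (ad v))%g) N x <->
  N x /\ (v : B) * pa_f e * adj v * x = x.
Proof.
move=> /pa_idemP ee; have iP := gn_iniP v; have fP := gn_finP v; have gP := pa_fP e.
set g := pa_f e in ee gP *.
have key y : corner (adj v * v) N y -> ad v y = x ->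
    (v : B) * g * adj v * x = ad v (g * y).
  move=> yi <-; have [Ny py] := (cornerP cc y iP).1 yi.
  rewrite adE // adE; last first.
    apply/(cornerP cc _ iP); rewrite mulrA -(projC cc gP); last exact: (proj_N cc iP).
    by rewrite -mulrA py; split=> //; apply: (vNM vN) => //; apply: (proj_N cc gP).
  by rewrite -[in RHS]py !mulrA.
have gy y : corner (adj v * v) N y -> corner (adj v * v) N (g * y).
  move=> /(cornerP cc y iP)[Ny py].
  apply/(cornerP cc _ iP); rewrite mulrA -(projC cc gP); last exact: (proj_N cc iP).
  by rewrite -mulrA py; split=> //; apply: (vNM vN) => //; apply: (proj_N cc gP).
split.
  move=> /pa_compP[xe /pa_compP[ye _]].
  have yi : corner (adj v * v) N (dag (ad v) x) by exact: (pa_in (a := dag (ad v))).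
  have yx : ad v (dag (ad v) x) = x by exact: (pa_dagE (a := ad v)).
  split; first by have [] := (cornerP cc x fP).1 xe.
  rewrite (key _ yi yx).
  by have [_ ->] := (cornerP cc _ gP).1 ye.
move=> [Nx gx].
have xe : corner (pa_e (ad v)) N x.
  by apply/(cornerP cc _ fP); split => //; rewrite -[in LHS]gx !mulrA gn_pi.
have [y yi yx] := pa_surj xe.
have dyx : dag (ad v) x = y by rewrite -yx; exact: pa_invK.
have ye : corner g N y.
  have := key _ yi yx; rewrite gx -{1}yx => /(pa_inj yi (gy _ yi)) e1.
  by apply/(cornerP cc _ gP); split; [case: ((cornerP cc y iP).1 yi)|].
apply/pa_compP; split => //; rewrite dyx.
by apply/pa_compP; split => //; rewrite ee.
Qed.

Lemma theta_pi v : theta (munn_pi v) = munn_pi (ad v).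
Proof.
set w := repr (munn_pi v); have /munn_piP wv : munn_pi w = munn_pi v by exact: munn_repr.
apply/munn_piP => e ee.
have gE : forall u : gn c, (gn_val (u * Gn c (proj_gn_subproof (pa_fP e)) * dag u)%g) =
  (u : B) * pa_f e * adj u by [].
have gi : (Gn c (proj_gn_subproof (pa_fP e)) * Gn c (proj_gn_subproof (pa_fP e)) =
   Gn c (proj_gn_subproof (pa_fP e)))%g.
  by apply: val_inj; case: (pa_fP e).
have wvE : (w : B) * pa_f e * adj w = (v : B) * pa_f e * adj v.
  by rewrite -!gE wv.
have /pa_idemP iw := idem_conj (ad w) ee.
have /pa_idemP iv := idem_conj (ad v) ee.
have dom x : corner (pa_f (ad w * e * dag (ad w))%g) N x <->
    corner (pa_f (ad v * e * dag (ad v))%g) N x.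
  by rewrite !ad_conj_dom // wvE.
by apply: pAutP => // x xw; rewrite iw // iv //; apply/dom.
Qed.

End Theory.
End Extension.

(* Main.v *)
From HB Require Import structures.
From mathcomp Require Import all_boot all_order all_algebra.
From mathcomp Require Import complex ring lra.
From mathcomp Require Import all_classical all_reals topology normedtype sequences.
Require Import Defs.

Set Implicit Arguments.
Unset Strict Implicit.
Unset Printing Implicit Defensive.

Import Order.TTheory GRing.Theory Num.Theory.
Import numFieldNormedType.Exports.

Local Open Scope classical_set_scope.
Local Open Scope ring_scope.

(** Throughout, M, N, D is the triple, E a faithful normal expectation of M onto N, and q
the quotient by the Munn relation.

_From a lift to a regularizer._  Take for the regularizer the group of all unitaries
of M that normalize D, and put alpha_u := alpha (q u).  Its span is dense
([unorm_dense]): a normalizer v splits as a sum of v e, which lies in N, and three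
pieces v p_i such that v moves p_i to an orthogonal projection
([fixed_displaced_decomp]); each of these four partial isometries is cut out of a
unitary normalizer by a projection of D.  Two partial automorphisms of N have the
same class in the fundamental quotient exactly when they agree on the projections of
D ([pa_munn_intro], [pa_munn_proj]).  Hence pi o alpha = theta gives
alpha_u p = u p u^* for the projections p of D, and then (ii), because D is the norm
closed span of its projections ([projections_total]) and star-isomorphisms are
contractive.  For (i): if alpha_u is trivial on D p, then u p and p have the same
class in S, and alpha maps the class of p to an idempotent, the identity of p N
([alpha_of_fix]).

_From a regularizer to a lift._  Let G be a regularizer with action al, and v a
normalizer of D.  A pair (u, p) with u in G and p <= v^* v a projection of D is
compatible with v if u and v conjugate D p in the same way.  The automorphism wanted
for v has to be al_u on such a piece p.  On the overlap of two pieces conjugation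
by u'^* u is trivial on D, so by (i) the choices al_u and al_u' agree there
([compat_agree]).  The pieces have supremum v^* v ([compat_total]), so the al_u glue
to a unique isomorphism from v^* v N to v v^* N ([glue_ex], [glued_uniq]).  By
uniqueness it depends only on the class of v and is multiplicative in v
([induced_munn], [induced_mul]), and it has the same class as ad_v since both
conjugate D by v.

The pieces are exhaustive for the following reason ([cover]).  Let r be a nonzero
projection of D below v^* v.  Some u in G has E (u^* v r) <> 0, and the decomposition
above, applied to u^* v r, gives a nonzero projection e of D, below r after cutting,
with u^* v e in N.  Were E (u^* v r) = 0 for all u in G, then v r would be orthogonal
to the weak-* dense star-algebra span G with respect to the inner products
<E (y^* x) xi, xi>; that forces v r = 0 ([orth_functional], [orth_expectation]).
Weak-* density does not give density in these inner products at once.  The projection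
P onto the closure of span G commutes with G; to see that it commutes with all of M
one tests on vectors dominated by vector states of H, where the matrix coefficients of
P are weak-* continuous, and these vectors are total by an argument of Dixmier
([dominated_ex], [dominated_total]).  Then P w = w P 1 = w for every w in M. *)

(** * Norms and bounds of operators *)

Lemma inv_small (R : realType) (e : R) : 0 < e -> exists k, forall n, (k <= n)%N -> n.+1%:R^-1 <= e.
Proof.
move=> e0; exists (Num.Def.truncn e^-1) => n kn.
rewrite -[leRHS]invrK lef_pV2 ?posrE ?invr_gt0 //.
have := truncnS_gt e^-1 => /ltW /le_trans; apply.
by rewrite ler_nat ltnS.
Qed.

Lemma addr_fix (V : zmodType) (x y : V) : x + y = x -> y = 0.
Proof. by rewrite -[in RHS](addr0 x) => /addrI. Qed.

Lemma conjc_real (R : realType) (r : R) : (r%:C%C)^* = r%:C%C :> R[i].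
Proof. by rewrite conj_Creal // realE (lecR 0 r) (lecR r 0) -realE num_real. Qed.

Section RealNorm.
Variables (R : realType) (V : normedModType R[i]).
Implicit Types (x y : V).

(** The norm of a normed module over R[i] takes values in R[i]; nrm is the same norm with
values in R, where the order is total. *)
Definition nrm x : R := complex.Re `|x|.

Lemma nrmE x : `|x| = (nrm x)%:C%C.
Proof. by rewrite /nrm RRe_real // normr_real. Qed.

Lemma nrm_ge0 x : 0 <= nrm x.
Proof. by rewrite -lecR -nrmE; apply: normr_ge0. Qed.

Lemma nrm0 : nrm 0 = 0.
Proof. by apply: complexI; rewrite -nrmE normr0. Qed.

Lemma nrm_eq0 x : nrm x = 0 -> x = 0.
Proof. by move=> h; apply/eqP; rewrite -normr_eq0 nrmE h. Qed.

Lemma nrmD x y : nrm (x + y) <= nrm x + nrm y.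
Proof. by rewrite -lecR rmorphD /= -!nrmE; exact: ler_normD. Qed.

Lemma nrmN x : nrm (- x) = nrm x.
Proof. by rewrite /nrm normrN. Qed.

Lemma nrmB x y : nrm (x - y) = nrm (y - x).
Proof. by rewrite -nrmN opprB. Qed.

Lemma nrmZ (a : R[i]) x : nrm (a *: x) = complex.Re `|a| * nrm x.
Proof.
apply: complexI; rewrite [RHS]rmorphM -!nrmE normrZ; congr (_ * _).
by apply/esym/RRe_real; exact: normr_real.
Qed.

Lemma nrmZr (r : R) x : nrm (r%:C%C *: x) = `|r| * nrm x.
Proof.
rewrite nrmZ; congr (_ * _); rewrite normc_def /=.
by rewrite expr0n addr0 sqrtr_sqr.
Qed.

Lemma nrm_tri x y z : nrm (x - z) <= nrm (x - y) + nrm (y - z).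
Proof. by have := nrmD (x - y) (y - z); rewrite addrA subrK. Qed.

Lemma nrm_small x : (forall e, 0 < e -> nrm x <= e) -> x = 0.
Proof.
move=> h; apply: nrm_eq0; apply/eqP; rewrite eq_le nrm_ge0 andbT.
by apply/ler_addgt0Pl => e e0; rewrite addr0; apply: h.
Qed.

Lemma nrm_le_lim x (k : R) : (forall e, 0 < e -> nrm x <= k + e) -> nrm x <= k.
Proof. by move=> h; apply/ler_addgt0Pl => e /h; rewrite addrC. Qed.

End RealNorm.

Section RealNormComplete.
Variables (R : realType) (V : completeNormedModType R[i]).

Lemma nrm_complete (u : nat -> V) :
  (forall e : R, 0 < e -> exists k, forall n m, (k <= n)%N -> (k <= m)%N -> nrm (u n - u m) <= e) ->
  exists l, forall e : R, 0 < e -> exists k, forall n, (k <= n)%N -> nrm (l - u n) <= e.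
Proof.
move=> uC.
have /cauchy_cvg ul : cauchy (u @ \oo).
  apply/cauchy_ballP => e e0.
  have eR : e = (complex.Re e)%:C%C by rewrite RRe_real // gtr0_real.
  have e0' : 0 < complex.Re e by rewrite -ltcR -eR.
  have [k kP] := uC (complex.Re e / 2) ltac:(lra).
  exists ([set x | exists2 n, (k <= n)%N & u n = x], [set x | exists2 n, (k <= n)%N & u n = x]).
    by split; exists k => // n /= kn; exists n.
  move=> [x y] /= [[n kn <-] [m km <-]] /=; rewrite -ball_normE /ball_ /= nrmE eR ltcR.
  by apply: (le_lt_trans (kP _ _ kn km)); lra.
exists (lim (u @ \oo)) => e e0.
have [k _ kP] : \forall n \near \oo, ball (lim (u @ \oo)) e%:C%C (u n).
  by apply: ul; apply: nbhsx_ballx; rewrite ltcR.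
exists k => n /kP; rewrite -ball_normE /ball_ /= nrmE ltcR => h; exact: ltW.
Qed.
End RealNormComplete.

Section HilbertNorm.
Variables (R : realType) (H : hilbertType R).
Implicit Types (x y z : H) (S T : bop H) (k : R).

Lemma ipxx x : ip x x = (nrm x ^+ 2)%:C%C.
Proof. by rewrite rmorphXn /= -nrmE ip_norm. Qed.

Lemma ipxx_ge0 x : 0 <= ip x x.
Proof. by rewrite ipxx lecR; exact: sqr_ge0. Qed.

Lemma nrmc_le (c : R[i]) (r : R) : (nrm (c : R[i]^o) <= r) = (`|c| <= r%:C%C).
Proof. by rewrite -lecR -(nrmE (c : R[i]^o)). Qed.

Lemma cauchy_schwarz_nrm x y : nrm (ip x y : R[i]^o) <= nrm x * nrm y.
Proof. by rewrite nrmc_le rmorphM /= -!nrmE; exact: cauchy_schwarz. Qed.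

Lemma sqr_nrm_le x y z : ip x x = ip y z -> nrm x ^+ 2 <= nrm y * nrm z.
Proof.
move=> e; rewrite -lecR -ipxx -(ger0_norm (ipxx_ge0 x)) e rmorphM /= -!nrmE.
exact: cauchy_schwarz.
Qed.

Definition opb k T := forall x, nrm (T x) <= k * nrm x.

Lemma opb_ex T : exists2 k, 0 <= k & opb k T.
Proof.
have [K K0 KP] := bop_bounded T.
have KE : K = (complex.Re K)%:C%C by rewrite RRe_real // ger0_real.
exists (complex.Re K); first by rewrite -lecR -KE.
by move=> x; rewrite -lecR rmorphM /= -KE -!nrmE.
Qed.

Lemma opb_ex1 T : exists2 k, 0 < k & opb k T.
Proof.
have [k k0 kT] := opb_ex T; exists (k + 1); first lra.
by move=> x; rewrite mulrDl; have := kT x; have := nrm_ge0 x; lra.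
Qed.

Lemma opbM k l S T : 0 <= k -> opb k S -> opb l T -> opb (k * l) (S * T).
Proof.
move=> k0 hS hT x; rewrite bopME; apply: le_trans (hS _) _.
by rewrite -mulrA ler_wpM2l.
Qed.

Lemma opbD k l S T : opb k S -> opb l T -> opb (k + l) (S + T).
Proof.
move=> hS hT x; rewrite bopDE mulrDl; apply: le_trans (nrmD _ _) _.
exact: lerD.
Qed.

Lemma opbZ k (r : R) T : opb k T -> opb (`|r| * k) (r%:C%C *: T).
Proof. by move=> hT x; rewrite bopZE nrmZr -mulrA ler_wpM2l. Qed.

Lemma opbN k T : opb k T -> opb k (- T).
Proof. by move=> hT x; rewrite bopNE nrmN. Qed.

Lemma opb_adj k T : opb k T -> opb k (adj T).
Proof.
move=> hT x.
have [h0|h0] := eqVneq (nrm (adj T x)) 0.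
  by have := hT x; have := nrm_ge0 (T x); rewrite h0; lra.
have hp : 0 < nrm (adj T x) by rewrite lt_neqAle eq_sym h0 nrm_ge0.
have e : nrm (adj T x) ^+ 2 <= nrm (T (adj T x)) * nrm x.
  by apply: sqr_nrm_le; rewrite [RHS]adjP.
have : nrm (adj T x) ^+ 2 <= k * nrm (adj T x) * nrm x.
  by apply: (le_trans e); apply: ler_wpM2r => //; exact: nrm_ge0.
by rewrite expr2 mulrAC [k * _ * _]mulrC ler_pM2l.
Qed.

Definition contr T := forall x, nrm (T x) <= nrm x.

Lemma contrP T : contr T <-> opb 1 T.
Proof. by split => h x; have := h x; rewrite mul1r. Qed.

Lemma contrM S T : contr S -> contr T -> contr (S * T).
Proof. by move=> hS hT x; apply: le_trans (hS _) (hT _). Qed.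

Lemma contr_adj T : contr T -> contr (adj T).
Proof. by rewrite !contrP; exact: opb_adj. Qed.

Lemma contr_proj T : T * T = T -> adj T = T -> contr T.
Proof.
move=> TT sT x; have [h0|h0] := eqVneq (nrm (T x)) 0; first by rewrite h0 nrm_ge0.
have hp : 0 < nrm (T x) by rewrite lt_neqAle eq_sym h0 nrm_ge0.
have : nrm (T x) ^+ 2 <= nrm (T x) * nrm x.
  by apply: sqr_nrm_le; rewrite -[in RHS]TT bopME [RHS]adjP sT.
by rewrite expr2 ler_pM2l.
Qed.

Lemma contr_scale k T : 0 < k -> opb k T -> contr ((k^-1)%:C%C *: T).
Proof.
move=> k0 kT x; have := opbZ k^-1 kT x; rewrite ger0_norm ?invr_ge0 ?(ltW k0) //.
by rewrite mulVf ?gt_eqF // mul1r.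
Qed.

Lemma adj1 : adj (1 : bop H) = 1.
Proof. by apply: adj_uniq. Qed.

Lemma ip_sa_real T x : adj T = T -> ip (T x) x \is Num.real.
Proof. by move=> sT; rewrite CrealE; apply/eqP; rewrite -ipC -{1}sT -adjP. Qed.

Lemma adjB S T : adj (S - T) = adj S - adj T.
Proof. by rewrite adjD adjN. Qed.

Lemma adjZr (r : R) T : adj (r%:C%C *: T) = r%:C%C *: adj T.
Proof. by rewrite adjZ conjc_real. Qed.

Lemma bopBE S T x : (S - T) x = S x - T x. Proof. by []. Qed.

End HilbertNorm.

(** * Approximate Riesz representation in a semi-inner product space *)

Section SemiInner.
Variables (R : realType) (V : lmodType R[i]).
Local Notation C := R[i].
Implicit Types (S : set V) (s : V -> V -> C) (f : V -> C).

Record subspace S : Prop := Subspace {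
  ss0 : S 0;
  ssP : forall (a : C) x y, S x -> S y -> S (a *: x + y)
}.

(** The axioms are required on S only: the main example is (x, y) |-> om (y^* x) for a
functional om that is positive on M and arbitrary on the rest of B(H). *)
Record semi_inner S s : Prop := SemiInner {
  si_sub : subspace S;
  si_lin : forall a x y z, S x -> S y -> S z -> s (a *: x + y) z = a * s x z + s y z;
  si_conj : forall x y, S x -> S y -> s x y = (s y x)^*;
  si_ge0 : forall x, S x -> 0 <= s x x
}.

Lemma ssZ S (a : C) x : subspace S -> S x -> S (a *: x).
Proof. by move=> hS Sx; rewrite -[_ *: _]addr0; apply: ssP => //; apply: ss0. Qed.

Lemma ssD S x y : subspace S -> S x -> S y -> S (x + y).
Proof. by move=> hS Sx Sy; rewrite -[x]scale1r; apply: ssP. Qed.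

Lemma ssB S x y : subspace S -> S x -> S y -> S (x - y).
Proof. by move=> hS Sx Sy; rewrite addrC -scaleN1r; apply: ssP. Qed.

Section Form.
Variables (S : set V) (s : V -> V -> C).
Hypothesis ips : semi_inner S s.
Let subS := si_sub ips.

Definition sq x : R := complex.Re (s x x).

Lemma sqE x : S x -> s x x = (sq x)%:C%C.
Proof. by move=> Sx; rewrite /sq RRe_real // ger0_real // (si_ge0 ips). Qed.

Lemma sq_ge0 x : S x -> 0 <= sq x.
Proof. by move=> Sx; rewrite -lecR -sqE // (si_ge0 ips). Qed.

Lemma si0l z : S z -> s 0 z = 0.
Proof.
move=> Sz; have S0 := ss0 subS; have := si_lin ips 1 S0 S0 Sz.
by rewrite scaler0 addr0 mul1r => /esym/addr_fix.
Qed.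

Lemma siZl a x z : S x -> S z -> s (a *: x) z = a * s x z.
Proof.
move=> Sx Sz; have := si_lin ips a Sx (ss0 subS) Sz.
by rewrite addr0 si0l // addr0.
Qed.

Lemma siDl x y z : S x -> S y -> S z -> s (x + y) z = s x z + s y z.
Proof. by move=> Sx Sy Sz; have := si_lin ips 1 Sx Sy Sz; rewrite scale1r mul1r. Qed.

Lemma siBl x y z : S x -> S y -> S z -> s (x - y) z = s x z - s y z.
Proof.
move=> Sx Sy Sz; rewrite addrC -scaleN1r (si_lin ips) // mulN1r addrC //.
Qed.

Lemma siZr a x z : S x -> S z -> s x (a *: z) = a^* * s x z.
Proof.
move=> Sx Sz; rewrite (si_conj ips) //; last exact: ssZ.
by rewrite siZl // rmorphM /= -(si_conj ips).
Qed.

Lemma siDr x y z : S x -> S y -> S z -> s x (y + z) = s x y + s x z.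
Proof.
move=> Sx Sy Sz; rewrite (si_conj ips) //; last exact: ssD.
by rewrite siDl // rmorphD /= -!(si_conj ips).
Qed.

Lemma siBr x y z : S x -> S y -> S z -> s x (y - z) = s x y - s x z.
Proof.
move=> Sx Sy Sz; rewrite (si_conj ips) //; last exact: ssB.
by rewrite siBl // rmorphB /= -!(si_conj ips).
Qed.

Definition msq (c : C) : R := nrm (c : C^o) ^+ 2.

Lemma msqE (c : C) : c * c^* = (msq c)%:C%C.
Proof. by rewrite -normCK rmorphXn /= -nrmE. Qed.

Lemma msq_ge0 c : 0 <= msq c. Proof. exact: sqr_ge0. Qed.

Lemma Re_conj (c : C) : complex.Re c^* = complex.Re c. Proof. by case: c. Qed.

Lemma sq_add x y (r : R) : S x -> S y ->
  sq (x + (- (r%:C%C * s x y)) *: y) = sq x - 2 * r * msq (s x y) + r ^+ 2 * msq (s x y) * sq y.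
Proof.
move=> Sx Sy; set g := s x y.
have Sy' a : S (a *: y) by exact: ssZ.
apply: complexI; rewrite -sqE; last exact: ssD.
rewrite siDl ?siDr //; try exact: ssD.
rewrite !siZl // !siZr // -/g [s y x](si_conj ips) // -/g !sqE //.
move: (msq g) (msqE g) => m mE.
rewrite !(rmorphM, rmorphN, rmorphB, rmorphD, rmorphXn, rmorph1, rmorph_nat) /= -mE.
rewrite conjc_real; ring.
Qed.

(** The discriminant step of the Cauchy-Schwarz inequality: take r = 1 / Y. *)
Lemma quad_le (G d Y : R) : 0 <= G -> 0 <= Y ->
  (forall r, 0 <= d - 2 * r * G + r ^+ 2 * G * Y) -> G <= d * Y.
Proof.
move=> G0 Y0 h; have [Yz|Yn] := eqVneq Y 0.
  rewrite Yz mulr0; have [->//|Gn] := eqVneq G 0.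
  have := h ((d + 1) / (2 * G)); rewrite Yz mulr0 addr0.
  suff -> : 2 * ((d + 1) / (2 * G)) * G = d + 1 by lra.
  by field.
have Yp : 0 < Y by rewrite lt_neqAle eq_sym Yn.
have := h Y^-1; have -> : d - 2 * Y^-1 * G + Y^-1 ^+ 2 * G * Y = d - G / Y by field.
by rewrite subr_ge0 ler_pdivrMr.
Qed.

Lemma form_CS x y : S x -> S y -> msq (s x y) <= sq x * sq y.
Proof.
move=> Sx Sy; apply: quad_le; [exact: msq_ge0|exact: sq_ge0|move=> r].
rewrite -sq_add //; apply: sq_ge0; apply: ssD => //; exact: ssZ.
Qed.

Variable f : V -> C.
Hypothesis f_lin : forall a x y, S x -> S y -> f (a *: x + y) = a * f x + f y.
Variable K : R.
Hypothesis fK : forall x, S x -> msq (f x) <= K * sq x.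

(** z represents f up to the error d.  An exact representative need not exist, (S, s)
being neither separated nor complete. *)
Definition approx (d : R) z := S z /\ forall x, S x -> msq (f x - s x z) <= d * sq x.

Let Q z := sq z - 2 * complex.Re (f z).

Lemma msq_ReIm (c : C) : msq c = complex.Re c ^+ 2 + complex.Im c ^+ 2.
Proof.
rewrite /msq -[nrm _]/(complex.Re (`|c| : C)) normc_def /=; case: c => a b /=.
by rewrite sqr_sqrtr ?addr_ge0 ?sqr_ge0.
Qed.

Lemma Re_msq (c : C) : complex.Re c ^+ 2 <= msq c.
Proof. by rewrite msq_ReIm lerDl sqr_ge0. Qed.

Lemma Q_ge z : S z -> - `|K| <= Q z.
Proof.
move=> Sz; have h := le_trans (Re_msq _) (fK Sz).
have X0 := sq_ge0 Sz; rewrite /Q; set X := sq z in h X0 *.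
set r := complex.Re (f z) in h *.
have h2 : r ^+ 2 <= `|K| * X.
  by apply: (le_trans h); apply: ler_wpM2r => //; exact: ler_norm.
have K0 : 0 <= `|K| by [].
have : (2 * r) ^+ 2 <= (X + `|K|) ^+ 2.
  have := sqr_ge0 (X - `|K|); set k := `|K| in h2 *; nra.
move=> h3; have : 2 * r <= X + `|K|.
  rewrite leNgt; apply/negP => lt; set k := `|K| in K0 h3 lt; nra.
lra.
Qed.

(** An almost minimizer z of Q does the job: a step from z in the direction g^* x,
with g = f x - s x z, lowers Q by at most d. *)
Lemma approx_riesz (d : R) : 0 < d -> exists z, approx d z.
Proof.
move=> d0; set E := [set Q z | z in S].
have hE : has_inf E.
  split; first by exists (Q 0), 0 => //; apply: ss0.
  by exists (- `|K|) => _ [z Sz <-]; exact: Q_ge.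
have [_ [z Sz <-] Qz] := inf_adherent d0 hE.
exists z; split=> // x Sx.
set g := f x - s x z.
have f0 : f 0 = 0.
  have S0 := ss0 subS; have := f_lin 1 S0 S0.
  by rewrite scaler0 addr0 mul1r => /esym/addr_fix.
have fZ a y : S y -> f (a *: y) = a * f y.
  by move=> Sy; have := f_lin a Sy (ss0 subS); rewrite addr0 f0 addr0.
apply: quad_le; [exact: msq_ge0|exact: sq_ge0|move=> r].
pose t : C := r%:C%C * g^*.
have Stx : S (t *: x) by exact: ssZ.
have h : Q z - d <= Q (z + t *: x).
  have : inf E <= Q (z + t *: x).
    by apply: ge_inf; [case: hE|exists (z + t *: x) => //; exact: ssD].
  by move: Qz; lra.
suff e : Q (z + t *: x) = Q z - 2 * r * msq g + r ^+ 2 * msq g * sq x by move: h; rewrite e; lra.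
have fe : f (z + t *: x) = f z + t * f x by rewrite addrC f_lin // addrC.
have rc := conjc_real r.
have se : s (z + t *: x) (z + t *: x) = s z z + (t * s x z + (t * s x z)^*) + (r ^+ 2 * msq g * sq x)%:C%C.
  rewrite siDl ?siDr //; try exact: ssD.
  rewrite siZl // siZl // !siZr // [s z x](si_conj ips) // (sqE Sx).
  move: (msq g) (msqE g) => m mE.
  rewrite /t !(rmorphM, rmorphXn) /= -mE conjCK rc; ring.
have Ret : complex.Re (t * g) = r * msq g.
  by rewrite /t -mulrA [_^* * g]mulrC msqE -[LHS]/(complex.Re (_ * _)) -rmorphM.
rewrite /Q /sq fe se !raddfD /= [complex.Re (_^*)]Re_conj.
rewrite (_ : t * s x z = t * f x - t * g); last by rewrite /g; ring.
rewrite raddfB /= Ret; ring.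
Qed.

Lemma msqD (a b : C) : msq (a + b) <= 2 * (msq a + msq b).
Proof.
rewrite /msq; have := nrmD (a : C^o) b; have := nrm_ge0 (a : C^o); have := nrm_ge0 (b : C^o).
have := nrm_ge0 (a + b : C^o); set p := nrm _; set q := nrm _; set r := nrm _.
move=> *; have := sqr_ge0 (q - r); nra.
Qed.

Lemma msqN (a : C) : msq (- a) = msq a.
Proof. by rewrite /msq (nrmN (a : C^o)). Qed.

(** Approximate representatives of f for errors tending to 0 form a Cauchy net. *)
Lemma approx_close d d' z z' : 0 <= d -> 0 <= d' -> approx d z -> approx d' z' -> sq (z - z') <= 2 * (d + d').
Proof.
move=> d0 d0' [Sz hz] [Sz' hz']; have Sx : S (z - z') by exact: ssB.
set x := z - z' in Sx *; have X0 := sq_ge0 Sx.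
have e : s x x = - (f x - s x z) + (f x - s x z') by rewrite siBr //; ring.
have h : sq x ^+ 2 <= 2 * (d + d') * sq x.
  have -> : sq x ^+ 2 = msq (s x x).
    by rewrite sqE // msq_ReIm /= expr0n addr0.
  rewrite e; apply: le_trans (msqD _ _) _; rewrite msqN.
  have := hz _ Sx; have := hz' _ Sx; nra.
have [->|Xn] := eqVneq (sq x) 0; first lra.
have Xp : 0 < sq x by rewrite lt_neqAle eq_sym Xn.
by move: h; rewrite expr2 ler_pM2r.
Qed.

End Form.
End SemiInner.

(** * Strong limits of bounded monotone nets *)

Section Nets.
Variables (R : realType) (H : hilbertType R).
Local Notation B := (bop H).

Record directed (I : Type) (X : set I) (le : I -> I -> Prop) : Prop := Directed {
  dir_ex : X !=set0;
  dir_refl : forall i, X i -> le i i;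
  dir_trans : forall i j l, X i -> X j -> X l -> le i j -> le j l -> le i l;
  dir_ub : forall i j, X i -> X j -> exists l, [/\ X l, le i l & le j l]
}.

(** Strong operator convergence of the net y to Y, tested on finitely many vectors at a
time. *)
Definition slim (I : Type) (X : set I) (le : I -> I -> Prop) (y : I -> B) (Y : B) :=
  forall (xs : seq H) (e : R), 0 < e -> exists i, X i /\
    forall j, X j -> le i j -> forall x, x \in xs -> nrm (Y x - y j x) <= e.

(** The function phi x increases along the net and is bounded, so it oscillates little
beyond some index, and so does y x by hypothesis.  Increasing nets of projections, the
iteration for square roots and the gluing of automorphisms all have this form. *)
Lemma monotone_net (I : Type) (X : set I) (le : I -> I -> Prop) (y : I -> B)
    (k : R) (phi : H -> I -> R) (b : H -> R) :
  directed X le -> 0 <= k -> (forall i, X i -> opb k (y i)) ->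
  (forall x i, X i -> phi x i <= b x) ->
  (forall x i j, X i -> X j -> le i j -> nrm (y j x - y i x) ^+ 2 <= phi x j - phi x i) ->
  exists2 Y, opb k Y & slim X le y Y.
Proof.
move=> dX k0 yk phib ymon.
have osc x (e : R) : 0 < e -> exists2 i, X i & forall j, X j -> le i j -> nrm (y j x - y i x) <= e.
  move=> e0; set E := [set phi x i | i in X].
  have hE : has_sup E.
    split; first by have [i Xi] := dir_ex dX; exists (phi x i), i.
    by exists (b x) => _ [i Xi <-]; exact: phib.
  have e2 : 0 < e ^+ 2 by rewrite exprn_gt0.
  have [_ [i Xi <-] hi] := sup_adherent e2 hE.
  exists i => // j Xj ij.
  have hj : phi x j <= sup E by apply: ub_le_sup; [case: hE|exists j].
  have := ymon x i j Xi Xj ij.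
  have := nrm_ge0 (y j x - y i x); set d := nrm _ => d0 hd.
  rewrite leNgt; apply/negP => lt; nra.
have lim1 x : exists l, forall e : R, 0 < e ->
    exists2 i, X i & forall j, X j -> le i j -> nrm (l - y j x) <= e.
  have ex n : exists i, X i /\ forall j, X j -> le i j -> nrm (y j x - y i x) <= n.+1%:R^-1.
    by have [|i Xi hi] := osc x n.+1%:R^-1; [rewrite invr_gt0|exists i].
  have [idx idxP] := choice ex.
  have [|l lP] := @nrm_complete _ H (fun n => y (idx n) x).
    move=> e e0; have [k1 k1P] := @inv_small R (e / 2) ltac:(lra).
    exists k1 => n m kn km; have [Xn hn] := idxP n; have [Xm hm] := idxP m.
    have [l [Xl nl ml]] := dir_ub dX Xn Xm.
    apply: le_trans (nrm_tri _ (y l x) _) _; rewrite [nrm (y (idx n) x - _)]nrmB.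
    apply: le_trans (lerD (le_trans (hn _ Xl nl) (k1P _ kn)) (le_trans (hm _ Xl ml) (k1P _ km))) _.
    lra.
  exists l => e e0; have [k1 k1P] := @inv_small R (e / 2) ltac:(lra).
  have [k2 k2P] := lP (e / 2) ltac:(lra).
  pose n := maxn k1 k2; have [Xn hn] := idxP n.
  exists (idx n) => // j Xj nj; apply: le_trans (nrm_tri _ (y (idx n) x) _) _.
  rewrite [nrm (y (idx n) x - _)]nrmB.
  apply: le_trans (lerD (k2P n (leq_maxr _ _)) (le_trans (hn _ Xj nj) (k1P n (leq_maxl _ _)))) _.
  lra.
have [ell ellP] := choice lim1.
have ellS (xs : seq H) (e : R) : 0 < e -> exists i, X i /\
    forall j, X j -> le i j -> forall x, x \in xs -> nrm (ell x - y j x) <= e.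
  move=> e0; elim: xs => [|x xs [i [Xi hi]]]; first by have [i Xi] := dir_ex dX; exists i.
  have [i' Xi' hi'] := ellP x e e0.
  have [l [Xl il i'l]] := dir_ub dX Xi Xi'.
  exists l; split=> // j Xj lj z; rewrite inE => /orP[/eqP ->|zxs].
    by apply: hi' => //; apply: (dir_trans dX Xi' Xl Xj).
  by apply: hi => //; apply: (dir_trans dX Xi Xl Xj).
have ell_k x : nrm (ell x) <= k * nrm x.
  apply: nrm_le_lim => e e0; have [i [Xi hi]] := ellS [:: x] e e0.
  have := hi i Xi (dir_refl dX Xi) x (mem_head _ _).
  have := yk i Xi x; have := nrmD (ell x - y i x) (y i x); rewrite subrK; lra.
have ellb : ell \in @bounded_op R H.
  apply/asboolP; split.
    move=> a x x'; apply/subr0_eq; apply: nrm_small => e e0.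
    set m := complex.Re `|a|; have m0 : 0 <= m by exact: nrm_ge0 (a : R[i]^o).
    have e1 : 0 < e / (m + 2) by rewrite divr_gt0 //; lra.
    have [i [Xi hi]] := ellS [:: a *: x + x'; x; x'] _ e1.
    have h z := hi i Xi (dir_refl dX Xi) z.
    have h1 := h (a *: x + x') (mem_head _ _).
    have h2 := h x ltac:(by rewrite !inE eqxx orbT).
    have h3 := h x' ltac:(by rewrite !inE eqxx !orbT).
    have -> : ell (a *: x + x') - (a *: ell x + ell x') =
      (ell (a *: x + x') - y i (a *: x + x')) - (a *: (ell x - y i x) + (ell x' - y i x')).
      rewrite [y i (a *: x + x')]linearP scalerBr (_ : a *: ell x - _ + _ = a *: ell x + ell x' - (a *: y i x + y i x')).
        by rewrite opprB subrKA.
      by rewrite opprD addrACA.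
    apply: le_trans (nrmD _ _) _; rewrite nrmN.
    apply: (@le_trans _ _ (e / (m + 2) + (m * (e / (m + 2)) + e / (m + 2)))).
      apply: lerD => //; apply: le_trans (nrmD _ _) _; apply: lerD => //.
      by rewrite nrmZ; apply: ler_wpM2l.
    suff -> : e / (m + 2) + (m * (e / (m + 2)) + e / (m + 2)) = e by [].
    by field; lra.
  exists k%:C%C => [|x]; first by rewrite (lecR 0 k).
  by rewrite !nrmE -rmorphM lecR.
by exists (Bop ellb).
Qed.

(** The closure of S in the strong operator topology. *)
Definition sclosure (S : set B) (Y : B) := forall (xs : seq H) (e : R), 0 < e ->
  exists2 T, S T & forall x, x \in xs -> nrm (Y x - T x) <= e.

Lemma slim_closure (I : Type) (X : set I) le y Y (S : set B) :
  directed X le -> slim X le y Y -> (forall i, X i -> S (y i)) -> sclosure S Y.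
Proof.
move=> dX hY yS xs e e0; have [i [Xi hi]] := hY xs e e0.
by exists (y i); [exact: yS|move=> x xx; exact: (hi i Xi (dir_refl dX Xi))].
Qed.

Lemma bop_small (T : B) : (forall x e, 0 < e -> nrm (T x) <= e) -> T = 0.
Proof. by move=> h; apply: bopP => x; apply: nrm_small => e; exact: h. Qed.

Lemma nrm_op_small (T : B) e : 0 < e -> exists2 d, 0 < d & forall x, nrm x <= d -> nrm (T x) <= e.
Proof.
move=> e0; have [k k0 kT] := opb_ex1 T; exists (e / k); first exact: divr_gt0.
move=> x hx; apply: le_trans (kT x) _.
by rewrite mulrC -ler_pdivlMr.
Qed.

Lemma sclosure_comm (S : set B) Y T : sclosure S Y -> (forall y, S y -> y * T = T * y) -> Y * T = T * Y.
Proof.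
move=> hY hS; apply/subr0_eq; apply: bop_small => x e e0.
have [d d0 dP] := @nrm_op_small T (e / 2) ltac:(lra).
have m0 : 0 < Num.min d (e / 2) by rewrite lt_min d0 /=; lra.
have [y Sy hy] := hY [:: x; T x] _ m0.
have h1 := hy x ltac:(by rewrite !inE eqxx).
have h2 := hy (T x) ltac:(by rewrite !inE eqxx orbT).
rewrite bopBE !bopME.
have -> : Y (T x) - T (Y x) = (Y (T x) - y (T x)) - T (Y x - y x).
  by rewrite linearB /= -[T (y x)]bopME -(hS _ Sy) bopME opprB addrA subrK.
apply: le_trans (nrmD _ _) _; rewrite nrmN.
have := dP (Y x - y x) ltac:(by apply: le_trans h1 _; rewrite ge_min lexx).
have : nrm (Y (T x) - y (T x)) <= e / 2 by apply: le_trans h2 _; rewrite ge_min lexx orbT.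
lra.
Qed.

Lemma vN_sclosure (M S : set B) Y : von_neumann M -> S `<=` M -> sclosure S Y -> M Y.
Proof.
move=> vM SM hY; apply: (vN_in vM) => T hT.
by apply: (sclosure_comm hY) => y /SM My; exact: (vN_comm My hT).
Qed.

Lemma sclosure_mul0 (S : set B) Y T : sclosure S Y -> (forall y, S y -> T * y = 0) -> T * Y = 0.
Proof.
move=> hY hS; apply: bop_small => x e e0; rewrite bopME.
have [d d0 dP] := nrm_op_small T e0.
have [y Sy /(_ x (mem_head _ _)) hy] := hY [:: x] _ d0.
have := dP _ hy.
by rewrite linearB /= -[T (y x)]bopME hS // subr0.
Qed.

Lemma sclosure_0mul (S : set B) Y T : sclosure S Y -> (forall y, S y -> y * T = 0) -> Y * T = 0.
Proof.
move=> hY hS; apply: bop_small => x e e0; rewrite bopME.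
have [y Sy /(_ (T x) (mem_head _ _))] := hY [:: T x] _ e0.
by rewrite -[y (T x)]bopME hS // subr0.
Qed.

Lemma nrm_ip_small (x : H) e : 0 < e -> exists2 d, 0 < d &
  forall z, nrm z <= d -> nrm (ip z x : R[i]^o) <= e /\ nrm (ip x z : R[i]^o) <= e.
Proof.
move=> e0; have k0 : 0 < nrm x + 1 by have := nrm_ge0 x; lra.
exists (e / (nrm x + 1)); first exact: divr_gt0.
move=> z; rewrite ler_pdivlMr // mulrDr mulr1 => hz.
have := cauchy_schwarz_nrm z x; have := cauchy_schwarz_nrm x z.
have := nrm_ge0 z; rewrite [nrm x * _]mulrC; split; lra.
Qed.

Lemma sclosure_ip_ge0 (S : set B) Y x : sclosure S Y -> (forall y, S y -> 0 <= ip (y x) x) ->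
  adj Y = Y -> 0 <= ip (Y x) x.
Proof.
move=> hY hS sY.
have Yr := ip_sa_real x sY.
have YE : ip (Y x) x = (complex.Re (ip (Y x) x))%:C%C by rewrite RRe_real.
rewrite YE (lecR 0); apply/ler_addgt0Pl => e e0.
have [d d0 dP] := nrm_ip_small x e0.
have [y Sy /(_ x (mem_head _ _)) hy] := hY [:: x] _ d0.
have [h _] := dP _ hy.
rewrite ipBl in h.
have h2 : 0 <= complex.Re (ip (y x) x).
  have := hS _ Sy; rewrite -{1}(RRe_real (ger0_real (hS _ Sy))) (lecR 0); exact.
have : complex.Re (ip (y x) x - ip (Y x) x) <= e.
  apply: le_trans h; rewrite -(nrmN (_ - _ : R[i]^o)) opprB.
  rewrite -[nrm _]/(complex.Re (`|_| : R[i])) normc_def /=.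
  apply: le_trans (ler_norm _) _; rewrite -sqrtr_sqr ler_wsqrtr // lerDl; exact: sqr_ge0.
rewrite raddfB /=; lra.
Qed.

Lemma sclosure_sa (S : set B) Y : sclosure S Y -> (forall y, S y -> adj y = y) -> adj Y = Y.
Proof.
move=> hY hS; apply: adj_uniq => x z; apply/subr0_eq.
apply: (@nrm_small _ R[i]^o) => e e0.
have [d1 d10 d1P] := @nrm_ip_small z (e / 2) ltac:(lra).
have [d2 d20 d2P] := @nrm_ip_small x (e / 2) ltac:(lra).
have m0 : 0 < Num.min d1 d2 by rewrite lt_min d10.
have [y Sy hy] := hY [:: x; z] _ m0.
have h1 := hy x ltac:(by rewrite !inE eqxx).
have h2 := hy z ltac:(by rewrite !inE eqxx orbT).
have -> : ip (Y x) z - ip x (Y z) = ip (Y x - y x) z - ip x (Y z - y z).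
  by rewrite ipBl ipBr [ip (y x) z]adjP (hS _ Sy) opprB addrA subrK.
apply: le_trans (nrmD _ _) _; rewrite nrmN.
have [|h3 _] := d1P (Y x - y x); first by apply: le_trans h1 _; rewrite ge_min lexx.
have [|_ h4] := d2P (Y z - y z); first by apply: le_trans h2 _; rewrite ge_min lexx orbT.
lra.
Qed.

Lemma sclosure_idem (S : set B) Y k : 0 < k -> sclosure S Y -> (forall y, S y -> y * y = y /\ opb k y) ->
  Y * Y = Y.
Proof.
move=> k0 hY hS; apply/subr0_eq; apply: bop_small => x e e0.
have m0 : 0 < e / (k + 2) by rewrite divr_gt0 //; lra.
have [y Sy hy] := hY [:: x; Y x] _ m0.
have h1 := hy x ltac:(by rewrite !inE eqxx).
have h2 := hy (Y x) ltac:(by rewrite !inE eqxx orbT).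
have [yy ky] := hS _ Sy.
rewrite bopBE !bopME.
have -> : Y (Y x) - Y x = (Y (Y x) - y (Y x)) + y (Y x - y x) - (Y x - y x).
  by rewrite linearB /= -[y (y x)]bopME yy addrA subrK opprB addrA subrK.
apply: le_trans (nrmD _ _) _; rewrite nrmN.
have := nrmD (Y (Y x) - y (Y x)) (y (Y x - y x)).
have := ky (Y x - y x).
have : k * nrm (Y x - y x) <= k * (e / (k + 2)) by apply: ler_wpM2l => //; exact: ltW.
have : (k + 2) * (e / (k + 2)) = e by field; lra.
rewrite mulrDl; lra.
Qed.

End Nets.

(** * Square roots *)

Section Spectral.
Variables (R : realType) (H : hilbertType R).
Local Notation B := (bop H).
Local Notation C := R[i].
Implicit Types (a c S T : B) (A M : set B).

(** For self-adjoint a this is the von Neumann algebra generated by a. *)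
Definition bicomm a : set B := commutant (commutant [set a]).

Lemma commutant_adj A x : (forall y, A y -> A (adj y)) -> commutant A x -> commutant A (adj x).
Proof.
move=> hA hx y Ay; rewrite -[LHS]adjK -[RHS]adjK; congr adj.
by rewrite !adjM adjK (hx _ (hA _ Ay)).
Qed.

Lemma bicomm_sub M a : von_neumann M -> M a -> bicomm a `<=` M.
Proof.
move=> vM Ma x hx; apply: (vN_in vM) => y hy; apply: hx => _ ->.
exact: hy.
Qed.

Lemma bicomm_comm a x T : bicomm a x -> T * a = a * T -> x * T = T * x.
Proof. by move=> hx hT; apply: hx => _ ->. Qed.

Lemma bicomm_self a : bicomm a a.
Proof. by move=> T hT; rewrite (hT _ erefl). Qed.

Lemma bicomm_abel a x y : bicomm a x -> bicomm a y -> x * y = y * x.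
Proof.
move=> hx hy; apply: (bicomm_comm hx).
by apply: (bicomm_comm hy).
Qed.

Lemma vN_bicomm a : adj a = a -> von_neumann (bicomm a).
Proof.
move=> sa; split=> [x|].
  apply: commutant_adj => y; apply: commutant_adj => z /= ->; exact: sa.
apply/seteqP; split=> [x hx T hT|x hx T hT]; first by apply: hx => S hS; exact/esym/hS.
exact/esym/hT.
Qed.

(** Positivity as a form; for a self-adjoint element of a von Neumann algebra it gives a
square root in that algebra (psdP). *)
Definition fpos T := forall x, 0 <= ip (T x) x.

Lemma ip_adj_mul T x : ip ((adj T * T) x) x = ip (T x) (T x).
Proof. by rewrite bopME adjP adjK. Qed.

Lemma fpos_adj_mul T : fpos (adj T * T).
Proof. by move=> x; rewrite ip_adj_mul ipxx_ge0. Qed.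

Lemma fpos_sqr T : adj T = T -> fpos (T * T).
Proof. by move=> sT; rewrite -{1}sT; exact: fpos_adj_mul. Qed.

Lemma fposD S T : fpos S -> fpos T -> fpos (S + T).
Proof. by move=> hS hT x; rewrite bopDE ipDl addr_ge0. Qed.

Lemma fposZ (r : R) T : 0 <= r -> fpos T -> fpos (r%:C%C *: T).
Proof. by move=> r0 hT x; rewrite bopZE ipZl mulr_ge0 // (lecR 0 r). Qed.

Lemma psd_fpos A T : psd A T -> fpos T.
Proof. by move=> [x _ <-]; exact: fpos_adj_mul. Qed.

Lemma psd_sa A T : psd A T -> adj T = T.
Proof. by move=> [x _ <-]; rewrite adjM adjK. Qed.

(** T - T^2 = T (1 - T) T + (1 - T) T (1 - T). *)
Lemma fpos_sqr_le T x : adj T = T -> fpos T -> fpos (1 - T) -> ip (T x) (T x) <= ip (T x) x.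
Proof.
move=> sT pT qT; rewrite -subr_ge0.
suff -> : ip (T x) x - ip (T x) (T x) =
    ip ((1 - T) (T x)) (T x) + ip (T ((1 - T) x)) ((1 - T) x) by rewrite addr_ge0.
rewrite !bopBE !bop1E [T (x - T x)]linearB /= !(ipBl, ipBr) [ip (T (T x)) x]adjP sT; ring.
Qed.

Lemma fpos1_contr T : adj T = T -> fpos T -> fpos (1 - T) -> contr T.
Proof.
move=> sT pT qT x.
have h : nrm (T x) ^+ 2 <= nrm x ^+ 2.
  rewrite -lecR -!ipxx; apply: le_trans (fpos_sqr_le x sT pT qT) _.
  by have := qT x; rewrite bopBE bop1E ipBl subr_ge0.
by rewrite ler_pXn2r ?nnegrE ?nrm_ge0 // in h.
Qed.

Lemma contr_fpos T : adj T = T -> contr T -> fpos (1 - T * T).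
Proof.
move=> sT cT x; rewrite bopBE bop1E ipBl subr_ge0 bopME adjP sT !ipxx lecR.
by rewrite ler_pXn2r ?nnegrE ?nrm_ge0.
Qed.

Lemma contr_fposD T : adj T = T -> contr T -> fpos (1 - T).
Proof.
move=> sT cT x; rewrite bopBE bop1E ipBl subr_ge0.
have r := ip_sa_real x sT.
apply: le_trans (real_ler_norm r) _; apply: le_trans (cauchy_schwarz _ _) _.
rewrite ipxx !nrmE -rmorphM lecR expr2; apply: ler_wpM2r => //; exact: nrm_ge0.
Qed.

Section Sqrt.
Variable c : B.
Hypotheses (sc : adj c = c) (cc : contr c).

Let half : C := (2^-1 : R)%:C%C.

(** The iteration y' = (c + y^2) / 2 with fixed point 1 - sqrt (1 - c). *)
Fixpoint sq_it n : B := if n is n'.+1 then half *: (c + sq_it n' * sq_it n') else 0.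
(** The iteration sq_it for the scalar c = 1; it dominates sq_it and its increments. *)
Fixpoint sq_eta n : R := if n is n'.+1 then 2^-1 * (1 + sq_eta n' * sq_eta n') else 0.

Let halfD T : half *: T + half *: T = T.
Proof.
rewrite -scalerDl /half -rmorphD /= (_ : 2^-1 + 2^-1 = 1 :> R) ?rmorph1 ?scale1r //.
by field.
Qed.

Let half_norm : `|2^-1 : R| = 2^-1.
Proof. by rewrite ger0_norm // invr_ge0. Qed.

Lemma sq_eta_bd n : 0 <= sq_eta n /\ sq_eta n <= 1.
Proof. elim: n => [|n [h0 h1]] /=; first by lra. split; nra. Qed.

Lemma sq_itP n : [/\ bicomm c (sq_it n), adj (sq_it n) = sq_it n & opb (sq_eta n) (sq_it n)].
Proof.
have vA := vN_bicomm sc.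
elim: n => [|n [bn sn on]] /=.
  by split; [exact: (vN0 vA)|exact: adj0|move=> x; rewrite nrm0 mul0r].
split.
- apply: (vNZ vA); apply: (vND vA); first exact: bicomm_self.
  exact: (vNM vA).
- by rewrite adjZr adjD adjM sn sc.
move=> x; have [h0 h1] := sq_eta_bd n.
have := opbZ (2^-1) (opbD (iffLR (contrP c) cc) (opbM h0 on on)) x.
by rewrite half_norm.
Qed.

Lemma sq_it_comm n m : sq_it n * sq_it m = sq_it m * sq_it n.
Proof.
have [hn _ _] := sq_itP n; have [hm _ _] := sq_itP m; exact: (bicomm_abel hn hm).
Qed.

Lemma sq_itS n : sq_it n.+1 = half *: (c + sq_it n * sq_it n). Proof. by []. Qed.
Lemma sq_etaS n : sq_eta n.+1 = 2^-1 * (1 + sq_eta n * sq_eta n). Proof. by []. Qed.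

Lemma sq_it_step n : opb (sq_eta n.+1 - sq_eta n) (sq_it n.+1 - sq_it n).
Proof.
elim: n => [|n IH].
  rewrite sq_itS sq_etaS !subr0 !mul0r !addr0.
  by have := opbZ (2^-1) (iffLR (contrP c) cc); rewrite half_norm.
have [h0 h1] := sq_eta_bd n; have [k0 k1] := sq_eta_bd n.+1.
have [_ _ o1] := sq_itP n; have [_ _ o2] := sq_itP n.+1.
have -> : sq_it n.+2 - sq_it n.+1 = half *: ((sq_it n.+1 + sq_it n) * (sq_it n.+1 - sq_it n)).
  rewrite [X in X - _]sq_itS [X in _ - X]sq_itS -scalerBr; congr (_ *: _).
  rewrite opprD addrACA subrr add0r mulrDl !mulrBr (sq_it_comm n n.+1).
  by rewrite subrKA.
have -> : sq_eta n.+2 - sq_eta n.+1 =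
    2^-1 * ((sq_eta n.+1 + sq_eta n) * (sq_eta n.+1 - sq_eta n)).
  by rewrite [X in X - _]sq_etaS [X in _ - X]sq_etaS; ring.
have := opbZ (2^-1) (opbM (addr_ge0 k0 h0) (opbD o2 o1) IH).
by rewrite half_norm.
Qed.

Lemma sq_it_le n m : (n <= m)%N -> opb (sq_eta m - sq_eta n) (sq_it m - sq_it n).
Proof.
elim: m => [|m IH]; first by rewrite leqn0 => /eqP ->; rewrite !subrr => x; rewrite nrm0 mul0r.
rewrite leq_eqVlt => /orP[/eqP ->|]; first by rewrite !subrr => x; rewrite nrm0 mul0r.
rewrite ltnS => /IH h x.
have := opbD (sq_it_step m) h x; rewrite !subrKA.
by [].
Qed.

(** Y is the strong limit of sq_it, so that 2 Y = c + Y^2. *)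
Lemma sqrt1 : exists Y, [/\ bicomm c Y, adj Y = Y, contr Y & (1 - Y) * (1 - Y) = 1 - c].
Proof.
have vA := vN_bicomm sc.
have dir : @directed nat setT (fun n m => (n <= m)%N).
  split.
  - by exists 0%N.
  - by [].
  - by move=> i j l _ _ _; exact: leq_trans.
  - by move=> i j _ _; exists (maxn i j); split; rewrite ?leq_maxl ?leq_maxr.
have c_it n : contr (sq_it n).
  have [_ _ o] := sq_itP n; have [_ h1] := sq_eta_bd n => x.
  by apply: le_trans (o x) _; rewrite ler_piMl ?nrm_ge0.
have [|x n _|x n m _ _ nm|Y oY hY] :=
  @monotone_net _ H nat setT (fun n m => (n <= m)%N) sq_it 1
    (fun x n => sq_eta n * nrm x ^+ 2) (fun x => nrm x ^+ 2) dir ler01.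
- by move=> n _; apply/contrP.
- by rewrite ler_piMl ?sqr_ge0 //; case: (sq_eta_bd n).
- have := sq_it_le nm x; rewrite bopBE -mulrBl.
  have [h0 _] := sq_eta_bd n; have [_ h1] := sq_eta_bd m.
  set d := sq_eta m - sq_eta n => h.
  have n0 := nrm_ge0 (sq_it m x - sq_it n x).
  have X0 := nrm_ge0 x.
  have [d0|d0] := lerP d 0; last first.
    apply: (@le_trans _ _ ((d * nrm x) ^+ 2)); first by rewrite ler_pXn2r ?nnegrE //; nra.
    rewrite exprMn; apply: ler_wpM2r; [exact: sqr_ge0|rewrite /d in d0 *; nra].
  have : d * nrm x <= 0 by nra.
  move=> ?; have -> : nrm (sq_it m x - sq_it n x) = 0 by lra.
  rewrite expr0n /=.
  have h2 : 0 <= d * nrm x by lra.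
  by rewrite expr2 mulrA mulr_ge0.
have cl := @slim_closure _ _ _ _ _ _ _ (range sq_it) dir hY (fun n _ => imageT sq_it n).
exists Y; split.
- apply: (vN_sclosure vA _ cl) => _ [n _ <-]; by case: (sq_itP n).
- apply: (sclosure_sa cl) => _ [n _ <-]; by case: (sq_itP n).
- exact/contrP.
have YY : Y + Y = c + Y * Y.
  apply/subr0_eq; apply: bop_small => x e e0.
  have [n [_ hn]] := hY [:: x; Y x] (e / 4) ltac:(lra).
  have h1 := hn n I (leqnn _) x ltac:(by rewrite !inE eqxx).
  have h2 := hn n I (leqnn _) (Y x) ltac:(by rewrite !inE eqxx orbT).
  have h3 := hn n.+1 I (leqnSn _) x ltac:(by rewrite !inE eqxx).
  have e1 : sq_it n.+1 x + sq_it n.+1 x = c x + sq_it n (sq_it n x).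
    by rewrite -[LHS]/((sq_it n.+1 + sq_it n.+1) x) sq_itS halfD.
  have -> : (Y + Y - (c + Y * Y)) x =
    (Y x - sq_it n.+1 x) + (Y x - sq_it n.+1 x) - ((Y (Y x) - sq_it n (Y x)) + sq_it n (Y x - sq_it n x)).
    rewrite bopBE !bopDE bopME linearB /= subrKA addrACA -opprD e1.
    rewrite -[RHS]addrA; congr (_ + _); rewrite -opprD; congr (- _).
    by rewrite -addrA [sq_it n _ + _]addrC subrK.
  have := c_it n (Y x - sq_it n x).
  have := nrmD (Y x - sq_it n.+1 x) (Y x - sq_it n.+1 x).
  have := nrmD (Y (Y x) - sq_it n (Y x)) (sq_it n (Y x - sq_it n x)).
  have := nrmD (Y x - sq_it n.+1 x + (Y x - sq_it n.+1 x)) (- (Y (Y x) - sq_it n (Y x) + sq_it n (Y x - sq_it n x))).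
  rewrite nrmN; lra.
have e : Y * Y = Y + (Y - c) by rewrite addrA YY addrC addKr.
by rewrite mulrBl mul1r mulrBr mulr1 e opprD opprK addKr subrKA.
Qed.

End Sqrt.
End Spectral.

(** * Kernel projections *)

Section Kernel.
Variables (R : realType) (H : hilbertType R).
Local Notation B := (bop H).
Local Notation C := R[i].

Lemma nrm_sqr_le (V : normedModType C) (x : V) e : 0 <= e -> nrm x ^+ 2 <= e ^+ 2 -> nrm x <= e.
Proof. by move=> e0; rewrite ler_pXn2r // nnegrE ?nrm_ge0. Qed.

(** Riesz representation of a functional bounded by the seminorm of j x.  The
representing vector is a limit of approximate representatives, whence the last clause. *)
Lemma riesz_sub (V : lmodType C) (S : set V) (j : V -> H) (f : V -> C) (K : R) :
  subspace S -> (forall a x y, j (a *: x + y) = a *: j x + j y) ->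
  (forall a x y, S x -> S y -> f (a *: x + y) = a * f x + f y) ->
  (forall x, S x -> msq (f x) <= K * nrm (j x) ^+ 2) ->
  exists2 z0, forall x, S x -> f x = ip (j x) z0 &
    forall e, 0 < e -> exists2 z, S z & nrm (z0 - j z) <= e.
Proof.
move=> sS jlin flin fK; pose s x y := ip (j x) (j y).
have ips : semi_inner S s.
  split=> // [a x y z _ _ _|x y _ _|x _].
  - by rewrite /s jlin ipDl ipZl.
  - exact: ipC.
  - exact: ipxx_ge0.
have sqE' x : sq s x = nrm (j x) ^+ 2 by rewrite /sq /s ipxx.
have jB x y : j (x - y) = j x - j y by rewrite addrC -scaleN1r jlin scaleN1r addrC.
have ex n : exists z, approx S s f n.+1%:R^-1 z.
  apply: (approx_riesz ips flin (K := K)); last by rewrite invr_gt0.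
  by move=> x Sx; rewrite sqE'; exact: fK.
have [z zP] := choice ex.
have inv0 n : 0 <= n.+1%:R^-1 :> R by rewrite invr_ge0.
have close e : 0 < e -> exists k, forall n m, (k <= n)%N -> (k <= m)%N -> nrm (j (z n) - j (z m)) <= e.
  move=> e0; have e4 : 0 < e ^+ 2 / 4 by rewrite divr_gt0 // exprn_gt0.
  have [k kP] := inv_small e4; exists k => n m kn km.
  apply: nrm_sqr_le; first exact: ltW.
  rewrite -jB -sqE'; apply: le_trans (approx_close ips (inv0 n) (inv0 m) (zP n) (zP m)) _.
  have := kP _ kn; have := kP _ km; move: n.+1%:R^-1 m.+1%:R^-1 => p q; lra.
have [z0 z0P] := nrm_complete close.
exists z0 => [x Sx|e /z0P[k kP]]; last by exists (z k); [case: (zP k)|exact: kP].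
apply/subr0_eq; apply: (@nrm_small _ C^o) => e e0.
have [d d0 dP] := @nrm_ip_small _ _ (j x) (e / 2) ltac:(lra).
have [k1 k1P] := z0P _ d0.
pose X := nrm (j x) ^+ 2 + 1; have X0 : 0 < X by rewrite /X; have := sqr_ge0 (nrm (j x)); lra.
have e4 : 0 < (e / 2) ^+ 2 / X by rewrite divr_gt0 // exprn_gt0 //; lra.
have [k2 k2P] := inv_small e4.
pose n := maxn k1 k2.
have -> : f x - ip (j x) z0 = (f x - s x (z n)) - ip (j x) (z0 - j (z n)).
  by rewrite ipBr opprB subrKA.
apply: le_trans (nrmD _ _) _; rewrite nrmN.
have [_ h1] := dP _ (k1P n (leq_maxl _ _)).
have h2 : nrm (f x - s x (z n) : C^o) <= e / 2.
  apply: nrm_sqr_le; first lra.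
  have [_ /(_ x Sx)] := zP n; rewrite sqE' => h; apply: (le_trans h).
  have h3 := k2P n (leq_maxr _ _); rewrite ler_pdivlMr // in h3.
  apply: le_trans h3; apply: ler_wpM2l => //; rewrite /X; lra.
have := lerD h2 h1; rewrite -splitr; exact.
Qed.

(** The orthogonal projection onto the kernel of b lies in A, since the commutant of A
preserves this kernel. *)
Lemma kernel_projection (A : set B) b : von_neumann A -> A b ->
  exists p, [/\ projections A p, b * p = 0 & forall T, b * T = 0 -> p * T = T].
Proof.
move=> vA Ab; pose S := [set x | b x = 0].
have sS : subspace S.
  split; first exact: linear0.
  by move=> a x y hx hy; rewrite /S /= [b _]linearP /= (hx : b x = 0) (hy : b y = 0) scaler0 addr0.
have ex x : exists z, b z = 0 /\ forall k, b k = 0 -> ip k x = ip k z.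
  have [//|a k l _ _|k _|z0 z0P z0c] := @riesz_sub H S id (fun k => ip k x) (nrm x ^+ 2) sS.
  - by rewrite ipDl ipZl.
  - rewrite /msq -exprMn ler_pXn2r ?nnegrE ?mulr_ge0 ?nrm_ge0 //.
    by rewrite mulrC; exact: cauchy_schwarz_nrm.
  exists z0; split=> //; apply: nrm_small => e e0.
  have [d d0 dP] := nrm_op_small b e0; have [z bz zd] := z0c d d0.
  by have := dP _ zd; rewrite linearB /= bz subr0.
have [Q QP] := choice ex.
have bQ x : b (Q x) = 0 by case: (QP x).
have ipQ k x : b k = 0 -> ip k x = ip k (Q x) by case: (QP x) => _; apply.
have uniq x y : b x = 0 -> b y = 0 -> (forall k, b k = 0 -> ip k x = ip k y) -> x = y.
  move=> bx by_ h; apply/subr0_eq.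
  have e : ip (x - y) (x - y) = 0.
    by rewrite ipBr h ?subrr // linearB /= bx by_ subrr.
  by apply/eqP; rewrite -normr_eq0 -sqrf_eq0 ip_norm e.
have Qb : Q \in @bounded_op R H.
  apply/asboolP; split.
    move=> a x y; apply: uniq; rewrite ?linearP /= ?bQ ?scaler0 ?addr0 //.
    by move=> k bk; rewrite -ipQ // !ipDr !ipZr -!ipQ.
  exists 1 => // x; rewrite mul1r !nrmE lecR.
  have [->|Qn] := eqVneq (nrm (Q x)) 0; first exact: nrm_ge0.
  have h : nrm (Q x) ^+ 2 <= nrm (Q x) * nrm x by apply: sqr_nrm_le; rewrite -ipQ.
  by rewrite expr2 ler_pM2l // in h; rewrite lt_neqAle eq_sym Qn nrm_ge0.
pose p := Bop Qb; have pE x : p x = Q x by [].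
have pk x : b x = 0 -> p x = x by move=> bx; apply: uniq => // k bk; rewrite pE -ipQ.
have bcomm T : commutant A T -> b * T = T * b by move=> /(_ _ Ab) ->.
exists p; split.
- split.
  + apply: (vN_in vA) => T hT; apply: bopP => x; rewrite !bopME.
    have hT' : commutant A (adj T) by apply: commutant_adj hT; exact: (vN_adj vA).
    apply: uniq => [|| k bk].
    * exact: bQ.
    * by rewrite -bopME (bcomm _ hT) bopME bQ linear0.
    rewrite pE -ipQ //; transitivity (ip (adj T k) x); first by rewrite adjP adjK.
    rewrite ipQ ?adjP ?adjK //.
    by rewrite -bopME (bcomm _ hT') bopME bk linear0.
  + by apply: bopP => x; rewrite bopME pk // pE.
  + apply: adj_uniq => x y; rewrite !pE (ipQ (Q x) y) //.
    by rewrite [RHS]ipC (ipQ (Q y) x) // -ipC.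
- by apply: bopP => x; rewrite bopME pE bQ.
- move=> T bT; apply: bopP => x; rewrite bopME pk //.
  by rewrite -bopME bT.
Qed.

End Kernel.

(** * Binary expansion of positive operators by projections *)

Section Decomposition.
Variables (R : realType) (H : hilbertType R).
Local Notation B := (bop H).
Local Notation C := R[i].
Implicit Types (a p q w S T : B) (A : set B).

(** Scaled down, T is 1 - c with c a contraction, and sqrt1 applies to c. *)
Lemma psdP A T : von_neumann A -> A T -> adj T = T -> fpos T ->
  exists h, [/\ A h, adj h = h & h * h = T].
Proof.
move=> vA AT sT pT; have [k k0 kT] := opb_ex1 T.
pose T' := (k^-1)%:C%C *: T.
have AT' : A T' by exact: (vNZ vA).
have sT' : adj T' = T' by rewrite adjZr sT.
have pT' : fpos T' by apply: fposZ => //; rewrite invr_ge0 ltW.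
have cT' : contr T' := contr_scale k0 kT.
pose c := 1 - T'.
have sc : adj c = c by rewrite adjB adj1 sT'.
have cc : contr c.
  by apply: fpos1_contr => //; [exact: contr_fposD|rewrite opprB addrC subrK].
have [Y [bY sY _ YE]] := sqrt1 sc cc.
have Ac : A c by apply: (vND vA); [exact: (vN1 vA)|exact: (vNN vA)].
have AY : A (1 - Y).
  by apply: (vND vA); [exact: (vN1 vA)|apply: (vNN vA); exact: (bicomm_sub vA Ac)].
exists ((Num.sqrt k)%:C%C *: (1 - Y)); split.
- exact: (vNZ vA).
- by rewrite adjZr adjB adj1 sY.
rewrite -bop_scalerAl -bop_scalerAr YE opprB addrC subrK !scalerA.
by rewrite -!rmorphM -expr2 sqr_sqrtr ?(ltW k0) // mulfV ?scale1r // gt_eqF.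
Qed.

Lemma bicomm_trans a T : adj T = T -> bicomm T a -> bicomm a `<=` bicomm T.
Proof. by move=> sT aT; exact: (bicomm_sub (vN_bicomm sT) aT). Qed.

(** The element w is a fourth root of a^2, so w^2 = |a|, and p is the projection onto the
kernel of |a| - a.  As (|a| - a) (|a| + a) = 0, the range of |a| + a is below p, that
is, a = - |a| on 1 - p. *)
Lemma sign_decomp a : adj a = a -> contr a -> exists p w,
  [/\ projections (bicomm a) p, bicomm a w, adj w = w, contr w &
      a * p = w * w * p /\ a * (1 - p) = - (w * w * (1 - p))].
Proof.
move=> sa ca; have vA := vN_bicomm sa; have ab := @bicomm_abel _ _ a.
have Aa := @bicomm_self _ _ a.
have A1 := vN1 vA.
pose c := 1 - a * a.
have sc : adj c = c by rewrite adjB adj1 adjM sa.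
have pc : fpos c by exact: contr_fpos.
have cc : contr c.
  by apply: fpos1_contr => //; rewrite opprB addrC subrK; exact: fpos_sqr.
have Ac : bicomm a c by apply: (vND vA) => //; apply: (vNN vA); exact: (vNM vA).
have [Y [bY sY cY YE]] := sqrt1 sc cc.
have AY : bicomm a Y by exact: (bicomm_sub vA Ac).
have [Z [bZ sZ cZ ZE]] := sqrt1 sY cY.
have AZ : bicomm a Z by exact: (bicomm_sub vA AY).
pose w := 1 - Z.
have sw : adj w = w by rewrite adjB adj1 sZ.
have Aw : bicomm a w by apply: (vND vA) => //; exact: (vNN vA).
(* sqrt1 is used twice: 1 - Y is a square root of a^2, and w of 1 - Y. *)
have w4 : w * w * (w * w) = a * a.
  by rewrite ZE YE opprB addrC subrK.
have Aww : bicomm a (w * w) by exact: (vNM vA).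
have cw : contr w.
  move=> x; apply: nrm_sqr_le; first exact: nrm_ge0.
  have h1 : nrm ((w * w) x) <= nrm x.
    suff -> : nrm ((w * w) x) = nrm (a x) by exact: ca.
    have : nrm ((w * w) x) ^+ 2 = nrm (a x) ^+ 2.
      apply: complexI; rewrite -!ipxx.
      have e T : adj T = T -> ip (T x) (T x) = ip ((T * T) x) x.
        by move=> sT; rewrite bopME [RHS]adjP sT.
      by rewrite !e ?w4 // adjM sw.
    by move/eqP; rewrite eqrXn2 ?nrm_ge0 // => /eqP.
  apply: (@le_trans _ _ (nrm ((w * w) x) * nrm x)).
    by apply: sqr_nrm_le; rewrite bopME [RHS]adjP sw.
  by rewrite expr2; apply: ler_wpM2r => //; exact: nrm_ge0.
clearbody w.
pose b := w * w - a.
have Ab : bicomm a b by apply: (vND vA) => //; exact: (vNN vA).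
have [p [pP bp pmax]] := kernel_projection vA Ab.
have [Ap pp sp] := pP.
exists p, w; split=> //; split.
  by apply/eqP; rewrite eq_sym -subr_eq0 -mulrBl; apply/eqP.
have b0 : b * (w * w + a) = 0.
  by rewrite /b mulrBl !mulrDr w4 (ab a (w * w)) // [a * a + _]addrC subrr.
have h := pmax _ b0.
have : (1 - p) * (w * w + a) = 0 by rewrite mulrBl mul1r h subrr.
have Aq : bicomm a (1 - p) by apply: (vND vA) => //; exact: (vNN vA).
rewrite (ab (1 - p)) //; last exact: (vND vA).
by rewrite mulrDl => /eqP; rewrite addrC addr_eq0 => /eqP.
Qed.

Lemma fpos_conj S T : fpos T -> fpos (adj S * T * S).
Proof. by move=> pT x; rewrite !bopME adjP adjK. Qed.

(** p is the spectral projection of y for [1/2, 1], the first binary digit of y; the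
operator 2 y - p of the unit interval carries the remaining digits. *)
Lemma binary_digit y : adj y = y -> fpos y -> fpos (1 - y) -> exists p,
  [/\ projections (bicomm y) p, fpos (y + y - p) & fpos (1 - (y + y - p))].
Proof.
move=> sy py qy; have vA := vN_bicomm sy.
pose a := y + y - 1.
have Ay := @bicomm_self _ _ y.
have Aa : bicomm y a.
  by apply: (vND vA); [exact: (vND vA)|apply: (vNN vA); exact: (vN1 vA)].
have sa : adj a = a by rewrite adjB adj1 adjD sy.
have ca : contr a.
  move=> x; apply: nrm_sqr_le; first exact: nrm_ge0.
  rewrite -lecR -!ipxx -subr_ge0.
  have -> : ip x x - ip (a x) (a x) = (ip (y x) x - ip (y x) (y x)) *+ 4.
    rewrite bopBE bopDE bop1E !(ipBl, ipBr, ipDl, ipDr).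
    rewrite [ip x (y x)](_ : _ = ip (y x) x); last by rewrite adjP sy.
    ring.
  by rewrite mulrn_wge0 // subr_ge0; exact: fpos_sqr_le.
have [p [w [[Ap pp sp] Aw sw cw [ap aq]]]] := sign_decomp sa ca.
have ab := @bicomm_abel _ _ a.
have va := vN_bicomm sa.
pose q := 1 - p.
have sq : adj q = q by rewrite adjB adj1 sp.
have qq : q * q = q by rewrite mulrBl mul1r mulrBr mulr1 pp subrr subr0.
have Aq : bicomm a q by apply: (vND va); [exact: (vN1 va)|exact: (vNN va)].
have Aww : bicomm a (w * w) by exact: (vNM va).
have cut r : bicomm a r -> r * r = r -> forall z, bicomm a z -> r * z * r = z * r.
  by move=> Ar rr z Az; rewrite (ab r z) // -mulrA rr.
have aE : a = w * w * p - w * w * q.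
  by rewrite -ap -aq -mulrDr [p + _]addrC subrK mulr1.
have y1E : y + y - p = p * (w * w) * p + q * (1 - w * w) * q.
  rewrite !cut //; last by apply: (vND va); [exact: (vN1 va)|exact: (vNN va)].
  have -> : y + y - p = a + q by rewrite /a /q addrA subrK.
  by rewrite {1}aE mulrBl mul1r -addrA [- _ + q]addrC.
have fp T : fpos T -> fpos (p * T * p) by move=> ?; rewrite -{1}sp; exact: fpos_conj.
have fq T : fpos T -> fpos (q * T * q) by move=> ?; rewrite -{1}sq; exact: fpos_conj.
exists p; split.
- by split=> //; exact: (bicomm_trans sy Aa).
- rewrite y1E; apply: fposD; [apply: fp; exact: fpos_sqr|apply: fq; exact: contr_fpos].
have -> : 1 - (y + y - p) = p * (1 - w * w) * p + q * (w * w) * q.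
  have A1w : bicomm a (1 - w * w) by apply: (vND va); [exact: (vN1 va)|exact: (vNN va)].
  have -> : 1 - (y + y - p) = p - a by rewrite /a !opprB [p - _]addrC !addrA addrAC [p + 1]addrC.
  rewrite !cut // {1}aE mulrBl mul1r opprB addrA addrAC.
  by [].
apply: fposD; [apply: fp; exact: contr_fpos|apply: fq; exact: fpos_sqr].
Qed.

Lemma projections1 A : von_neumann A -> projections A 1.
Proof. by move=> vA; split; [exact: (vN1 vA)|rewrite mulr1|exact: adj1]. Qed.

Lemma projections_sub A1 A2 p : A1 `<=` A2 -> projections A1 p -> projections A2 p.
Proof. by move=> h [Ap pp sp]; split=> //; exact: h. Qed.

(** A is the norm closed span of its projections: as L kills the binary digits of an
element y of the unit interval, 2^n L y = L y_n for an element y_n of the unit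
interval, so that 2^n L y stays bounded. *)
Lemma projections_total A (L : B -> B) (K : R) : von_neumann A ->
  (forall x y, A x -> A y -> L (x + y) = L x + L y) ->
  (forall (k : C) x, A x -> L (k *: x) = k *: L x) ->
  (forall x, A x -> contr x -> opb K (L x)) ->
  (forall p, projections A p -> L p = 0) ->
  forall x, A x -> L x = 0.
Proof.
move=> vA LD LZ LK Lp.
have A1 := vN1 vA.
have L1 : L 1 = 0 by apply: Lp; exact: projections1.
have LN x : A x -> L (- x) = - L x by move=> Ax; rewrite -scaleN1r LZ // scaleN1r.
have LB x y : A x -> A y -> L (x - y) = L x - L y.
  by move=> Ax Ay; rewrite LD ?LN //; exact: (vNN vA).
have unit n : forall y, A y -> adj y = y -> fpos y -> fpos (1 - y) ->
    forall x, nrm (L y x) *+ (2 ^ n) <= K * nrm x.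
  elim: n => [|n IH] y Ay sy py qy x.
    by rewrite expn0 mulr1n; apply: LK => //; exact: fpos1_contr.
  have [p [pP p1 q1]] := binary_digit sy py qy.
  have pA := projections_sub (bicomm_sub vA Ay) pP.
  have Ap : A p by case: pA.
  have AS : A (y + y - p) by apply: (vND vA); [exact: (vND vA)|exact: (vNN vA)].
  have sS : adj (y + y - p) = y + y - p by rewrite adjB adjD sy; case: pP => _ _ ->.
  have LS : L (y + y - p) = 2%:R *: L y.
    by rewrite LB //; [rewrite (Lp p pA) subr0 LD // scaler_nat mulr2n|exact: (vND vA)].
  have := IH _ AS sS p1 q1 x; rewrite LS bopZE.
  have e2 : 2%:R = (2%:R : R)%:C%C :> C by rewrite rmorph_nat.
  rewrite e2 nrmZr normr_nat.
  by rewrite expnS mulrnA mulr_natl.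
have unit0 y : A y -> adj y = y -> fpos y -> fpos (1 - y) -> L y = 0.
  move=> Ay sy py qy; apply: bop_small => x e e0.
  have X0 : 0 <= `|K * nrm x| by [].
  have e1 : 0 < e / (`|K * nrm x| + 1) by rewrite divr_gt0 //; lra.
  have [n nP] := inv_small e1.
  have := unit n y Ay sy py qy x.
  have := nrm_ge0 (L y x); set m := nrm _ => m0 h.
  have h2 : m * n.+1%:R <= `|K * nrm x|.
    apply: le_trans (ler_norm _); apply: le_trans h; rewrite -[leRHS]mulr_natr.
    by apply: ler_wpM2l => //; rewrite ler_nat; exact: ltn_expl.
  have := nP n (leqnn _); rewrite ler_pdivlMr; last lra.
  have N0 : 0 < n.+1%:R :> R by rewrite ltr0n.
  rewrite mulrC ler_pdivrMr // => h3.
  have : m * n.+1%:R <= e * n.+1%:R by lra.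
  by rewrite ler_pM2r.
have sa0 y : A y -> adj y = y -> L y = 0.
  move=> Ay sy; have [k k0 kT] := opb_ex1 y.
  pose d := (k^-1)%:C%C *: y.
  have Ad : A d by exact: (vNZ vA).
  have sd : adj d = d by rewrite adjZr sy.
  have cd : contr d := contr_scale k0 kT.
  have cnd : contr (- d) by move=> x; rewrite bopNE nrmN.
  have half0 : 0 <= 2^-1 :> R by rewrite invr_ge0.
  have := unit0 ((2^-1 : R)%:C%C *: (1 + d)).
  rewrite LZ; last exact: (vND vA).
  rewrite LD // L1 add0r LZ // !scalerA => h.
  have hN : (2^-1 : R)%:C%C * (k^-1)%:C%C != 0 :> C.
    by rewrite -rmorphM fmorph_eq0 mulf_neq0 // invr_eq0 // gt_eqF.
  suff : ((2^-1 : R)%:C%C * (k^-1)%:C%C) *: L y = 0.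
    by move/eqP; rewrite scaler_eq0 (negbTE hN) => /eqP.
  apply: h.
  - by apply: (vNZ vA); exact: (vND vA).
  - by rewrite adjZr adjD adj1 sd.
  - apply: fposZ => //; rewrite -[d]opprK; apply: contr_fposD => //.
    by rewrite adjN sd.
  - rewrite (_ : 1 - _ = (2^-1 : R)%:C%C *: (1 - d)); first by apply: fposZ => //; exact: contr_fposD.
    rewrite -[X in X - _]scale1r (_ : 1 = (2^-1 : R)%:C%C + (2^-1 : R)%:C%C :> C); last first.
      by rewrite -rmorphD (_ : 2^-1 + 2^-1 = 1 :> R) ?rmorph1 //; field.
    by rewrite scalerDl scalerDr scalerBr opprD addrACA subrr add0r.
move=> x Ax; have Ax' := vN_adj vA Ax.
have h1 : L (x + adj x) = 0 by apply: sa0; [exact: (vND vA)|rewrite adjD adjK addrC].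
have h2 : L (('i : C) *: (x - adj x)) = 0.
  apply: sa0; first by apply: (vNZ vA); apply: (vND vA) => //; exact: (vNN vA).
  rewrite adjZ adjB adjK -[in RHS]opprB scalerN -scaleNr; congr (_ *: _).
  exact: conjCi.
have h3 : L (x - adj x) = 0.
  move: h2; rewrite LZ; last by apply: (vND vA) => //; exact: (vNN vA).
  by move/eqP; rewrite scaler_eq0 (negbTE (neq0Ci _)) => /eqP.
have : L (x + x) = 0.
  have -> : x + x = (x + adj x) + (x - adj x) by rewrite addrACA subrr addr0.
  by rewrite LD ?h1 ?h3 ?addr0 //; apply: (vND vA) => //; exact: (vNN vA).
rewrite LD // -mulr2n -scaler_nat => /eqP; rewrite scaler_eq0 pnatr_eq0 => /eqP//.
Qed.

End Decomposition.

(** * Star-isomorphisms are contractive *)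

Section StarIsoNorm.
Variables (R : realType) (H : hilbertType R).
Local Notation B := (bop H).
Local Notation C := R[i].
Implicit Types (p q S T : B) (A N D : set B).

Section One.
Variables (N : set B) (phi : B -> B).
Hypotheses (vN : von_neumann N) (iso : star_iso N N phi).

Lemma star_iso1 : phi 1 = 1.
Proof.
have [x Nx xE] := star_iso_surj iso (vN1 vN).
transitivity (phi 1 * phi x); first by rewrite xE mulr1.
by rewrite -(si_mul iso) // ?mul1r //; exact: (vN1 vN).
Qed.

Lemma star_isoB x y : N x -> N y -> phi (x - y) = phi x - phi y.
Proof.
move=> Nx Ny; rewrite (si_add iso) //; last exact: (vNN vN).
by rewrite -scaleN1r (si_scale iso) // scaleN1r.
Qed.

(** 1 - (phi x)^* (phi x) is the image of 1 - x^* x = (1 - Y)^2, thus a square. *)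
Lemma star_iso_contr x : N x -> contr x -> contr (phi x).
Proof.
move=> Nx cx; have N1 := vN1 vN; have Nx' := vN_adj vN Nx.
pose c := adj x * x.
have Nc : N c by exact: (vNM vN).
have sc : adj c = c by rewrite adjM adjK.
have cc : contr c by apply: contrM => //; exact: contr_adj.
have [Y [bY sY _ YE]] := sqrt1 sc cc.
have NY : N (1 - Y).
  by apply: (vND vN) => //; apply: (vNN vN); exact: (bicomm_sub vN Nc).
have e : 1 - adj (phi x) * phi x = phi (1 - Y) * phi (1 - Y).
  by rewrite -(si_mul iso) // YE star_isoB // star_iso1 (si_mul iso) // (si_adj iso).
move=> h; apply: nrm_sqr_le; first exact: nrm_ge0.
rewrite -lecR -!ipxx -subr_ge0 -ip_adj_mul.
have -> : ip h h - ip ((adj (phi x) * phi x) h) h = ip ((1 - adj (phi x) * phi x) h) h.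
  by rewrite bopBE bop1E ipBl.
rewrite e; apply: fpos_sqr.
by rewrite -(si_adj iso) // adjB adj1 sY.
Qed.

Lemma star_iso_opb k x : 0 < k -> N x -> opb k x -> opb k (phi x).
Proof.
move=> k0 Nx kx.
have := star_iso_contr (vNZ vN _ Nx) (contr_scale k0 kx); rewrite (si_scale iso) // => h y.
have := h y; rewrite bopZE nrmZr ger0_norm ?invr_ge0 ?(ltW k0) //.
by rewrite mulrC ler_pdivrMr // mulrC.
Qed.
End One.

Lemma commutant_projections A T : von_neumann A ->
  (forall p, projections A p -> T * p = p * T) -> commutant A T.
Proof.
move=> vA hT d Ad; apply/subr0_eq.
have [k k0 kT] := opb_ex T.
apply: (@projections_total _ _ A (fun d => T * d - d * T) (k + k) vA) => //.
- by move=> x y _ _; rewrite mulrDl mulrDr opprD addrACA.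
- by move=> a x _; rewrite -bop_scalerAl -bop_scalerAr scalerBr.
- move=> x _ /contrP cx; apply: opbD.
    by have := opbM k0 kT cx; rewrite mulr1.
  by apply: opbN; have := opbM ler01 cx kT; rewrite mul1r.
- by move=> p /hT ->; rewrite subrr.
Qed.

Lemma star_iso_eq_on_projections N D phi psi : von_neumann N -> von_neumann D -> D `<=` N ->
  star_iso N N phi -> star_iso N N psi ->
  (forall p, projections D p -> phi p = psi p) -> forall d, D d -> phi d = psi d.
Proof.
move=> vN vD DN i1 i2 h d Dd; apply/subr0_eq.
apply: (@projections_total _ _ D (fun d => phi d - psi d) (1 + 1) vD) => //.
- move=> x y /DN Nx /DN Ny.
  by rewrite (si_add i1) // (si_add i2) // opprD addrACA.
- by move=> a x /DN Nx; rewrite (si_scale i1) // (si_scale i2) // scalerBr.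
- move=> x /DN Nx cx; apply: opbD; first by apply/contrP; exact: (star_iso_contr vN i1).
  by apply: opbN; apply/contrP; exact: (star_iso_contr vN i2).
- by move=> p /h ->; rewrite subrr.
Qed.

End StarIsoNorm.

(** * Suprema of projections and maximal projections *)

Section ProjectionOrder.
Variables (R : realType) (H : hilbertType R).
Local Notation B := (bop H).
Implicit Types (p q S T : B) (A : set B).

Definition ple p q := q * p = p.

Lemma ple_r A p q : projections A p -> projections A q -> ple p q -> p * q = p.
Proof. by move=> [_ _ sp] [_ _ sq] pq; rewrite -{1}sp -{1}sq -adjM pq. Qed.

Lemma ple_anti A p q : projections A p -> projections A q -> ple p q -> ple q p -> p = q.
Proof. by move=> pP qP pq qp; rewrite -(ple_r pP qP pq). Qed.

Lemma ple_trans p q r : ple p q -> ple q r -> ple p r.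
Proof. by rewrite /ple => pq qr; rewrite -{1}pq mulrA qr pq. Qed.

Lemma projections0 A : von_neumann A -> projections A 0.
Proof. by move=> vA; split; [exact: (vN0 vA)|rewrite mulr0|exact: adj0]. Qed.

Lemma projections_sub_ple A p q : von_neumann A -> projections A p -> projections A q ->
  ple p q -> projections A (q - p).
Proof.
move=> vA pP qP pq; have qp := ple_r pP qP pq.
case: pP qP => [Ap pp sp] [Aq qq sq]; split.
- by apply: (vND vA) => //; exact: (vNN vA).
- by rewrite mulrBl !mulrBr qq pp pq qp subrr subr0.
- by rewrite adjB sp sq.
Qed.

Lemma projections_add A p q : von_neumann A -> projections A p -> projections A q ->
  p * q = 0 -> projections A (p + q).
Proof.
move=> vA [Ap pp sp] [Aq qq sq] pq.
have qp : q * p = 0 by rewrite -sq -sp -adjM pq adj0.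
split; first exact: (vND vA).
- by rewrite mulrDl !mulrDr pq qp pp qq addr0 add0r.
- by rewrite adjD sp sq.
Qed.

Lemma ip_proj A p x : projections A p -> ip (p x) (p x) = ip (p x) x.
Proof. by move=> [_ pp sp]; rewrite -[in RHS]pp bopME [RHS]adjP sp. Qed.

Lemma ip_proj_ge0 A p x : projections A p -> 0 <= ip (p x) x.
Proof. by move=> pP; rewrite -(ip_proj x pP) ipxx_ge0. Qed.

Lemma ple_nrm A p q x : von_neumann A -> projections A p -> projections A q -> ple p q ->
  nrm (q x - p x) ^+ 2 = nrm (q x) ^+ 2 - nrm (p x) ^+ 2.
Proof.
move=> vA pP qP pq; have dP := projections_sub_ple vA pP qP pq.
apply: complexI; rewrite rmorphB /= -!ipxx -bopBE (ip_proj x dP) (ip_proj x pP) (ip_proj x qP).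
by rewrite bopBE ipBl.
Qed.

Lemma sclosure_ple X P q : sclosure X P -> (forall p, X p -> ple p q) -> ple P q.
Proof.
move=> cl h; apply/eqP; rewrite eq_sym -subr_eq0 -{1}[P]mul1r -mulrBl; apply/eqP.
by apply: (sclosure_mul0 cl) => p /h pq; rewrite mulrBl mul1r pq subrr.
Qed.

Lemma contr_projections A p : projections A p -> contr p.
Proof. by case=> _ pp sp; exact: contr_proj. Qed.

Lemma projections_sup A (X : set B) : von_neumann A -> X `<=` projections A -> directed X ple ->
  exists P, [/\ projections A P, forall p, X p -> ple p P & slim X ple id P].
Proof.
move=> vA XA dX.
have [|x p Xp|x p q Xp Xq pq|P cP hP] := @monotone_net _ H B X ple id 1
  (fun x p => nrm (p x) ^+ 2) (fun x => nrm x ^+ 2) dX ler01.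
- by move=> p /XA /contr_projections; move/contrP.
- rewrite ler_pXn2r ?nnegrE ?nrm_ge0 //; exact: (contr_projections (XA _ Xp)).
- by rewrite (ple_nrm x vA (XA _ Xp) (XA _ Xq)).
have cl := slim_closure dX hP (S := X) (fun p Xp => Xp).
exists P; split=> //.
- split.
  + by apply: (vN_sclosure vA _ cl) => p /XA[].
  + apply: (sclosure_idem (k := 1) _ cl) => // p /XA pP; split; first by case: pP.
    by apply/contrP; exact: (contr_projections pP).
  + by apply: (sclosure_sa cl) => p /XA[].
- move=> p Xp; apply/subr0_eq; apply: bop_small => x e e0.
  have [q [Xq hq]] := hP [:: p x] e e0.
  have [l [Xl ql pl]] := dir_ub dX Xq Xp.
  have := hq l Xl ql (p x) (mem_head _ _).
  by rewrite bopBE bopME -[id l (p x)]/((l * p) x) pl.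
Qed.

(** Zorn's lemma for a property of projections that passes to suprema of directed
families; such a supremum is also a strong limit. *)
Lemma max_projection A (Phi : B -> Prop) p0 : von_neumann A ->
  projections A p0 -> Phi p0 ->
  (forall (X : set B) P, X `<=` projections A -> (forall p, X p -> Phi p) -> directed X ple ->
     projections A P -> (forall p, X p -> ple p P) -> slim X ple id P -> Phi P) ->
  exists p, [/\ projections A p, Phi p & forall q, projections A q -> Phi q -> ple p q -> q = p].
Proof.
move=> vA p0P Phi0 hPhi.
pose T := {p | projections A p /\ Phi p}.
pose r (s t : T) := `[< ple (sval s) (sval t) >].
have [s|s t u|s t|W totW|[p [pP Pp]] pmax] := @Zorn T r.
- by apply/asboolP; exact: (let: conj (And3 _ pp _) _ := svalP s in pp).
- move=> /asboolP st /asboolP tu; apply/asboolP; exact: ple_trans st tu.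
- move=> /asboolP st /asboolP ts.
  case: s t st ts => [p [pP Pp]] [q [qP Pq]] /= st ts.
  have e := ple_anti pP qP st ts; subst q; congr exist; exact: Prop_irrelevance.
- have [[w Ww]|W0] := pselect (W !=set0); last first.
    by exists (exist _ p0 (conj p0P Phi0)) => s Ws; case: W0; exists s.
  pose X := [set sval s | s in W].
  have XA : X `<=` projections A by move=> _ [[p [pP Pp]] _ <-].
  have dX : directed X ple.
    split.
    + by exists (sval w), w.
    + by move=> p /XA[].
    + by move=> p q l _ _ _; exact: ple_trans.
    + move=> _ _ [s Ws <-] [t Wt <-].
      have := totW _ _ Ws Wt; rewrite /r => -[/asboolP st|/asboolP ts].
        by exists (sval t); split=> //; [exists t|case: (t) => ? [[]]].
      by exists (sval s); split=> //; [exists s|case: (s) => ? [[]]].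
  have [P [PP Pub Psl]] := projections_sup vA XA dX.
  have PhiP : Phi P by apply: (hPhi X) => // _ [[p [pP Pp]] _ <-].
  exists (exist _ P (conj PP PhiP)) => s Ws; apply/asboolP; apply: Pub.
  by exists s.
exists p; split=> // q qP Pq pq.
have := pmax (exist _ q (conj qP Pq)); rewrite /r /= => h.
by have /(congr1 sval) := h (asboolT pq).
Qed.

End ProjectionOrder.

Arguments ple {R H} p q.

(** * Fixed and displaced parts of a normalizer *)

Section Normalizers.
Variables (R : realType) (H : hilbertType R).
Local Notation B := (bop H).
Variables (M N D : set B) (c : cartan_triple M N D).
Local Notation vM := (ct_vNM c).
Local Notation vD := (ct_vND c).
Local Notation cc := (cartan_central c).
Implicit Types (p q d : B) (v w : gn c).

Lemma DN : D `<=` N. Proof. exact: (cs_sub cc). Qed.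
Lemma NM : N `<=` M. Proof. by move=> x; rewrite {1}(ct_relcomm c) => -[]. Qed.
Lemma DM : D `<=` M. Proof. by move=> x /DN /NM. Qed.

Lemma N_intro x : M x -> (forall d, D d -> x * d = d * x) -> N x.
Proof. by move=> Mx h; rewrite {1}(ct_relcomm c). Qed.

Lemma N_comm x d : N x -> D d -> x * d = d * x.
Proof. by move=> Nx Dd; rewrite (cs_central cc Dd Nx). Qed.

Lemma DC d d' : D d -> D d' -> d * d' = d' * d.
Proof. exact: ct_abelian c _ _. Qed.

Lemma gn_M v : M v. Proof. by case: (gnP v). Qed.
Lemma gn_MA v : M (adj v). Proof. exact/(vN_adj vM)/gn_M. Qed.

Lemma projD_mul p q : projections D p -> projections D q -> projections D (p * q).
Proof. exact: (projM cc). Qed.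

Lemma projD_C p : projections D p -> projections D (1 - p).
Proof.
move=> pP; apply: (projections_sub_ple vD) => //; first exact: projections1 vD.
by rewrite /ple mul1r.
Qed.

Lemma proj_compl p : p * p = p -> p * (1 - p) = 0 /\ (1 - p) * p = 0.
Proof. by move=> pp; rewrite mulrBr mulrBl mulr1 mul1r pp subrr. Qed.

Lemma gn_pull v d : D d -> d * v = (v : B) * (adj v * d * v).
Proof. by move=> Dd; rewrite -[in LHS](gn_pi v) mulrA (DC Dd (gn_fin v)) !mulrA. Qed.

Lemma gn_push v d : D d -> (v : B) * d = ((v : B) * d * adj v) * v.
Proof.
move=> Dd; rewrite -[in LHS](gn_pi v) -!mulrA; congr (_ * _).
by rewrite mulrA (DC (gn_ini v) Dd).
Qed.

Lemma gn_iniK v : (v : B) * (adj v * v) = v. Proof. by rewrite mulrA gn_pi. Qed.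

Lemma proj_gn_r v p : projections D p -> projections D ((v : B) * p * adj v).
Proof.
move=> [Dp pp sp]; split; first exact: gn_r.
  rewrite !mulrA -[_ * p * adj v * v]mulrA -[_ * (adj v * v) * p]mulrA.
  by rewrite (DC (gn_ini v) Dp) -!mulrA [p * (p * _)]mulrA pp -[in RHS](gn_ipi v) !mulrA.
by rewrite !adjM adjK sp mulrA.
Qed.

Lemma proj_gn_l v p : projections D p -> projections D (adj v * p * v).
Proof. by move=> /(proj_gn_r (gn_dag v)); rewrite /= adjK. Qed.

Definition projgn p (pP : projections D p) : gn c := Gn c (proj_gn_subproof c pP).

(** For a normalizer v this says that v p v^* is orthogonal to p. *)
Definition displaced v p := p * v * p = 0.

Lemma displaced_le v p q : projections D p -> projections D q -> q * p = q -> displaced v p -> displaced v q.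
Proof.
move=> [Dp _ _] [Dq _ _] qp vp; rewrite /displaced -{1}qp -{2}qp (DC Dq Dp).
by rewrite -(DC Dq Dp) -!mulrA [p * ((v : B) * _)]mulrA (DC Dq Dp) [p * v * _]mulrA [p * v * p]vp mul0r mulr0.
Qed.

(** Let d be a projection of D not commuting with v r, and s = v^* d v, so that d v = v s.
Then v maps s into d and 1 - s into 1 - d, hence r s (1 - d) and r v^* v (1 - s) d are
displaced.  If both vanish, then v r d = d v r. *)
Lemma displaced_ex v r : projections D r -> ~ N ((v : B) * r) ->
  exists q, [/\ projections D q, r * q = q, q <> 0 & displaced v q].
Proof.
move=> rP nN; have [Dr rr sr] := rP.
have [d dP dn] : exists2 d, projections D d & ~ ((v : B) * r * d = d * ((v : B) * r)).
  apply: contrapT => h; apply: nN; apply: N_intro; first by apply: (vNM vM); [exact: gn_M|exact: DM].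
  move=> d Dd; apply: (commutant_projections vD _ Dd) => p pP.
  by apply: contrapT => hp; apply: h; exists p.
have [Dd dd sd] := dP.
pose s := adj v * d * v.
have sP : projections D s by exact: proj_gn_l.
have [Ds ss _] := sP.
have dv : d * v = (v : B) * s by exact: gn_pull.
pose t := adj v * v.
have tP : projections D t by exact: gn_iniP.
have [Dt tt _] := tP.
have vt : (v : B) * t = v by exact: gn_iniK.
clearbody t s.
have q1P := projD_mul rP (projD_mul sP (projD_C dP)).
have q2P := projD_mul rP (projD_mul tP (projD_mul (projD_C sP) dP)).
have [D1d _ _] := projD_C dP.
have [D1s _ _] := projD_C sP.
have [q1|q1] := pselect (r * (s * (1 - d)) = 0); last first.
  exists (r * (s * (1 - d))); split=> //; first by rewrite mulrA rr.
  rewrite /displaced [X in _ * X](DC Dr) //; last by case: (projD_mul sP (projD_C dP)).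
  have -> : r * (s * (1 - d)) * v * (s * (1 - d) * r) = r * s * ((1 - d) * ((v : B) * s)) * (1 - d) * r.
    by rewrite !mulrA.
  by rewrite -dv [(1 - d) * (d * _)]mulrA (proj_compl dd).2 mul0r mulr0 !mul0r.
have [q2|q2] := pselect (r * (t * ((1 - s) * d)) = 0); last first.
  exists (r * (t * ((1 - s) * d))); split=> //; first by rewrite mulrA rr.
  rewrite /displaced (DC D1s Dd).
  have -> : r * (t * (d * (1 - s))) * v * (r * (t * (d * (1 - s)))) =
    r * t * (1 - s) * (d * v) * (r * (t * (d * (1 - s)))).
    by rewrite (DC Dd D1s) !mulrA.
  have -> : r * (t * (d * (1 - s))) = (1 - s) * (r * (t * d)).
    rewrite [RHS](DC D1s) ?mulrA //.
    by do 2!apply: (vNM vD) => //.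
  by rewrite dv !mulrA -[_ * s * (1 - s)]mulrA (proj_compl ss).1 mulr0 !mul0r.
case: dn; rewrite mulrA dv -mulrA (DC Dr Dd).
have e1 : r * s = r * (s * d).
  by apply/eqP; rewrite -subr_eq0 -mulrBr -[X in X - _]mulr1 -mulrBr q1.
have e2 : r * (t * d) = r * (t * (s * d)).
  apply/eqP; rewrite -subr_eq0 -!mulrBr; apply/eqP; rewrite -[RHS]q2.
  by rewrite mulrBl mul1r.
rewrite -[in LHS]vt -[in RHS]vt.
have f1 : (v : B) * t * (d * r) = (v : B) * (r * (t * d)).
  by rewrite -mulrA; congr (_ * _); rewrite mulrA [RHS](DC Dr) //; by apply: (vNM vD).
have f2 : (v : B) * t * s * r = (v : B) * (t * (r * s)).
  by rewrite -!mulrA (DC Ds Dr).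
rewrite f1 f2 e1 e2; congr (_ * _).
by rewrite mulrA (DC Dr Dt) [RHS]mulrA.
Qed.

(** Frolik's decomposition of a partial bijection into a fixed part and three displaced
parts.  Let e be a maximal projection on which v commutes with D, and p1 a maximal
displaced projection orthogonal to e.  Then v p1 v^* and v^* p1 v are displaced too.
Nothing remains outside these four: it would contain a nonzero displaced q, and p1 + q
would still be displaced. *)
Lemma fixed_displaced_decomp v : exists e p1 p2 p3,
  [/\ [/\ projections D e, projections D p1, projections D p2 & projections D p3],
      N ((v : B) * e), [/\ displaced v p1, displaced v p2 & displaced v p3] &
      e + p1 + p2 + p3 = 1].
Proof.
pose fix_ e := forall d, D d -> (d * v - (v : B) * d) * e = 0.
have fixN e : D e -> fix_ e -> N ((v : B) * e).
  move=> De he; apply: N_intro; first by apply: (vNM vM); [exact: gn_M|exact: DM].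
  move=> d Dd; apply/eqP; rewrite eq_sym -subr_eq0 mulrA -(mulrA _ e) (DC De Dd) mulrA -mulrBl.
  exact/eqP/he.
have Nfix e : D e -> N ((v : B) * e) -> fix_ e.
  move=> De Ne d Dd; rewrite mulrBl -mulrA -(N_comm Ne Dd) -!mulrA (DC De Dd).
  by rewrite subrr.
have [e [eP fe emax]] : exists e, [/\ projections D e, fix_ e &
    forall q, projections D q -> fix_ q -> ple e q -> q = e].
  apply: (max_projection vD (projections0 vD)) => [d Dd|X P XD Xf dX PP Xub PX d Dd].
    by rewrite mulr0.
  have cl := slim_closure dX PX (S := X) (fun p Xp => Xp).
  by apply: (sclosure_mul0 cl) => p Xp; exact: Xf.
have [De ee se] := eP.
have [p1 [p1P [ep1 dp1] p1max]] : exists p, [/\ projections D p, e * p = 0 /\ displaced v p &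
    forall q, projections D q -> (e * q = 0 /\ displaced v q) -> ple p q -> q = p].
  apply: (max_projection vD (projections0 vD)) => [|X P XD Xf dX PP Xub PX].
    by rewrite /displaced !mulr0.
  have cl := slim_closure dX PX (S := X) (fun p Xp => Xp).
  split; first by apply: (sclosure_mul0 cl) => p /Xf[].
  rewrite /displaced -mulrA; apply: (sclosure_0mul cl) => q Xq; rewrite mulrA.
  apply: (sclosure_mul0 cl) => p Xp.
  have [l [Xl ql pl]] := dir_ub dX Xq Xp.
  have [_ dl] := Xf _ Xl.
  rewrite -(ple_r (XD _ Xq) (XD _ Xl) ql) -[p]pl -!mulrA [l * ((v : B) * _)]mulrA [l * v * _]mulrA.
  by rewrite [l * v * l]dl mul0r mulr0.
have [Dp1 pp1 _] := p1P.
pose q2 := (v : B) * p1 * adj v; pose q3 := adj v * p1 * v.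
have q2P : projections D q2 by exact: proj_gn_r.
have q3P : projections D q3 by exact: proj_gn_l.
have [Dq2 qq2 _] := q2P; have [Dq3 qq3 _] := q3P.
have d2 : displaced v q2.
  rewrite /displaced /q2 !mulrA -[_ * adj v * v]mulrA -[_ * p1 * (adj v * v)]mulrA (DC Dp1 (gn_ini v)).
  by rewrite -!mulrA [p1 * ((v : B) * (p1 * _))]mulrA [p1 * v * _]mulrA [p1 * v * p1]dp1 mul0r !mulr0.
have d3 : displaced v q3.
  rewrite /displaced /q3 !mulrA -[_ * (v : B) * adj v]mulrA -[_ * (_ * adj v) * p1]mulrA.
  rewrite (DC (gn_fin v) Dp1) -!mulrA [p1 * ((v : B) * (p1 * _))]mulrA [p1 * v * _]mulrA.
  by rewrite [p1 * v * p1]dp1 mul0r !mulr0.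
pose z := (1 - e) * (1 - p1).
have zP : projections D z by apply: projD_mul; exact: projD_C.
have [Dz zz _] := zP.
have zE : z = 1 - e - p1 by rewrite /z mulrBr mulr1 mulrBl mul1r ep1 subr0.
have p2P := projD_mul zP q2P.
have z2P := projD_mul zP (projD_C q2P).
have p3P := projD_mul z2P q3P.
have rP := projD_mul z2P (projD_C q3P).
set r := z * (1 - q2) * (1 - q3) in rP.
have [Dr rr _] := rP.
have er : e * r = 0 by rewrite /r /z !mulrA (proj_compl ee).1 !mul0r.
have r0 : r = 0.
  apply: contrapT => rn.
  have [|q [qP rq qn dq]] := @displaced_ex v r rP.
    move=> Nr; have fr := Nfix _ Dr Nr.
    have erP := projections_add vD eP rP er.
    have er1 : e + r = e.
      apply: emax => //; last by rewrite /ple mulrDl ee -(DC De Dr) er addr0.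
      by move=> d Dd; rewrite mulrDr fe // fr // addr0.
    exact: rn (addr_fix er1).
  have [Dq qq _] := qP.
  have kill x : D x -> r * x = 0 -> q * x = 0.
    by move=> Dx rx; rewrite -rq (DC Dr Dq) -mulrA rx mulr0.
  have D1p x : D x -> D (1 - x) by move=> Dx; apply: (vND vD); [exact: (vN1 vD)|exact: (vNN vD)].
  have eq0 : e * q = 0 by rewrite -rq mulrA er mul0r.
  have rp1 : r * p1 = 0.
    have pz : p1 * z = 0 by rewrite /z (DC (D1p _ De) (D1p _ Dp1)) mulrA (proj_compl pp1).1 mul0r.
    by rewrite (DC Dr Dp1) /r [p1 * _]mulrA [p1 * (z * _)]mulrA pz !mul0r.
  have rq2 : r * q2 = 0.
    have qz : q2 * (z * (1 - q2)) = 0.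
      by rewrite (DC Dz (D1p _ Dq2)) mulrA (proj_compl qq2).1 mul0r.
    by rewrite (DC Dr Dq2) /r mulrA qz mul0r.
  have rq3 : r * q3 = 0 by rewrite /r -mulrA (proj_compl qq3).2 mulr0.
  have pq : p1 * q = 0 by rewrite (DC Dp1 Dq) kill.
  have p1qP := projections_add vD p1P qP pq.
  have : p1 + q = p1.
    apply: p1max => //; last by rewrite /ple mulrDl pp1 (DC Dq Dp1) pq addr0.
    split; first by rewrite mulrDr ep1 eq0 addr0.
    rewrite /displaced mulrDl mulrDr !mulrDl [p1 * v * p1]dp1 [q * v * q]dq add0r addr0.
    have -> : p1 * v * q = (v : B) * (q3 * q) by rewrite (gn_pull v Dp1) -mulrA.
    rewrite (DC Dq3 Dq) (kill q3) // mulr0 addr0.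
    by rewrite -mulrA (gn_push v Dp1) -/q2 mulrA (kill q2) // mul0r.
  by move/addr_fix.
exists e, p1, (z * q2), (z * (1 - q2) * q3); split.
- by split.
- exact: fixN.
- split=> //.
    by apply: (displaced_le q2P p2P _ d2); rewrite -mulrA qq2.
  by apply: (displaced_le q3P p3P _ d3); rewrite -mulrA qq3.
have -> : z * (1 - q2) * q3 = z * (1 - q2).
  by apply/eqP; rewrite eq_sym -subr_eq0 -{1}[z * (1 - q2)]mulr1 -mulrBr -/r r0.
by rewrite -addrA -mulrDr [q2 + _]addrC subrK mulr1 zE -[1 - e - _]addrA -opprD addrC subrK.
Qed.

End Normalizers.

(** * Normalizers in the span of the unitary normalizers *)

Section Span.
Variables (R : realType) (H : hilbertType R).
Local Notation B := (bop H).

Lemma lspan_subspace (A : set B) : subspace (lspan A).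
Proof.
split.
  by exists 0%N, (fun=> 0), (fun=> 0); split; [case|rewrite big_ord0].
move=> k _ _ [n [cx [a [Aa ->]]]] [m [cy [b [Ab ->]]]].
exists (n + m)%N, (fun i => match fintype.split i with inl j => k * cx j | inr j => cy j end),
  (fun i => match fintype.split i with inl j => a j | inr j => b j end); split.
  by move=> i; case: (fintype.split i).
rewrite big_split_ord /= scaler_sumr; congr (_ + _); apply: eq_bigr => i _.
  by rewrite (unsplitK (inl i)) scalerA.
by rewrite (unsplitK (inr i)).
Qed.

Lemma lspan_incl (A : set B) : A `<=` lspan A.
Proof.
move=> x Ax; exists 1%N, (fun=> 1), (fun=> x); split=> //.
by rewrite big_ord1 scale1r.
Qed.

Lemma lspan_min (A S : set B) : subspace S -> A `<=` S -> lspan A `<=` S.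
Proof.
move=> sS AS _ [n [k [a [Aa ->]]]].
elim: n k a Aa => [|n IH] k a Aa; first by rewrite big_ord0; exact: ss0.
by rewrite big_ord_recl; apply: ssP => //; [apply: AS|apply: IH].
Qed.

Lemma lspan_mulr (A : set B) : (forall x y, A x -> A y -> A (x * y)) ->
  forall x y, lspan A x -> lspan A y -> lspan A (x * y).
Proof.
move=> AM; have sA := lspan_subspace A.
have h1 x y : A x -> lspan A y -> lspan A (x * y).
  move=> Ax; move: y; apply: lspan_min => [|y Ay] /=; last by apply: lspan_incl; exact: AM.
  split; first by rewrite /= mulr0; exact: ss0.
  by move=> k y z hy hz; rewrite /= mulrDr -bop_scalerAr; exact: ssP.
move=> x y Ax Ay; move: x Ax; apply: lspan_min => [|x Ax] /=; last exact: h1.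
split; first by rewrite /= mul0r; exact: ss0.
by move=> k x z hx hz; rewrite /= mulrDl -bop_scalerAl; exact: ssP.
Qed.

Lemma lspan_adj (A : set B) : (forall x, A x -> A (adj x)) -> forall x, lspan A x -> lspan A (adj x).
Proof.
move=> Aadj; have sA := lspan_subspace A.
apply: lspan_min => [|x Ax] /=; last by apply: lspan_incl; exact: Aadj.
split; first by rewrite /= adj0; exact: ss0.
by move=> k x y hx hy; rewrite /= adjD adjZ; exact: ssP.
Qed.

End Span.

Section UnitaryNormalizers.
Variables (R : realType) (H : hilbertType R).
Local Notation B := (bop H).
Local Notation C := R[i].
Variables (M N D : set B) (c : cartan_triple M N D).
Local Notation vM := (ct_vNM c).
Local Notation vD := (ct_vND c).
Local Notation vN := (ct_vNN c).

Definition unitary_normalizers : set B := unitaries M `&` GN M D.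
Local Notation U := unitary_normalizers.

Lemma unorm_intro u : M u -> unitary u ->
  (forall d, D d -> D (adj u * d * u)) -> (forall d, D d -> D (u * d * adj u)) -> U u.
Proof. by move=> Mu [uu uu'] h1 h2; split; split=> //; rewrite /partial_isometry uu' mul1r. Qed.

Lemma unormM u v : U u -> U v -> U (u * v).
Proof.
move=> [[Mu [uu uu']] [_ _ lu ru]] [[Mv [vv vv']] [_ _ lv rv]].
apply: unorm_intro.
- exact: (vNM vM).
- by split; rewrite adjM -!mulrA; [rewrite [adj u * _]mulrA uu mul1r|rewrite [v * _]mulrA vv' mul1r].
- by move=> d Dd; rewrite adjM !mulrA -[adj v * _ * d]mulrA -[adj v * _ * u]mulrA; apply: lv; exact: lu.
- by move=> d Dd; rewrite adjM !mulrA -[u * v * d]mulrA -[u * _ * adj v]mulrA; apply: ru; exact: rv.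
Qed.

Lemma unormV u : U u -> U (adj u).
Proof.
move=> [[Mu [uu uu']] [_ _ lu ru]]; apply: unorm_intro; rewrite /unitary ?adjK //.
exact: (vN_adj vM).
Qed.

Lemma unorm_unitN : unitaries N `<=` U.
Proof.
move=> u [Nu [uu uu']].
have Nu' := vN_adj vN Nu.
apply: unorm_intro => [|//|d Dd|d Dd]; first exact: (NM c).
- by rewrite (N_comm c Nu' Dd) -mulrA uu mulr1.
- by rewrite (N_comm c Nu Dd) -mulrA uu' mulr1.
Qed.

(** p is a combination of 1 and of the unitary 2 p - 1. *)
Lemma lspan_unorm_cut u p : U u -> projections D p -> lspan U (u * p).
Proof.
move=> Uu [Dp pp sp].
have Us : U (p + p - 1).
  apply: unorm_unitN; split.
    by apply: (DN c); apply: (vND vD); [exact: (vND vD)|apply: (vNN vD); exact: (vN1 vD)].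
  have s : adj (p + p - 1) = p + p - 1 by rewrite adjB adjD sp adj1.
  suff e : (p + p - 1) * (p + p - 1) = 1 by split; rewrite s.
  rewrite mulrBl mul1r mulrBr mulr1 mulrDl !mulrDr !pp.
  by rewrite addrK opprB addrC subrK.
have -> : u * p = (2^-1 : C) *: u + (2^-1 : C) *: (u * (p + p - 1)).
  rewrite -scalerDr (_ : u + _ = 2%:R *: (u * p)) ?scalerA; last first.
    by rewrite mulrBr mulr1 addrC subrK mulrDr scaler_nat mulr2n.
  by rewrite mulVf ?scale1r // pnatr_eq0.
have sU := lspan_subspace U.
by apply: ssD => //; apply: ssZ => //; apply: lspan_incl => //; exact: unormM.
Qed.

(** D is central in N, so w w^* and w^* w absorb each other. *)
Lemma gn_N_proj (w : gn c) : N w -> (w : B) * adj w = adj w * (w : B).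
Proof.
move=> Nw; pose g := adj w * (w : B).
have Dg : D g := gn_ini w.
have h1 : g * ((w : B) * adj w) = (w : B) * adj w.
  by rewrite mulrA -(N_comm c Nw Dg) gn_iniK.
have h2 : ((w : B) * adj w) * g = g.
  by rewrite /g mulrA -(N_comm c (vN_adj vN Nw) (gn_fin w)) mulrA gn_ipi.
by rewrite -h1 (DC c Dg (gn_fin w)) h2.
Qed.

(** A partial isometry with equal initial and final projection extends to a unitary by
the identity on the complement; in N this is a normalizer. *)
Lemma lspan_unorm_N (w : gn c) : N w -> lspan U w.
Proof.
move=> Nw; pose g := adj w * (w : B).
have gP : projections D g := gn_iniP w.
have [Dg gg sg] := gP.
have e : (w : B) * adj w = g := gn_N_proj Nw.
have wg : (w : B) * g = w by exact: gn_iniK.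
have gw : g * w = w by rewrite -(N_comm c Nw Dg).
have D1g : D (1 - g) by case: (projD_C c gP).
have [g1 g2] := proj_compl gg.
have s1 : adj (1 - g) = 1 - g by rewrite adjB adj1 sg.
have w1 : (w : B) * (1 - g) = 0 by rewrite mulrBr mulr1 wg subrr.
have w2 : (1 - g) * (w : B) = 0 by rewrite mulrBl mul1r gw subrr.
have w3 : adj w * (1 - g) = 0 by rewrite -[1 - g]s1 -adjM w2 adj0.
have w4 : (1 - g) * adj w = 0 by rewrite -[1 - g]s1 -adjM w1 adj0.
have qq : (1 - g) * (1 - g) = 1 - g by rewrite mulrBr mulr1 g2 subr0.
have hg : g + (1 - g) = 1 by rewrite addrC subrK.
move: (1 - g) D1g g2 s1 w1 w2 w3 w4 qq hg => h Dh hg sh w1 w2 w3 w4 hh gh.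
have Uu : U ((w : B) + h).
  apply: unorm_unitN; split; first by apply: (vND vN) => //; exact: (DN c).
  by split; rewrite adjD sh mulrDl !mulrDr ?w1 ?w2 ?w3 ?w4 hh ?e addr0 add0r.
have -> : (w : B) = ((w : B) + h) * g by rewrite mulrDl hg addr0 wg.
exact: lspan_unorm_cut.
Qed.

(** A partial isometry with orthogonal initial and final projections extends to a
symmetry exchanging the two. *)
Lemma lspan_unorm_nil (w : gn c) : (w : B) * w = 0 -> lspan U w.
Proof.
move=> ww; pose e := adj w * (w : B); pose f := (w : B) * adj w.
have [De ee se] : projections D e := gn_iniP w.
have [Df ff sf] : projections D f := gn_finP w.
have ww' : adj w * adj w = 0 by rewrite -adjM ww adj0.
have ef : e * f = 0 by rewrite /e /f mulrA -[_ * (w : B) * w]mulrA ww mulr0 mul0r.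
have fe : f * e = 0 by rewrite (DC c Df De).
have we : (w : B) * e = w by exact: gn_iniK.
have fw : f * w = w by exact: gn_pi.
have ew : e * w = 0 by rewrite /e -mulrA ww mulr0.
have wf : (w : B) * f = 0 by rewrite /f mulrA ww mul0r.
have ew' : e * adj w = adj w by rewrite -{1}se -adjM we.
have w'f : adj w * f = adj w by rewrite -{1}sf -adjM fw.
have w'e : adj w * e = 0 by rewrite -{1}se -adjM ew adj0.
have fw' : f * adj w = 0 by rewrite -{1}sf -adjM wf adj0.
pose g := 1 - e - f.
have Dg : D g.
  by apply: (vND vD); [apply: (vND vD); [exact: (vN1 vD)|exact: (vNN vD)]|exact: (vNN vD)].
have sg : adj g = g by rewrite /g !adjB adj1 se sf.
have eg : e * g = 0 by rewrite /g !mulrBr mulr1 ee ef subrr subr0.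
have fg : f * g = 0 by rewrite /g !mulrBr mulr1 ff fe subr0 subrr.
have ge : g * e = 0 by rewrite (DC c Dg De).
have gf : g * f = 0 by rewrite (DC c Dg Df).
have gg : g * g = g by rewrite {1}/g !mulrBl mul1r eg fg !subr0.
have wg : (w : B) * g = 0 by rewrite -we -mulrA eg mulr0.
have gw : g * w = 0 by rewrite -fw mulrA gf mul0r.
have w'g : adj w * g = 0 by rewrite -w'f -mulrA fg mulr0.
have gw' : g * adj w = 0 by rewrite -ew' mulrA ge mul0r.
have gE : g = 1 - e - f by [].
clearbody g.
(* w + w^* exchanges e and f, and u is the identity on the complement g. *)
pose u := (w : B) + adj w + g.
have su : adj u = u by rewrite /u !adjD adjK sg [adj w + _]addrC.
have uu : u * u = 1.
  rewrite {1}/u !mulrDl /u !mulrDr ww ww' wg w'g gw gw' gg !addr0 !add0r.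
  by rewrite -/e -/f gE -[1 - e - f]addrA -opprD [e + f]addrC [f + e + _]addrCA subrr addr0.
have ud d : D d -> D (u * d * u).
  move=> Dd.
  have x1 : (w : B) * d * w = 0 by rewrite -{2}fw mulrA -[_ * d * f]mulrA (DC c Dd Df) mulrA wf !mul0r.
  have x2 : adj w * d * adj w = 0.
    by rewrite -{2}ew' mulrA -[_ * d * e]mulrA (DC c Dd De) mulrA w'e !mul0r.
  have x3 : (w : B) * d * g = 0 by rewrite -mulrA (DC c Dd Dg) mulrA wg mul0r.
  have x4 : adj w * d * g = 0 by rewrite -mulrA (DC c Dd Dg) mulrA w'g mul0r.
  have x5 : g * d * w = 0 by rewrite (DC c Dg Dd) -mulrA gw mulr0.
  have x6 : g * d * adj w = 0 by rewrite (DC c Dg Dd) -mulrA gw' mulr0.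
  have -> : u * d * u = (w : B) * d * adj w + adj w * d * w + g * d * g.
    by rewrite {1}/u !mulrDl /u !mulrDr x1 x2 x3 x4 x5 x6 !addr0 !add0r.
  apply: (vND vD); first by apply: (vND vD); [exact: gn_r|exact: gn_l].
  by do 2!apply: (vNM vD) => //.
have Uu : U u.
  apply: unorm_intro; rewrite /unitary ?su //.
  apply: (vND vM); last exact: (DM c).
  by apply: (vND vM); [exact: gn_M|exact: gn_MA].
have -> : (w : B) = u * e by rewrite /u !mulrDl we w'e ge !addr0.
apply: lspan_unorm_cut => //; exact: (gn_iniP w).
Qed.

Lemma gn_lspan_unorm : GN M D `<=` lspan U.
Proof.
move=> x hx; pose v := Gn c (mem_set hx).
have [e [p1 [p2 [p3 [[eP p1P p2P p3P] Ne [d1 d2 d3] e1]]]]] := fixed_displaced_decomp v.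
have -> : x = (v : B) * e + (v : B) * p1 + (v : B) * p2 + (v : B) * p3.
  by rewrite -!mulrDr e1 mulr1.
have sU := lspan_subspace U.
have disp p (pP : projections D p) : displaced v p -> lspan U ((v : B) * p).
  move=> dp; apply: (@lspan_unorm_nil (gn_mul v (projgn c pP))).
  by rewrite /= -mulrA [p * _]mulrA [p * _ * p]dp mulr0.
do 3![apply: ssD => //; last exact: disp].
exact: (@lspan_unorm_N (gn_mul v (projgn c eP))).
Qed.

Lemma unorm_dense : weakstar_dense (lspan U) M.
Proof.
move=> x Mx; apply: closureS (ct_regular c Mx).
apply: lspan_min => [|y]; [exact: lspan_subspace|exact: gn_lspan_unorm].
Qed.

End UnitaryNormalizers.

(** * The projection onto a subspace of a semi-inner product space *)

Section MoreForms.
Variables (R : realType) (V : lmodType R[i]) (S : set V) (s : V -> V -> R[i]).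
Hypothesis ips : semi_inner S s.
Local Notation C := R[i].

Lemma sqD x y : S x -> S y -> sq s (x + y) <= 2 * (sq s x + sq s y).
Proof.
move=> Sx Sy; have sS := si_sub ips; have Sp := ssD sS Sx Sy; have Sm := ssB sS Sx Sy.
have := sq_ge0 ips Sm.
have e : sq s (x + y) + sq s (x - y) = 2 * (sq s x + sq s y).
  apply: complexI; rewrite !(rmorphM, rmorphD, rmorph1, rmorph_nat) /= -!(sqE ips) //.
  rewrite (siDl ips Sx Sy Sp) (siBl ips Sx Sy Sm) !(siDr ips _ Sx Sy) // !(siBr ips _ Sx Sy) //.
  ring.
move: e; lra.
Qed.

Lemma msq_sym (a b : C) : msq (a - b) = msq (b - a).
Proof. by rewrite -msqN opprB. Qed.

Lemma msqC (a : C) : msq a^* = msq a.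
Proof. by rewrite !msq_ReIm; case: a => a b /=; rewrite sqrrN. Qed.

Lemma msq_tri (a b z : C) : msq (a - z) <= 2 * (msq (a - b) + msq (b - z)).
Proof. by rewrite -(subrKA b); exact: msqD. Qed.

Lemma msqM (a b : C) : msq (a * b) = msq a * msq b.
Proof. rewrite !msq_ReIm; case: a b => a a' [b b'] /=; ring. Qed.

Lemma msq_eq0 (a : C) : msq a = 0 -> a = 0.
Proof.
rewrite msq_ReIm => h; apply/eqP; rewrite eq_complex.
have := sqr_ge0 (complex.Re a); have := sqr_ge0 (complex.Im a) => h1 h2.
by rewrite -sqrf_eq0 -[complex.Im a == _]sqrf_eq0; apply/andP; split; apply/eqP; lra.
Qed.

Lemma le_small (r K : R) : 0 <= K -> (forall d, 0 < d -> r <= K * d) -> r <= 0.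
Proof.
move=> K0 h; apply/ler_addgt0Pl => e e0; rewrite addr0.
apply: le_trans (h (e / (K + 1)) _) _; first by rewrite divr_gt0 //; lra.
by rewrite mulrA ler_pdivrMr; nra.
Qed.

Lemma msq_small (a : C) K : 0 <= K -> (forall d, 0 < d -> msq a <= K * d) -> a = 0.
Proof.
by move=> K0 h; apply: msq_eq0; apply/eqP; rewrite eq_le msq_ge0 andbT; exact: le_small h.
Qed.

Lemma real_complete (u : nat -> R) :
  (forall e, 0 < e -> exists k, forall n m, (k <= n)%N -> (k <= m)%N -> `|u n - u m| <= e) ->
  exists l, forall e, 0 < e -> exists k, forall n, (k <= n)%N -> `|l - u n| <= e.
Proof.
move=> uC; pose E := [set t : R | exists k, forall n, (k <= n)%N -> t <= u n].
have Eub k e : 0 < e -> (forall n m, (k <= n)%N -> (k <= m)%N -> `|u n - u m| <= e) ->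
    E (u k - e) /\ ubound E (u k + e).
  move=> e0 hk; split.
    exists k => n kn; have := hk k n (leqnn _) kn; rewrite ler_norml => /andP[]; lra.
  move=> t [k' hk']; have := hk k (maxn k k') (leqnn _) (leq_maxl _ _).
  rewrite ler_norml => /andP[? _]; have := hk' (maxn k k') (leq_maxr _ _); lra.
exists (sup E) => e e0; have [k hk] := uC (e / 2) ltac:(lra).
have e2 : 0 < e / 2 by lra.
have [Ek ubE] := Eub k _ e2 hk.
have h1 : u k - e / 2 <= sup E by apply: ub_le_sup Ek; exists (u k + e / 2).
have h2 : sup E <= u k + e / 2 by apply: ge_sup => //; exists (u k - e / 2).
exists k => n kn; have := hk k n (leqnn _) kn; rewrite !ler_norml => /andP[? ?].
apply/andP; split; lra.
Qed.

Lemma msq_complete (u : nat -> C) :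
  (forall e, 0 < e -> exists k, forall n m, (k <= n)%N -> (k <= m)%N -> msq (u n - u m) <= e) ->
  exists l, forall e, 0 < e -> exists k, forall n, (k <= n)%N -> msq (l - u n) <= e.
Proof.
move=> uC.
have sqr_le (a e : R) : 0 <= e -> a ^+ 2 <= e ^+ 2 -> `|a| <= e.
  by move=> e0; rewrite -[a ^+ 2]real_normK ?num_real // ler_pXn2r ?nnegrE.
have [|l lP] := @real_complete (fun n => complex.Re (u n)).
  move=> e e0; have [k kP] := uC (e ^+ 2) ltac:(by rewrite exprn_gt0).
  exists k => n m kn km; apply: sqr_le; first exact: ltW.
  rewrite -raddfB; apply: le_trans (Re_msq _) _; exact: kP.
have [|l' lP'] := @real_complete (fun n => complex.Im (u n)).
  move=> e e0; have [k kP] := uC (e ^+ 2) ltac:(by rewrite exprn_gt0).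
  exists k => n m kn km; apply: sqr_le; first exact: ltW.
  rewrite -raddfB; apply: le_trans _ (kP n m kn km).
  by rewrite msq_ReIm lerDr sqr_ge0.
exists (l +i* l')%C => e e0.
have e1 : 0 < Num.min 1 (e / 2) by rewrite lt_min ltr01 divr_gt0.
have [k kP] := lP _ e1; have [k' kP'] := lP' _ e1.
exists (maxn k k') => n; rewrite geq_max => /andP[/kP h1 /kP' h2].
have small (a : R) : `|a| <= Num.min 1 (e / 2) -> a ^+ 2 <= e / 2.
  rewrite le_min => /andP[a1 a2]; rewrite -real_normK ?num_real //.
  have := normr_ge0 a; set t := `|a| in a1 a2 *; nra.
rewrite msq_ReIm raddfB [X in _ + X ^+ 2]raddfB /=.
have := small _ h1; have := small _ h2; lra.
Qed.

End MoreForms.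

Section ProjectionForm.
Variables (R : realType) (V : lmodType R[i]) (S A : set V) (s : V -> V -> R[i]).
Hypotheses (ips : semi_inner S s) (sA : subspace A) (AS : A `<=` S).
Local Notation C := R[i].
Local Notation sqs := (sq s).

Let ipA : semi_inner A s.
Proof.
split=> // [a x y z /AS Sx /AS Sy /AS Sz|x y /AS Sx /AS Sy|x /AS Sx].
- exact: (si_lin ips).
- exact: (si_conj ips).
- exact: (si_ge0 ips).
Qed.

(** z is at distance at most sqrt d from the projection of x onto the closure of A. *)
Let ap x d z := approx A s (s^~ x) d z.

Let ap_ex x d : S x -> 0 < d -> exists z, ap x d z.
Proof.
move=> Sx d0; apply: (@approx_riesz _ _ _ _ ipA _ _ (sqs x)) d0 => [a y z /AS Sy /AS Sz|a /AS Sa].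
  exact: (si_lin ips).
by rewrite mulrC; exact: (form_CS ips).
Qed.

Let ap_sq x d z : S x -> 0 <= d -> ap x d z -> sqs z <= 2 * (d + sqs x).
Proof.
move=> Sx d0 [Az hz]; have Sz := AS Az; have z0 := sq_ge0 ips Sz; have x0 := sq_ge0 ips Sx.
have h : sqs z ^+ 2 <= 2 * (d + sqs x) * sqs z.
  have -> : sqs z ^+ 2 = msq (s z z) by rewrite (sqE ips) // msq_ReIm /= expr0n addr0.
  have := msq_tri (s z z) (s z x) 0; rewrite !subr0 => /le_trans; apply.
  rewrite msq_sym; have := hz _ Az; have := form_CS ips Sz Sx; nra.
have [->|zn] := eqVneq (sqs z) 0; first lra.
by move: h; rewrite expr2 ler_pM2r // lt_neqAle eq_sym zn.
Qed.

(** The value is the limit of s y (z n), with z n an approximation of the projection of x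
for the error 1 / (n + 1).  The constant 8 comes from applying the inequality
|a + b|^2 <= 2 |a|^2 + 2 |b|^2 twice. *)
Lemma proj_form_ex : exists bf : V -> V -> C, forall x y d z, S x -> S y -> 0 < d ->
  ap x d z -> msq (bf y x - s y z) <= 8 * d * sqs y.
Proof.
suff ex (xy : V * V) : exists l : C, S xy.1 -> S xy.2 -> forall d z, 0 < d ->
    ap xy.1 d z -> msq (l - s xy.2 z) <= 8 * d * sqs xy.2.
  have [bf bfP] := choice ex; exists (fun y x => bf (x, y)) => x y d z Sx Sy d0 hz.
  exact: (bfP (x, y)).
case: xy => x y /=.
have [[Sx Sy]|nS] := pselect (S x /\ S y); last by exists 0 => ? ?; case: nS.
have inv0 n : 0 < n.+1%:R^-1 :> R by rewrite invr_gt0.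
have [z zP] := choice (fun n => ap_ex Sx (inv0 n)).
have y0 := sq_ge0 ips Sy.
have close d d' t t' : 0 < d -> 0 < d' -> ap x d t -> ap x d' t' ->
    msq (s y t - s y t') <= sqs y * (2 * (d + d')).
  move=> d0 d0' ht ht'; have St := AS ht.1; have St' := AS ht'.1.
  rewrite -(siBr ips) //; apply: le_trans (form_CS ips Sy _) _.
    exact: (ssB (si_sub ips)).
  apply: ler_wpM2l => //; apply: (approx_close ipA) ht ht'; exact: ltW.
have [|l lP] := @msq_complete R (fun n => s y (z n)).
  move=> e e0; have e1 : 0 < e / (4 * sqs y + 1) by rewrite divr_gt0 //; lra.
  have [k kP] := inv_small e1; exists k => n m kn km.
  apply: le_trans (close _ _ _ _ (inv0 n) (inv0 m) (zP n) (zP m)) _.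
  have := kP _ kn; have := kP _ km; have := inv0 n; have := inv0 m.
  move: n.+1%:R^-1 m.+1%:R^-1 => p q; rewrite !ler_pdivlMr; nra.
exists l => _ _ d t d0 ht; apply/ler_addgt0Pl => e e0.
have [k1 k1P] := lP (e / 2) ltac:(lra).
have [k2 k2P] := inv_small d0.
pose n := maxn k1 k2.
apply: le_trans (msq_tri _ (s y (z n)) _) _.
have h1 := k1P n (leq_maxl _ _).
have h2 := close _ _ _ _ (inv0 n) d0 (zP n) ht.
have := k2P n (leq_maxr _ _); move: n.+1%:R^-1 h2 => p; nra.
Qed.

(** The form (y, x) |-> <y, P x>, with P the orthogonal projection onto the closure of A
in the completion of (S, s); its values are limits of values of s. *)
Definition proj_form : V -> V -> C := sval (cid proj_form_ex).
Local Notation bf := proj_form.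

Lemma proj_formP x y d z : S x -> S y -> 0 < d -> ap x d z -> msq (bf y x - s y z) <= 8 * d * sqs y.
Proof. exact: (svalP (cid proj_form_ex)). Qed.

Lemma proj_form_A x a : S x -> A a -> bf a x = s a x.
Proof.
move=> Sx Aa; have Sa := AS Aa; have a0 := sq_ge0 ips Sa.
apply/subr0_eq.
apply: (@msq_small R _ (18 * sqs a)) => [|d d0]; first lra.
have [z hz] := ap_ex Sx d0.
apply: le_trans (msq_tri _ (s a z) _) _.
have := proj_formP Sx Sa d0 hz; have := hz.2 _ Aa; rewrite msq_sym; lra.
Qed.

Lemma proj_form_bound x y : S x -> S y -> msq (bf y x) <= 4 * sqs x * sqs y.
Proof.
move=> Sx Sy; have x0 := sq_ge0 ips Sx; have y0 := sq_ge0 ips Sy.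
rewrite -subr_le0; apply: (@le_small R _ (20 * sqs y)) => [|d d0]; first lra.
have [z hz] := ap_ex Sx d0; have Sz := AS hz.1.
have := msq_tri (bf y x) (s y z) 0; rewrite !subr0.
have := proj_formP Sx Sy d0 hz; have := form_CS ips Sy Sz; have := ap_sq Sx (ltW d0) hz.
have := sq_ge0 ips Sz; nra.
Qed.

Lemma proj_form_conj x y : S x -> S y -> bf y x = (bf x y)^*.
Proof.
move=> Sx Sy; have x0 := sq_ge0 ips Sx; have y0 := sq_ge0 ips Sy.
apply/subr0_eq.
pose K := 100 * (sqs x + sqs y + 1).
suff h d : 0 < d -> d <= 1 -> msq (bf y x - (bf x y)^*) <= K * d.
  apply: (@msq_small R _ (K + msq (bf y x - (bf x y)^*))) => [|d d0].
    by rewrite addr_ge0 ?msq_ge0 // /K; lra.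
  have m0 := msq_ge0 (bf y x - (bf x y)^*); have K0 : 0 <= K by rewrite /K; lra.
  have [d1|d1] := lerP d 1; first by have := h d d0 d1; nra.
  nra.
move=> d0 d1; have [z hz] := ap_ex Sx d0; have [t ht] := ap_ex Sy d0.
have Sz := AS hz.1; have St := AS ht.1.
have z2 := ap_sq Sx (ltW d0) hz; have t2 := ap_sq Sy (ltW d0) ht.
have z0 := sq_ge0 ips Sz; have t0 := sq_ge0 ips St.
have h1 := proj_formP Sx Sy d0 hz; have h2 := proj_formP Sy Sx d0 ht.
have h3 := hz.2 _ ht.1; have h4 := ht.2 _ hz.1.
have h5 : msq (s y z - s t z) <= d * sqs z.
  by rewrite (si_conj ips) // [s t z](si_conj ips) // -rmorphB msqC.
have h6 : msq (s t x - (bf x y)^*) <= 8 * d * sqs x.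
  by rewrite (si_conj ips) // -rmorphB msqC msq_sym.
have g1 := msq_tri (bf y x) (s y z) (s t z).
have g2 := msq_tri (s t z) (s t x) (bf x y)^*.
have g3 := msq_tri (bf y x) (s t z) (bf x y)^*.
rewrite msq_sym in h3.
rewrite /K; nra.
Qed.

Lemma proj_form_lin x a y y' : S x -> S y -> S y' -> bf (a *: y + y') x = a * bf y x + bf y' x.
Proof.
move=> Sx Sy Sy'; have sS := si_sub ips.
have Sc : S (a *: y + y') by exact: ssP.
have y0 := sq_ge0 ips Sy; have y0' := sq_ge0 ips Sy'; have c0 := sq_ge0 ips Sc.
have a0 := msq_ge0 a.
apply/subr0_eq.
apply: (@msq_small R _ (16 * sqs (a *: y + y') + 32 * (msq a * sqs y + sqs y'))).
  by have := mulr_ge0 a0 y0; lra.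
move=> d d0; have [z hz] := ap_ex Sx d0; have Sz := AS hz.1.
apply: le_trans (msq_tri _ (s (a *: y + y') z) _) _.
have h1 := proj_formP Sx Sc d0 hz; have h2 := proj_formP Sx Sy d0 hz; have h3 := proj_formP Sx Sy' d0 hz.
have : msq (s (a *: y + y') z - (a * bf y x + bf y' x)) <=
    2 * (msq a * msq (bf y x - s y z) + msq (bf y' x - s y' z)).
  rewrite [leLHS]msq_sym (si_lin ips) // [X in msq X <= _](_ : _ = a * (bf y x - s y z) + (bf y' x - s y' z)); last by ring.
  by apply: le_trans (msqD _ _) _; rewrite msqM.
have : msq a * msq (bf y x - s y z) <= msq a * (8 * d * sqs y) by apply: ler_wpM2l.
lra.
Qed.

Lemma proj_form_orth x y : S x -> S y -> (forall a, A a -> s a x = 0) -> bf y x = 0.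
Proof.
move=> Sx Sy h; have y0 := sq_ge0 ips Sy.
apply: (@msq_small R _ (8 * sqs y)) => [|d d0]; first lra.
have := @proj_formP x y d 0 Sx Sy d0; rewrite (si_conj ips) //; last exact: (ss0 (si_sub ips)).
rewrite (si0l ips) // conjC0 subr0 => hh; rewrite mulrAC; apply: hh; split; first exact: ss0.
move=> a Aa; rewrite h // (si_conj ips) ?(si0l ips) ?conjC0 ?subr0; [|exact: AS|exact: AS|exact: (ss0 (si_sub ips))].
rewrite msq_ReIm /= expr0n /= addr0; apply: mulr_ge0; first exact: ltW.
exact: (sq_ge0 ips (AS Aa)).
Qed.

(** P commutes with an operator b that leaves A invariant together with its adjoint b'. *)
Lemma proj_form_mul (b b' : V -> V) k x y : 0 < k -> (forall z, S z -> S (b z) /\ S (b' z)) ->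
  (forall z, A z -> A (b z) /\ A (b' z)) ->
  (forall z t, S z -> S t -> s (b z) t = s z (b' t)) ->
  (forall z, S z -> sqs (b z) <= k * sqs z) -> S x -> S y -> bf (b y) x = bf y (b' x).
Proof.
move=> k0 Sb Ab bb' bk Sx Sy; have [Sby _] := Sb _ Sy; have [_ Sbx] := Sb _ Sx.
have y0 := sq_ge0 ips Sy; have by0 := sq_ge0 ips Sby.
apply/subr0_eq.
apply: (@msq_small R _ (16 * sqs (b y) + 16 * k * sqs y)) => [|d d0]; first nra.
have [z hz] := ap_ex Sx d0; have Sz := AS hz.1.
(* b' z approximates P (b' x), with the error k d. *)
have hz' : ap (b' x) (k * d) (b' z).
  split=> [|a Aa]; first by have [] := Ab _ hz.1.
  have [Aba _] := Ab _ Aa.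
  rewrite -!bb' //; try exact: AS.
  apply: le_trans (hz.2 _ Aba) _; have := bk a (AS Aa); nra.
apply: le_trans (msq_tri _ (s (b y) z) _) _.
have h1 := proj_formP Sx Sby d0 hz.
have h2 := proj_formP Sbx Sy (mulr_gt0 k0 d0) hz'.
rewrite -bb' // msq_sym in h2; nra.
Qed.

End ProjectionForm.

(** * Normal functionals and domination by vector states *)

Section NormalFunctional.
Variables (R : realType) (H : hilbertType R).
Local Notation B := (bop H).
Local Notation C := R[i].

(** Positive functionals on M, with normality tested on increasing nets of projections. *)
Record normal_functional (M : set B) (om : B -> C) : Prop := NormalFunctional {
  nf_lin : forall a x y, M x -> M y -> om (a *: x + y) = a * om x + om y;
  nf_pos : forall x, M x -> 0 <= om (adj x * x);
  nf_conj : forall x, M x -> om (adj x) = (om x)^*;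
  nf_normal : forall (X : set B) P, X `<=` projections M -> directed X ple ->
    projections M P -> (forall p, X p -> ple p P) -> slim X ple id P ->
    forall e : R, 0 < e -> exists2 p, X p & complex.Re (om (P - p)) <= e
}.

Variables (M : set B) (om : B -> C).
Hypotheses (vM : von_neumann M) (nf : normal_functional M om).

Let s x y := om (adj y * x).

Lemma vN_subspace : subspace M.
Proof. by split=> [|a x y Mx My]; [exact: (vN0 vM)|apply: (vND vM) => //; exact: (vNZ vM)]. Qed.

Lemma nf_semi_inner : semi_inner M s.
Proof.
split=> [|a x y z Mx My Mz|x y Mx My|x Mx].
- exact: vN_subspace.
- have Mz' := vN_adj vM Mz.
  by rewrite /s mulrDr -bop_scalerAr (nf_lin nf) //; exact: (vNM vM).
- rewrite /s -(nf_conj nf); last by apply: (vNM vM) => //; exact: (vN_adj vM).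
  by rewrite adjM adjK.
- exact: (nf_pos nf).
Qed.
Local Notation ips := nf_semi_inner.
Local Notation osq := (sq s).

Lemma nfB x y : M x -> M y -> om (x - y) = om x - om y.
Proof.
by move=> Mx My; rewrite addrC -scaleN1r (nf_lin nf) // mulN1r addrC.
Qed.

Lemma nfD x y : M x -> M y -> om (x + y) = om x + om y.
Proof. by move=> Mx My; rewrite -[x in LHS]scale1r (nf_lin nf) // mul1r. Qed.

Lemma nf0 : om 0 = 0.
Proof. by have := nfB (vN0 vM) (vN0 vM); rewrite !subrr. Qed.

Lemma nfZ a x : M x -> om (a *: x) = a * om x.
Proof.
move=> Mx; have h := nf_lin nf a Mx (vN0 vM); rewrite addr0 in h.
by rewrite h nf0 addr0.
Qed.

Lemma osq_proj p : projections M p -> osq p = complex.Re (om p).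
Proof. by move=> [_ pp sp]; rewrite /sq /s sp pp. Qed.

(** b^* b <= k^2, and the difference is a square in M. *)
Lemma osq_opb b k x : M b -> M x -> 0 <= k -> opb k b -> osq (b * x) <= k ^+ 2 * osq x.
Proof.
move=> Mb Mx k0 kb; have Mb' := vN_adj vM Mb; have Mx' := vN_adj vM Mx; have M1 := vN1 vM.
have Mbb : M (adj b * b) by exact: (vNM vM).
have [h [Mh sh hh]] : exists h, [/\ M h, adj h = h & h * h = (k ^+ 2)%:C%C *: (1 : B) - adj b * b].
  apply: (psdP vM).
  - by apply: (vND vM); [exact: (vNZ vM)|exact: (vNN vM)].
  - by rewrite adjB adjZr adj1 adjM adjK.
  move=> z; rewrite bopBE bopZE bop1E ipBl ipZl ip_adj_mul !ipxx -rmorphM -exprMn subr_ge0 lecR.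
  by rewrite ler_pXn2r ?nnegrE ?nrm_ge0 ?mulr_ge0 ?nrm_ge0.
have Mhx : M (h * x) by exact: (vNM vM).
have := nf_pos nf Mhx.
have -> : adj (h * x) * (h * x) = (k ^+ 2)%:C%C *: (adj x * x) - adj (b * x) * (b * x).
  rewrite !adjM sh mulrA -[adj x * h * h]mulrA hh mulrBr mulrBl.
  by rewrite -bop_scalerAr mulr1 -bop_scalerAl !mulrA.
have Mbx : M (b * x) by exact: (vNM vM).
have Mxx : M (adj x * x) by exact: (vNM vM).
rewrite nfB ?nfZ; [|by []|exact: (vNZ vM)|by apply: (vNM vM) => //; exact: (vN_adj vM)].
rewrite -/(s x x) -/(s (b * x) (b * x)) !(sqE ips) // -rmorphM -rmorphB (lecR 0).
by rewrite subr_ge0.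
Qed.

(** The map x eta |-> x y from H to the GNS space of om is well defined and bounded: this
makes functionals on the GNS space weak-* continuous in x. *)
Definition dominated y := M y /\ exists eta : H, forall x, M x -> osq (x * y) <= nrm (x eta) ^+ 2.

Lemma dominated_mul b y : M b -> dominated y -> dominated (b * y).
Proof.
move=> Mb [My [eta h]]; split; first exact: (vNM vM).
by exists (b eta) => x Mx; rewrite mulrA; apply: le_trans (h _ _) _ => //; exact: (vNM vM).
Qed.

Let re_ip (x : B) (eta : H) : R := complex.Re (ip (x eta) eta).

Lemma re_ipD x y eta : re_ip (x + y) eta = re_ip x eta + re_ip y eta.
Proof. by rewrite /re_ip bopDE ipDl raddfD. Qed.

Lemma re_ipB x y eta : re_ip (x - y) eta = re_ip x eta - re_ip y eta.
Proof. by rewrite /re_ip bopBE ipBl raddfB. Qed.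

Lemma reomD x y : M x -> M y -> complex.Re (om (x + y)) = complex.Re (om x) + complex.Re (om y).
Proof. by move=> Mx My; rewrite nfD // raddfD. Qed.

Lemma reomB x y : M x -> M y -> complex.Re (om (x - y)) = complex.Re (om x) - complex.Re (om y).
Proof. by move=> Mx My; rewrite nfB // raddfB. Qed.

Lemma reom_ge0 T : M T -> adj T = T -> fpos T -> 0 <= complex.Re (om T).
Proof.
move=> MT sT pT; have [h [Mh sh <-]] := psdP vM MT sT pT.
by rewrite -{1}sh; exact: (sq_ge0 ips Mh).
Qed.

(** Domination of om by the vector state of eta passes from the projections below e to all
positive elements below e, by binary expansion. *)
Lemma dominated_state eta e : projections M e ->
  (forall e', projections M e' -> ple e' e -> complex.Re (om e') <= re_ip e' eta) -> dominated e.
Proof.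
move=> eP he; have [Me ee se] := eP; have M1 := vN1 vM.
have unit n : forall y, M y -> adj y = y -> fpos y -> fpos (1 - y) -> y * e = y ->
    (complex.Re (om y) - re_ip y eta) * 2 ^+ n <= complex.Re (om 1).
  elim: n => [|n IH] y My sy py qy ye.
    rewrite expr0 mulr1; have := reom_ge0 (vND vM M1 (vNN vM My)) _ qy.
    rewrite adjB adj1 sy => /(_ erefl); rewrite reomB //.
    have : 0 <= re_ip y eta.
      by rewrite /re_ip; have := py eta; case: (ip _ _) => a b; rewrite lecE /= => /andP[].
    lra.
  have ey : e * y = y by rewrite -sy -{1}se -adjM ye.
  have [p [[bp pp sp] p1 q1]] := binary_digit sy py qy.
  have pe : p * e = e * p by apply: (bicomm_comm bp); rewrite ey ye.
  have Mp : M p by exact: (bicomm_sub vM My).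
  have p'P : projections M (p * e).
    split; first exact: (vNM vM).
      by rewrite mulrA -[p * e * p]mulrA -pe mulrA pp -mulrA ee.
    by rewrite adjM se sp pe.
  have Mp' : M (p * e) by case: p'P.
  have Myy : M (y + y) by exact: (vND vM).
  pose z := y + y - p * e.
  have Mz : M z by apply: (vND vM) => //; exact: (vNN vM).
  have zE : z = adj e * (y + y - p) * e.
    by rewrite se mulrBr mulrDr ey -pe mulrBl mulrDl ye -mulrA ee.
  have z1E : 1 - z = (1 - e) + adj e * (1 - (y + y - p)) * e.
    by rewrite mulrBr mulrBl -zE se mulr1 ee addrA subrK.
  have sz : adj z = z by rewrite /z adjB adjD sy adjM se sp pe.
  have ze : z * e = z by rewrite /z mulrBl mulrDl ye -mulrA ee.
  have pz : fpos z by rewrite zE; exact: fpos_conj.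
  have qz : fpos (1 - z).
    rewrite z1E; apply: fposD; last exact: fpos_conj.
    move=> x; apply: (@ip_proj_ge0 _ _ M).
    by apply: projections_sub_ple vM eP (projections1 vM) _; rewrite /ple mul1r.
  have := IH z Mz sz pz qz ze.
  rewrite /z reomB // reomD // re_ipB re_ipD exprS.
  have := he _ p'P; rewrite /ple mulrA -pe -mulrA ee => /(_ erefl).
  have : 0 < 2 ^+ n :> R by rewrite exprn_gt0.
  nra.
have unit0 y : M y -> adj y = y -> fpos y -> fpos (1 - y) -> y * e = y ->
    complex.Re (om y) <= re_ip y eta.
  move=> My sy py qy ye; rewrite -subr_le0.
  have K0 : 0 <= complex.Re (om 1) by apply: (reom_ge0 M1 (@adj1 R H)) => x; exact: ipxx_ge0.
  apply: (@le_small R _ (complex.Re (om 1))) => // d d0.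
  have [n nP] := inv_small d0; have dn := nP n (leqnn _).
  have := unit n y My sy py qy ye; set t := _ - _ => ht.
  have [t0|t0] := lerP t 0; first by apply: le_trans t0 _; apply: mulr_ge0 => //; exact: ltW.
  have h2 : t * n.+1%:R <= complex.Re (om 1).
    apply: le_trans ht; apply: ler_wpM2l; first exact: ltW.
    by rewrite -natrX ler_nat; exact: ltn_expl.
  have N0 : 0 < n.+1%:R :> R by rewrite ltr0n.
  have : t <= complex.Re (om 1) * n.+1%:R^-1 by rewrite ler_pdivlMr.
  move=> /le_trans; apply; exact: ler_wpM2l.
split=> //; exists (e eta) => x Mx.
have Mx' := vN_adj vM Mx.
have Mxe : M (x * e) by exact: (vNM vM).
have [k k0 kx] := opb_ex1 (x * e).
pose y := (k^-1)%:C%C *: (x * e).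
have My : M y by exact: (vNZ vM).
have cy : contr y := contr_scale k0 kx.
have yy : adj y * y = (k^-1 ^+ 2)%:C%C *: (adj (x * e) * (x * e)).
  by rewrite /y adjZr -bop_scalerAl -bop_scalerAr scalerA -rmorphM -expr2.
have k2 : 0 < k^-1 ^+ 2 by rewrite exprn_gt0 // invr_gt0.
have Myy : M (adj y * y) by apply: (vNM vM) => //; exact: (vN_adj vM).
have := @unit0 (adj y * y) Myy.
rewrite adjM adjK => /(_ erefl (fpos_adj_mul _)) h.
have {}h : complex.Re (om (adj y * y)) <= re_ip (adj y * y) eta.
  apply: h.
    apply: contr_fposD; first by rewrite adjM adjK.
    by apply: contrM => //; exact: contr_adj.
  by rewrite -mulrA /y -bop_scalerAl -mulrA ee.
have Mxx : M (adj (x * e) * (x * e)) by apply: (vNM vM) => //; exact: (vN_adj vM).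
move: h; rewrite yy nfZ // /re_ip bopZE ipZl ip_adj_mul bopME ipxx.
rewrite -/(s (x * e) (x * e)) (sqE ips) // -!rmorphM /= ler_pM2l //.
Qed.

(** Dixmier's argument.  Choose eta with om g < <g eta, eta>, and let h be a maximal
projection below g on which the reverse inequality holds.  Every projection below
g - h satisfies om e' <= <e' eta, eta>, as h could be enlarged otherwise. *)
Lemma dominated_ex g : projections M g -> g <> 0 ->
  exists e, [/\ projections M e, ple e g, e <> 0 & dominated e].
Proof.
move=> gP gn; have [Mg gg sg] := gP; have M1 := vN1 vM.
have [x0 gx0] : exists x0, g x0 <> 0.
  by apply: contrapT => h; apply: gn; apply: bopP => x; apply: contrapT => hx; apply: h; exists x.
have n0 : 0 < nrm (g x0).
  by rewrite lt_neqAle nrm_ge0 andbT eq_sym; apply/eqP => /nrm_eq0.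
have og : 0 <= osq g by exact: (sq_ge0 ips Mg).
(* With this t one has <g eta, eta> = (1 + om g)^2 > om g. *)
pose t := (1 + osq g) / nrm (g x0).
pose eta := t%:C%C *: g x0.
have geta : g eta = eta by rewrite /eta linearZ /= -[g (g x0)]bopME gg.
have neta : complex.Re (om g) < re_ip g eta.
  rewrite -osq_proj // /re_ip geta ipxx /= /eta nrmZr ger0_norm.
    by rewrite /t divfK ?gt_eqF //; nra.
  by rewrite divr_ge0 ?(ltW n0) //; lra.
have [h [hP [hg hle] hmax]] : exists h, [/\ projections M h,
    ple h g /\ re_ip h eta <= complex.Re (om h) &
    forall q, projections M q -> (ple q g /\ re_ip q eta <= complex.Re (om q)) -> ple h q -> q = h].
  apply: (max_projection vM (projections0 vM)) => [|X P XM Xh dX PP Xub PX].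
    split; first by rewrite /ple mulr0.
    by rewrite /re_ip ip0l nf0.
  have cl := slim_closure dX PX (S := X) (fun p Xp => Xp).
  split; first by apply: (sclosure_ple cl) => p /Xh[].
  apply/ler_addgt0Pl => e e0.
  have [d d0 dP] := nrm_ip_small eta e0.
  have [p Xp /(_ eta (mem_head _ _)) hp] := cl [:: eta] d d0.
  have [h1 _] := dP _ hp.
  have [_ h2] := Xh _ Xp.
  have pM := XM _ Xp; have [Mp _ _] := pM; have [MP _ _] := PP.
  have pPP := projections_sub_ple vM pM PP (Xub _ Xp).
  have h3 : 0 <= complex.Re (om (P - p)) by rewrite -osq_proj //; apply: (sq_ge0 ips); case: pPP.
  rewrite reomB // in h3.
  have h4 : re_ip P eta - re_ip p eta <= e.
    rewrite -re_ipB /re_ip bopBE; apply: le_trans _ h1.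
    have : complex.Re (ip (P eta - p eta) eta) ^+ 2 <= nrm (ip (P eta - p eta) eta : R[i]^o) ^+ 2.
      exact: Re_msq.
    have := nrm_ge0 (ip (P eta - p eta) eta : R[i]^o).
    set a := complex.Re _; set b := nrm _ => b0 ab.
    by rewrite leNgt; apply/negP => lt; clear -b0 ab lt; nra.
  by clear -h2 h3 h4; lra.
have [Mh hh sh] := hP.
have eP := projections_sub_ple vM hP gP hg.
have he : h * (g - h) = 0 by rewrite mulrBr hh (ple_r hP gP hg) subrr.
have eg : ple (g - h) g by rewrite /ple mulrBr gg hg.
exists (g - h); split=> //.
  move=> /subr0_eq gh.
  by move: hle; rewrite -gh leNgt neta.
apply: (dominated_state (eta := eta) eP) => e' e'P e'e.
rewrite leNgt; apply/negP => lt.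
have [Me' _ _] := e'P.
have he' : h * e' = 0 by rewrite -e'e mulrA he mul0r.
have hP' := projections_add vM hP e'P he'.
have e'h : h + e' = h.
  apply: hmax => //; last by rewrite /ple mulrDl hh -[e' * h]adjK adjM sh (_ : adj e' = e') ?he' ?adj0 ?addr0 //; case: e'P.
  split; last by rewrite re_ipD reomD //; lra.
  by rewrite /ple mulrDr hg -{1}e'e mulrA eg e'e.
have e0 := addr_fix e'h.
by move: lt; rewrite e0 /re_ip ip0l nf0 ltxx.
Qed.

Lemma dominated_subM : lspan dominated `<=` M.
Proof. by apply: lspan_min => [|y []//]; exact: vN_subspace. Qed.

(** A maximal projection in the closure of the span of dominated elements is 1, since a
dominated projection of its complement could be added. *)
Lemma dominated_dense1 : forall e, 0 < e -> exists2 y, lspan dominated y & osq (1 - y) <= e.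
Proof.
pose Phi f := forall e, 0 < e -> exists2 y, lspan dominated y & osq (f - y) <= e.
have sL := lspan_subspace dominated.
have M1 := vN1 vM; have sM := vN_subspace.
have [f [fP ff fmax]] : exists f, [/\ projections M f, Phi f &
    forall q, projections M q -> Phi q -> ple f q -> q = f].
  apply: (max_projection vM (projections0 vM)) => [e e0|X P XM XPhi dX PP Xub PX e e0].
    exists 0; first exact: ss0.
    by rewrite subr0 /sq (si0l ips (vN0 vM)) /= ltW.
  have [p Xp hp] := nf_normal nf XM dX PP Xub PX (e := e / 4) ltac:(lra).
  have [y hy hpy] := XPhi _ Xp (e / 4) ltac:(lra).
  have pPP := projections_sub_ple vM (XM _ Xp) PP (Xub _ Xp).
  exists y => //; rewrite -(subrKA p).
  have [Mp _ _] := XM _ Xp.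
  apply: le_trans (sqD ips _ _) _; first by case: pPP.
    by apply: (ssB sM) => //; exact: dominated_subM.
  rewrite osq_proj //; lra.
suff -> : 1 = f by [].
apply: contrapT => fn; have [Mf fff sf] := fP.
have gP := projections_sub_ple vM fP (projections1 vM) ltac:(by rewrite /ple mul1r).
have [|e [eP eg en de]] := dominated_ex gP.
  by move/subr0_eq.
have fe : f * e = 0 by rewrite -eg mulrA mulrBr mulr1 fff subrr mul0r.
have fP' := projections_add vM fP eP fe.
apply/en/(@addr_fix _ f).
apply: fmax => //.
  move=> d d0; have [y hy hyd] := ff d d0.
  exists (y + e); first by apply: ssD => //; exact: lspan_incl.
  by rewrite opprD addrACA subrr addr0.
rewrite /ple mulrDl fff -[e * f]adjK adjM sf (_ : adj e = e); last by case: eP.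
by rewrite fe adj0 addr0.
Qed.

(** The dominated elements form a left ideal with 1 in the closure of its span. *)
Lemma dominated_total (L : B -> C) K :
  (forall a x y, M x -> M y -> L (a *: x + y) = a * L x + L y) ->
  (forall x, M x -> msq (L x) <= K * osq x) -> (forall y, dominated y -> L y = 0) ->
  forall m, M m -> L m = 0.
Proof.
move=> Llin LK Ldom m Mm; have M1 := vN1 vM; have sM := vN_subspace.
have L0 : L 0 = 0.
  have M0 := vN0 vM; have := Llin 1 0 0 M0 M0.
  by rewrite scaler0 addr0 mul1r => /esym/addr_fix.
have Lspan : lspan dominated `<=` [set y | M y /\ L y = 0].
  apply: lspan_min => [|y dy]; last by split; [case: dy|exact: Ldom].
  split; first by split=> //; exact: (vN0 vM).
  by move=> a x y [Mx Lx] [My Ly]; split; [exact: (ssP sM)|rewrite Llin // Lx Ly mulr0 addr0].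
have [k k0 km] := opb_ex1 m.
apply: (@msq_small R _ (`|K| * k ^+ 2)) => [|d d0].
  by rewrite mulr_ge0 // exprn_ge0 // ltW.
have [y hy hyd] := dominated_dense1 d0.
have My := dominated_subM hy.
have Lmy : L (m * y) = 0.
  suff /Lspan[] : lspan dominated (m * y) by [].
  move: y hy {hyd My}; apply: lspan_min => [|y dy]; last by apply: lspan_incl; exact: dominated_mul.
  have sL := lspan_subspace dominated; split; first by rewrite /= mulr0; exact: ss0.
  by move=> a x y hx hy; rewrite /= mulrDr -bop_scalerAr; exact: ssP.
have Mmy : M (m * y) by exact: (vNM vM).
have -> : L m = L (m * (1 - y)).
  rewrite mulrBr mulr1 [m - _]addrC -scaleN1r Llin // Lmy mulr0 add0r //.
have M1y : M (1 - y) by exact: (ssB sM).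
have h1 := LK _ (vNM vM Mm M1y).
have h2 := osq_opb Mm M1y (ltW k0) km.
have h3 := sq_ge0 ips M1y; have h4 := sq_ge0 ips (vNM vM Mm M1y).
have K1 := ler_norm K; have K0 := normr_ge0 K.
apply: (le_trans h1); apply: (@le_trans _ _ (`|K| * osq (m * (1 - y)))).
  exact: ler_wpM2r.
rewrite -mulrA; apply: ler_wpM2l => //; apply: (le_trans h2).
by apply: ler_wpM2l => //; rewrite exprn_ge0 // ltW.
Qed.

End NormalFunctional.

(** * Orthogonality to a weak-* dense star-algebra *)

Section UltraweakDensity.
Variables (R : realType) (H : hilbertType R).
Local Notation B := (bop H).
Local Notation C := R[i].

Definition two_term (x y : H) (n : nat) : H := if n is n'.+1 then (if n' is 0%N then y else 0) else x.

Lemma series_two (u : nat -> C^o) : (forall n, u n.+2 = 0) ->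
  \forall n \near \oo, series u n = u 0%N + u 1%N.
Proof.
move=> u0; exists 2%N => // n /= n2; rewrite /series /= big_ltn ?(leq_trans _ n2) //.
rewrite big_ltn // big_nat big1 ?addr0 // => -[|[|i]] // _; exact: u0.
Qed.

Fact two_term_l2 x y : cvgn (series (fun n => `|two_term x y n| ^+ 2 : C^o)).
Proof. by apply: is_cvg_near_cst; apply: series_two => n; rewrite /= normr0 expr0n. Qed.

(** The weak-* topology is given by square summable sequences of vectors; two terms are
enough to compare two matrix coefficients. *)
Definition two_l2 x y : l2seq H := exist _ (two_term x y) (@two_term_l2 x y).

Lemma uw_eval_two (T : B) x y x' y' :
  uw_eval T (two_l2 x y, two_l2 x' y') = ip (T x) x' + ip (T y) y'.
Proof.
apply: lim_near_cst; first exact: norm_hausdorff.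
by apply: (series_two (u := fun n => ip (T (two_term x y n)) (two_term x' y' n))) => n;
  rewrite /= ip0r.
Qed.

Lemma eval_continuous (I : Type) (T : topologicalType) (i : I) :
  continuous ((fun f => f i) : {ptws I -> T} -> T).
Proof.
move=> f U nU.
have /cvg_sup/(_ i) : nbhs (f : {ptws I -> T}) --> (f : {ptws I -> T}) by exact: cvg_id.
apply; exact: (@initial_continuous _ T (fun f : I -> T => f i) f U nU).
Qed.

Lemma dense_weak (A M : set B) x y x' y' : weakstar_dense A M ->
  (forall a, A a -> ip (a x) x' + ip (a y) y' = 0) ->
  forall T, M T -> ip (T x) x' + ip (T y) y' = 0.
Proof.
move=> dAM h T MT; rewrite -uw_eval_two.
set p := (two_l2 x y, two_l2 x' y').
have cf : continuous ((fun S : ultraweak H => uw_eval S p) : ultraweak H -> C^o).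
  move=> S; apply: (@continuous_comp _ _ _ (@uw_eval R H : ultraweak H -> _)
    ((fun f => f p) : {ptws (l2seq H * l2seq H) -> C^o} -> C^o)).
    exact: initial_continuous.
  exact: eval_continuous.
apply: (@nrm_small _ C^o) => e e0.
have [U nU UP] : exists2 U, nbhs (uw_eval T p : C^o) U &
    forall z, U z -> nrm (uw_eval T p - z : C^o) <= e.
  exists (ball (uw_eval T p : C^o) e%:C%C); first by apply: nbhsx_ballx; rewrite (ltcR 0 e).
  by move=> z; rewrite -ball_normE /ball_ /= (nrmE (_ : C^o)) ltcR => /ltW.
pose f S := uw_eval S p.
have nT : nbhs (T : ultraweak H) (f @^-1` U) by exact: (cf T U nU).
have [a [Aa fa]] := dAM T MT (f @^-1` U) nT.
have fa0 : f a = 0 :> C^o by rewrite /f uw_eval_two h.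
by have := UP _ fa; rewrite fa0 subr0.
Qed.

End UltraweakDensity.

Lemma ipNr (R : realType) (H : hilbertType R) (x y : H) : ip x (- y) = - ip x y.
Proof. by rewrite -scaleN1r ipZr rmorphN1 mulN1r. Qed.

Lemma Re_le_nrm (R : realType) (z : R[i]) : complex.Re z <= nrm (z : R[i]^o).
Proof.
have h := Re_msq z; have n0 := nrm_ge0 (z : R[i]^o).
rewrite leNgt; apply/negP => lt; move: h; rewrite /msq; nra.
Qed.

Section Orthogonality.
Variables (R : realType) (H : hilbertType R).
Local Notation B := (bop H).
Local Notation C := R[i].
Variables (M A : set B) (om : B -> C).
Hypotheses (vM : von_neumann M) (nf : normal_functional M om).
Hypotheses (sA : subspace A) (AM : A `<=` M) (A1 : A 1)
  (Amul : forall a b, A a -> A b -> A (a * b)) (Aadj : forall a, A a -> A (adj a))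
  (dA : weakstar_dense A M).

Let s x y := om (adj y * x).
Let ips : semi_inner M s := nf_semi_inner vM nf.
Local Notation osq := (sq s).
Local Notation bf := (proj_form ips sA AM).

Let bf_move_A a y z : A a -> M y -> M z -> bf (a * y) z = bf y (adj a * z).
Proof.
move=> Aa My Mz; have Ma := AM Aa; have Ma' := vN_adj vM Ma.
have [k k0 ka] := opb_ex1 a.
apply: (@proj_form_mul _ _ _ _ _ ips sA AM (fun x => a * x) (fun x => adj a * x) (k ^+ 2)) => //.
- exact: exprn_gt0.
- by move=> x Mx; split; exact: (vNM vM).
- by move=> x Ax; split; apply: Amul => //; exact: Aadj.
- by move=> x t _ _; rewrite /s adjM adjK mulrA.
- by move=> x Mx; exact: (osq_opb vM nf Ma Mx (ltW k0) ka).
Qed.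

(** For dominated y and z both sides are weak-* continuous in x, and they agree on A. *)
Let bf_dom y z : dominated M om y -> dominated M om z ->
  forall x, M x -> bf (x * y) z = bf y (adj x * z).
Proof.
move=> [My [eta hy]] [Mz [eta' hz]] x Mx.
have sM := vN_subspace vM.
have y0 := sq_ge0 ips My; have z0 := sq_ge0 ips Mz.
have rep y' z' e : M y' -> M z' -> (forall x, M x -> osq (x * y') <= nrm (x e) ^+ 2) ->
    exists zeta, forall x, M x -> bf (x * y') z' = ip (x e) zeta.
  move=> My' Mz' he; have z'0 := sq_ge0 ips Mz'.
  have [|a x1 x2 Mx1 Mx2|x1 Mx1|zeta hzeta _] := @riesz_sub _ _ _ M (fun x : B => x e)
      (fun x => bf (x * y') z') (4 * osq z') sM; last by exists zeta.
  - by [].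
  - by rewrite mulrDl -bop_scalerAl proj_form_lin //; exact: (vNM vM).
  - apply: le_trans (proj_form_bound ips sA AM Mz' (vNM vM Mx1 My')) _.
    by apply: ler_wpM2l; [lra|exact: he].
have [zeta h1] := rep y z eta My Mz hy.
have [zeta' h2] := rep z y eta' Mz My hz.
have h3 x1 : M x1 -> bf y (adj x1 * z) = ip (x1 zeta') eta'.
  move=> Mx1; have Mx1' := vN_adj vM Mx1.
  rewrite proj_form_conj // ?h2 //; last exact: (vNM vM).
  by rewrite -ipC [RHS]adjP.
rewrite h1 // h3 //; apply/subr0_eq.
have -> : ip (x eta) zeta - ip (x zeta') eta' = ip (x eta) zeta + ip (x zeta') (- eta').
  by rewrite ipNr.
apply: (dense_weak dA) Mx => a Aa; have Ma := AM Aa.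
by rewrite ipNr -h1 // -h3 // bf_move_A // subrr.
Qed.

(** By continuity, bf_dom extends from the dominated elements to M, first in y and then
in z: the projection onto the closure of A commutes with M. *)
Let bf_move x y z : M x -> M y -> M z -> bf (x * y) z = bf y (adj x * z).
Proof.
move=> Mx My Mz; have Mx' := vN_adj vM Mx.
have [k k0 kx] := opb_ex1 x.
have kx' := opb_adj kx.
have MM := vNM vM.
have bound y' z' : M y' -> M z' -> msq (bf (x * y') z' - bf y' (adj x * z')) <=
    16 * k ^+ 2 * osq z' * osq y'.
  move=> My' Mz'; rewrite -(subrKA 0) subr0; apply: le_trans (msqD _ _) _; rewrite sub0r msqN.
  have := proj_form_bound ips sA AM Mz' (MM _ _ Mx My').
  have := proj_form_bound ips sA AM (MM _ _ Mx' Mz') My'.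
  have := osq_opb vM nf Mx My' (ltW k0) kx.
  have := osq_opb vM nf Mx' Mz' (ltW k0) kx'.
  have := sq_ge0 ips My'; have := sq_ge0 ips Mz'.
  have := sq_ge0 ips (MM _ _ Mx' Mz'); have := sq_ge0 ips (MM _ _ Mx My').
  set a := msq _; set b := msq _; set p := osq _; set q := osq _; set r := osq _; set t := osq _.
  move=> p0 q0 r0 t0 h1 h2 h3 h4.
  have : 4 * q * t <= 4 * (k ^+ 2 * r) * t by nra.
  have : 4 * r * p <= 4 * r * (k ^+ 2 * t) by nra.
  lra.
have step1 z' : dominated M om z' -> bf (x * y) z' = bf y (adj x * z').
  move=> dz; have Mz' : M z' by case: dz.
  apply/subr0_eq.
  apply: (dominated_total vM nf (L := fun y => bf (x * y) z' - bf y (adj x * z'))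
    (K := 16 * k ^+ 2 * osq z')) => //.
  - move=> a y1 y2 My1 My2; rewrite mulrDr -bop_scalerAr !proj_form_lin //; try exact: MM.
    ring.
  - by move=> y' My'; exact: bound.
  - by move=> y' dy; rewrite bf_dom // subrr.
apply/eqP; rewrite -subr_eq0 -conjC_eq0; apply/eqP.
apply: (dominated_total vM nf (L := fun z => (bf (x * y) z - bf y (adj x * z))^*)
  (K := 16 * k ^+ 2 * osq y)) => //.
- move=> a z1 z2 Mz1 Mz2.
  have cj u t : M u -> M t -> (bf u t)^* = bf t u by move=> Mu Mt; rewrite [RHS]proj_form_conj.
  have Mc : M (a *: z1 + z2) by exact: (ssP (vN_subspace vM)).
  rewrite !rmorphB /= !cj //; try exact: MM.
  rewrite mulrDr -bop_scalerAr !proj_form_lin //; try exact: MM.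
  ring.
- move=> z' Mz'; rewrite msqC; apply: le_trans (bound _ _ My Mz') _.
  by rewrite mulrAC.
- by move=> z' dz; rewrite step1 // subrr conjC0.
Qed.

(** If P is the projection onto the closure of A in the GNS space, then w = w P 1 = P w,
and P w = 0 by hypothesis. *)
Lemma orth_functional w : M w -> (forall a, A a -> om (adj a * w) = 0) -> om (adj w * w) = 0.
Proof.
move=> Mw hw; have M1 := vN1 vM; have Mw' := vN_adj vM Mw.
have Mww : M (adj w * w) by exact: (vNM vM).
have h1 : bf (w * 1) w = 0.
  rewrite mulr1; apply: proj_form_orth => // a Aa.
  by rewrite (si_conj ips (AM Aa) Mw) /s hw // conjC0.
have := bf_move Mw M1 Mw; rewrite h1 => /esym.
by rewrite proj_form_A // /s mulr1 adjM adjK.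
Qed.

End Orthogonality.

(** * Normal conditional expectations *)

Section NormalExpectation.
Variables (R : realType) (H : hilbertType R).
Local Notation B := (bop H).
Local Notation C := R[i].
Variables (M N : set B) (E : B -> B).
Hypotheses (vM : von_neumann M) (vN : von_neumann N).
Hypotheses (ce : cond_exp M N E) (nE : normal_map M N E).

Lemma ceB x y : M x -> M y -> E (x - y) = E x - E y.
Proof.
move=> Mx My; rewrite (ce_add ce) //; last exact: (vNN vM).
by rewrite -scaleN1r (ce_scale ce) // scaleN1r.
Qed.

Lemma ce1 : E 1 = 1. Proof. exact: (ce_id ce (vN1 vN)). Qed.

Lemma ce_sa T : M T -> adj T = T -> adj (E T) = E T.
Proof.
move=> MT sT; have [k k0 kT] := opb_ex1 T; have M1 := vN1 vM.
have Mk : M (k%:C%C *: (1 : B)) by exact: (vNZ vM).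
(* k + T is positive, so its image under E is positive and thus self-adjoint. *)
have : psd N (E (k%:C%C *: (1 : B) + T)).
  apply: (ce_pos ce).
  have [|||h [Mh sh hh]] := @psdP _ _ M (k%:C%C *: (1 : B) + T) vM.
  - exact: (vND vM).
  - by rewrite adjD adjZr adj1 sT.
  - move=> x; rewrite bopDE bopZE bop1E ipDl ipZl ipxx.
    have r := ip_sa_real x sT.
    rewrite -lerBlDl sub0r.
    apply: le_trans (_ : - `|ip (T x) x| <= _); last by rewrite lerNl -normrN; apply: real_ler_norm; rewrite rpredN.
    rewrite lerN2; apply: le_trans (cauchy_schwarz _ _) _.
    by rewrite !nrmE -!rmorphM lecR expr2 mulrA; apply: ler_wpM2r; [exact: nrm_ge0|exact: kT].
  by exists h => //; rewrite sh.
move=> /psd_sa; rewrite (ce_add ce) // (ce_scale ce) // ce1 adjD adjZr adj1.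
exact: addrI.
Qed.

Lemma ce_adj T : M T -> E (adj T) = adj (E T).
Proof.
move=> MT; have MT' := vN_adj vM MT.
have e1 : adj (E T) + adj (E (adj T)) = E T + E (adj T).
  by rewrite -adjD -(ce_add ce) // ce_sa //; [exact: (vND vM)|rewrite adjD adjK addrC].
have MB : M (T - adj T) by apply: (vND vM) => //; exact: (vNN vM).
have e2 : adj (E T) - adj (E (adj T)) = E (adj T) - E T.
  have h : adj (E (('i : C) *: (T - adj T))) = E (('i : C) *: (T - adj T)).
    apply: ce_sa; first exact: (vNZ vM).
    rewrite adjZ adjB adjK conjCi scaleNr -scalerN opprB //.
  move: h; rewrite (ce_scale ce) // adjZ conjCi scaleNr -scalerN ceB // adjB.
  move/(scalerI (neq0Ci _)) => /eqP; rewrite opprB => /eqP h.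
  by rewrite -opprB h opprB.
have : adj (E T) + adj (E T) = E (adj T) + E (adj T).
  have := congr2 +%R e1 e2; rewrite addrACA subrr addr0 => ->.
  by rewrite addrC subrKA.
have dbl (T1 T2 : B) : T1 + T1 = T2 + T2 -> T1 = T2.
  have n2 : (2%:R : C) != 0 by rewrite pnatr_eq0.
  by move=> h; apply: (scalerI n2); rewrite !scaler_nat !mulr2n.
by move/dbl.
Qed.

(** Let X increase to P.  The operators E p increase strongly to some T in N, an upper
bound of the E p, so E P <= T by normality; thus <E p xi, xi> comes close to
<E P xi, xi>. *)
Lemma normal_expectation_state (xi : H) : normal_functional M (fun x => ip (E x xi) xi).
Proof.
have M1 := vN1 vM.
split.
- by move=> a x y Mx My; rewrite (ce_add ce) ?(ce_scale ce) ?bopDE ?ipDl ?bopZE ?ipZl //; exact: (vNZ vM).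
- move=> x Mx; apply: (@psd_fpos _ _ N); apply: (ce_pos ce); by exists x.
- by move=> x Mx; rewrite ce_adj // -ipC adjP adjK.
move=> X P XM dX PP Xub PX e e0.
have [MP PPP sP] := PP.
have Xd p q : X p -> X q -> ple p q -> projections M (q - p).
  by move=> Xp Xq; exact: (projections_sub_ple vM (XM _ Xp) (XM _ Xq)).
have psdproj d : projections M d -> psd M d by move=> [Md dd sd]; exists d; rewrite ?sd.
have compl d : projections M d -> projections M (1 - d).
  by move=> dP; apply: (projections_sub_ple vM dP (projections1 vM)); rewrite /ple mul1r.
have EP0 d : projections M d -> fpos (E d).
  by move=> /psdproj dP; apply: (@psd_fpos _ _ N); exact: (ce_pos ce).
have EPs d : projections M d -> adj (E d) = E d by move=> [Md _ sd]; exact: ce_sa.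
have EP1 d : projections M d -> fpos (1 - E d).
  move=> dP; rewrite -ce1 -ceB //; last by case: dP.
  by apply: EP0; exact: compl.
have lubP : alg_lub M X P.
  split=> // [p Xp|t Mt ht]; first exact/psdproj/(projections_sub_ple vM (XM _ Xp) PP)/Xub.
  have st : adj t = t.
    have [p Xp] := dir_ex dX; have := psd_sa (ht _ Xp); rewrite adjB.
    by case: (XM _ Xp) => _ _ ->; exact: addIr.
  have cl : sclosure [set t - p | p in X] (t - P).
    move=> xs d d0; have [p [Xp hp]] := PX xs d d0.
    exists (t - p); first by exists p.
    move=> x xx; rewrite !bopBE opprB addrC subrKA nrmB.
    exact: hp p Xp (dir_refl dX Xp) x xx.
  have [|||h [Mh sh hh]] := @psdP _ _ M (t - P) vM.
  - by apply: (vND vM) => //; exact: (vNN vM).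
  - by rewrite adjB st sP.
  - move=> x; apply: (sclosure_ip_ge0 cl); last by rewrite adjB st sP.
    by move=> _ [p Xp <-]; exact: (psd_fpos (ht _ Xp)).
  by exists h => //; rewrite sh.
have upX : updirected M X.
  split; first exact: dir_ex dX.
  move=> p q Xp Xq; have [l [Xl pl ql]] := dir_ub dX Xp Xq.
  by exists l; split=> //; apply: psdproj; exact: Xd.
have [_ _ lubE] := nE (fun p Xp => let: And3 Mp _ _ := XM p Xp in Mp)
  (fun p Xp => let: And3 _ _ sp := XM p Xp in sp) upX lubP.
have [|x p Xp|x p q Xp Xq pq|T _ hT] := @monotone_net _ H B X ple E 1
  (fun x p => complex.Re (ip (E p x) x)) (fun x => nrm x ^+ 2) dX ler01.
- move=> p Xp; apply/contrP; have pP := XM _ Xp.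
  by apply: fpos1_contr; [exact: EPs|exact: EP0|exact: EP1].
- have := EP1 _ (XM _ Xp) x; rewrite bopBE bop1E ipBl ipxx.
  by case: (ip _ _) => a b; rewrite lecE /= => /andP[_]; rewrite subr_ge0.
- have dP := Xd _ _ Xp Xq pq; have [Mp _ _] := XM _ Xp; have [Mq _ _] := XM _ Xq.
  have := fpos_sqr_le x (EPs _ dP) (EP0 _ dP) (EP1 _ dP).
  rewrite ceB // ipxx bopBE ipBl.
  case: (ip _ _) => a b; case: (ip _ _) => a' b'; rewrite lecE /= => /andP[_] //.
have cl := slim_closure dX hT (S := E @` X) (fun p Xp => imageP E Xp).
have NT : N T.
  by apply: (vN_sclosure vN _ cl) => _ [p Xp <-]; apply: (ce_fun ce); case: (XM _ Xp).
have sT : adj T = T by apply: (sclosure_sa cl) => _ [p Xp <-]; apply: EPs; exact: XM.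
have : psd_le N (E P) T.
  apply: lubE => // _ [p Xp <-].
  have [Mp _ _] := XM _ Xp.
  have clp : sclosure [set E q - E p | q in [set q | X q /\ ple p q]] (T - E p).
    move=> xs d d0; have [i [Xi hi]] := hT xs d d0.
    have [l [Xl il pl]] := dir_ub dX Xi Xp.
    exists (E l - E p); first by exists l.
    by move=> x xx; rewrite !bopBE opprB subrKA; exact: hi.
  have sTp : adj (T - E p) = T - E p by rewrite adjB sT EPs //; exact: XM.
  have [|||h [Nh sh hh]] := @psdP _ _ N (T - E p) vN.
  - by apply: (vND vN) => //; apply: (vNN vN); exact: (ce_fun ce).
  - exact: sTp.
  - move=> x; apply: (sclosure_ip_ge0 clp) => // _ [q [Xq pq] <-].
    have [Mq _ _] := XM _ Xq.
    by rewrite -ceB //; apply: EP0; exact: Xd.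
  by exists h => //; rewrite sh.
move=> /psd_fpos /(_ xi); rewrite bopBE ipBl => hP.
have [d d0 dP] := nrm_ip_small xi e0.
have [p [Xp hp]] := hT [:: xi] d d0.
have [h1 _] := dP _ (hp p Xp (dir_refl dX Xp) xi (mem_head _ _)).
exists p => //; have [Mp _ _] := XM _ Xp.
rewrite ceB // bopBE ipBl.
have h2 : complex.Re (ip (T xi - E p xi) xi) <= e.
  by apply: le_trans h1; exact: Re_le_nrm.
move: hP h2; rewrite ipBl; case: (ip _ _) => a b; case: (ip _ _) => a' b'.
case: (ip _ _) => a2 b2; rewrite lecE /= => /andP[_ h3 h4].
by move: h3 h4; rewrite subr_ge0 => h3; rewrite !lerBlDr => h4; apply: (le_trans h3).
Qed.

End NormalExpectation.

(** * The pieces on which a normalizer agrees with the regularizer *)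

Section Cover.
Variables (R : realType) (H : hilbertType R).
Local Notation B := (bop H).
Variables (M N D : set B) (c : cartan_triple M N D).
Local Notation vM := (ct_vNM c).
Local Notation vD := (ct_vND c).
Local Notation vN := (ct_vNN c).

(** All the functionals x |-> <E x xi, xi> vanish at w^* w. *)
Lemma orth_expectation (E : B -> B) (A : set B) w : cond_exp M N E -> faithful M E -> normal_map M N E ->
  subspace A -> A `<=` M -> A 1 -> (forall a b, A a -> A b -> A (a * b)) ->
  (forall a, A a -> A (adj a)) -> weakstar_dense A M ->
  M w -> (forall a, A a -> E (adj a * w) = 0) -> w = 0.
Proof.
move=> ce fE nE sA AM A1 Amul Aadj dA Mw hw.
have Mww : psd M (adj w * w) by exists w.
have zero xi : ip (E (adj w * w) xi) xi = 0.
  have nf := normal_expectation_state vM vN ce nE xi.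
  apply: (orth_functional vM nf sA AM A1 Amul Aadj dA Mw) => a Aa.
  by rewrite hw // ip0l.
have E0 : E (adj w * w) = 0.
  have [y Ny yE] := ce_pos ce Mww.
  suff y0 : y = 0 by rewrite -yE y0 mulr0.
  apply: bopP => x; apply: nrm_eq0; apply/eqP; rewrite -sqrf_eq0 -(inj_eq (@complexI R)) -ipxx.
  by rewrite -ip_adj_mul yE zero.
have w0 := fE _ Mww E0.
apply: bopP => x; apply: nrm_eq0; apply/eqP; rewrite -sqrf_eq0 -(inj_eq (@complexI R)) -ipxx.
by rewrite -ip_adj_mul w0 ip0l.
Qed.

(** E (g p) = E (p g p), because p is central in N. *)
Lemma displaced_expectation (E : B -> B) (g : gn c) p : cond_exp M N E -> projections D p ->
  displaced g p -> E ((g : B) * p) = 0.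
Proof.
move=> ce [Dp pp sp] dp; have N1 := vN1 vN; have Np := DN c Dp; have Mg := gn_M g.
have e1 : E ((g : B) * p) = E g * p by rewrite -[(g : B) * p]mul1r mulrA (ce_bimod ce) // mul1r.
rewrite e1 -pp mulrA (N_comm c (ce_fun ce Mg) Dp) -(ce_bimod ce Np Mg Np) [p * g * p]dp.
by have := ce_scale ce 0 (vN1 vM); rewrite !scale0r.
Qed.

Variable G : set B.
Hypothesis rg : regularizer M N D G.

Lemma rg_lspanM : lspan G `<=` M.
Proof.
apply: lspan_min => [|u Gu]; first exact: (vN_subspace vM).
by case: (rg_unitary rg Gu).
Qed.

Lemma rg_gn u : G u -> u \in GN M D. Proof. by move=> /(rg_GN rg)/mem_set. Qed.

Lemma rg_uu u : G u -> adj u * u = 1 /\ u * adj u = 1.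
Proof. by move=> /(rg_unitary rg)[_ []]. Qed.

(** The element g = u^* v r with E g <> 0 comes from orth_expectation.  E kills the
displaced parts of g, so its fixed part g e is not 0. *)
Lemma cover (v : gn c) r : projections D r -> ple r (adj v * v) -> r <> 0 ->
  exists u p, [/\ G u, projections D p, ple p r, p <> 0 & N (adj u * (v : B) * p)].
Proof.
move=> rP rv rn; have [Dr rr sr] := rP.
have [E [ce fE nE]] := ct_exp c.
have Mvr : M ((v : B) * r) by apply: (vNM vM); [exact: gn_M|exact: (DM c)].
have [u Gu un] : exists2 u, G u & E (adj u * ((v : B) * r)) <> 0.
  apply: contrapT => h; apply: rn.
  have G0 u : G u -> E (adj u * ((v : B) * r)) = 0.
    by move=> Gu; apply: contrapT => hu; apply: h; exists u.
  suff v0 : (v : B) * r = 0 by rewrite -rv -mulrA v0 mulr0.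
  apply: (@orth_expectation E (lspan G)) => //.
  - exact: lspan_subspace.
  - exact: rg_lspanM.
  - by apply: lspan_incl; exact: (rg1 rg).
  - by apply: lspan_mulr; exact: (rgM rg).
  - by apply: lspan_adj; exact: (rgV rg).
  - exact: (rg_dense rg).
  suff : lspan G `<=` [set a | M a /\ E (adj a * ((v : B) * r)) = 0] by move=> h' a /h'[].
  have M0 := vN0 vM.
  apply: lspan_min => [|u Gu]; last by split; [case: (rg_unitary rg Gu)|exact: G0].
  split; first by split=> //; rewrite adj0 mul0r; have := ce_scale ce 0 M0; rewrite !scale0r.
  move=> k x y [Mx Ex] [My Ey]; split; first exact: (ssP (vN_subspace vM)).
  have Mx' := vNM vM (vN_adj vM Mx) Mvr; have My' := vNM vM (vN_adj vM My) Mvr.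
  rewrite adjD adjZ mulrDl -bop_scalerAl (ce_add ce) ?(ce_scale ce) ?Ex ?Ey ?scaler0 ?addr0 //.
  exact: (vNZ vM).
pose gu := Gn c (rg_gn Gu).
pose g := gn_mul (gn_dag gu) (gn_mul v (projgn c rP)).
have gE : (g : B) = adj u * ((v : B) * r) by [].
have [e [p1 [p2 [p3 [[eP p1P p2P p3P] Ne [d1 d2 d3] e1]]]]] := fixed_displaced_decomp g.
have [De ee se] := eP.
have ge : (g : B) * e <> 0.
  move=> ge0; apply: un; rewrite -gE -[gn_val g]mulr1 -e1 !mulrDr ge0 add0r.
  have Mgp p : projections D p -> M ((g : B) * p).
    by move=> [Dp _ _]; apply: (vNM vM); [exact: gn_M|exact: (DM c)].
  have Mgp1 := Mgp _ p1P; have Mgp2 := Mgp _ p2P; have Mgp3 := Mgp _ p3P.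
  rewrite !(ce_add ce) //; last exact: (vND vM).
  by rewrite !displaced_expectation // !addr0.
exists u, (r * e); split=> //.
- exact: (projD_mul c).
- by rewrite /ple mulrA rr.
- by move=> re0; apply: ge; rewrite gE -!mulrA re0 !mulr0.
- by move: Ne; rewrite gE !mulrA.
Qed.

(** The element u of G and v conjugate D p in the same way. *)
Definition compat (v u p : B) := [/\ G u, projections D p, ple p (adj v * v) &
  forall d, projections D d -> v * (d * p) * adj v = u * (d * p) * adj u].

(** v p = u n with n = u^* v p a partial isometry of N, and n commutes with D. *)
Lemma compat_intro (v : gn c) u p : G u -> projections D p -> ple p (adj v * v) ->
  N (adj u * (v : B) * p) -> compat v u p.
Proof.
move=> Gu pP pv Nn; split=> // d [Dd _ _]; have [Dp pp sp] := pP.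
have [uu uu'] := rg_uu Gu.
pose n := gn_mul (gn_mul (gn_dag (Gn c (rg_gn Gu))) v) (projgn c pP).
have nE : (n : B) = adj u * (v : B) * p by [].
have nn : adj n * (n : B) = p.
  rewrite nE !adjM adjK sp !mulrA -[_ * u * adj u]mulrA uu' mulr1.
  by rewrite -[p * adj v * v]mulrA -mulrA pv pp.
have nn' : (n : B) * adj n = p by rewrite -[RHS]nn; apply: gn_N_proj; rewrite nE.
have vp : (v : B) * p = u * n by rewrite nE !mulrA uu' mul1r.
have -> : (v : B) * (d * p) * adj v = ((v : B) * p) * d * adj ((v : B) * p).
  by rewrite adjM sp (DC c Dd Dp) -[in LHS]pp -!mulrA [p * (d * _)]mulrA (DC c Dp Dd) -!mulrA.
rewrite vp adjM -!mulrA; congr (_ * _).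
by rewrite !mulrA (N_comm c _ Dd) ?nE // -nE -[d * n * _]mulrA nn'.
Qed.

Lemma cover_compat (v : gn c) r : projections D r -> ple r (adj v * v) -> r <> 0 ->
  exists u p, [/\ compat v u p, ple p r & p <> 0].
Proof.
move=> rP rv rn; have [u [p [Gu pP pr pn Np]]] := cover rP rv rn.
exists u, p; split=> //; apply: compat_intro => //; exact: (ple_trans pr rv).
Qed.

(** The supremum of the p with (u, p) compatible with v is v^* v: by cover_compat, a
maximal projection below v^* v that T kills is v^* v itself. *)
Lemma compat_total (v : gn c) (T : B) : (forall u p, compat v u p -> T * p = 0) -> T * (adj v * v) = 0.
Proof.
move=> hT; have vP := gn_iniP v.
have [f [fP [fv Tf] fmax]] : exists f, [/\ projections D f, ple f (adj v * v) /\ T * f = 0 &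
    forall q, projections D q -> ple q (adj v * v) /\ T * q = 0 -> ple f q -> q = f].
  apply: (max_projection vD (projections0 vD)) => [|X P XD XPhi dX PP Xub PX].
    by rewrite /ple !mulr0.
  have cl := slim_closure dX PX (S := X) (fun p Xp => Xp).
  by split; [apply: (sclosure_ple cl)|apply: (sclosure_mul0 cl)] => p /XPhi[].
suff -> : adj v * v = f by [].
apply: contrapT => vf.
have rP := projections_sub_ple vD fP vP fv.
have [Df ff sf] := fP; have [Dv vv sv] := vP.
have rv : ple (adj v * v - f) (adj v * v) by rewrite /ple mulrBr vv fv.
have [|u [p [cp pr pn]]] := cover_compat rP rv.
  by move/subr0_eq.
have [_ pP pv _] := cp; have [Dp _ _] := pP.
have fp : f * p = 0.
  by rewrite -pr mulrA mulrBr ff (ple_r fP vP fv) subrr mul0r.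
apply/pn/(@addr_fix _ f).
apply: fmax; first exact: (projections_add vD).
  by split; [rewrite /ple mulrDr fv pv|rewrite mulrDr Tf (hT _ _ cp) addr0].
by rewrite /ple mulrDl ff (DC c Dp Df) fp addr0.
Qed.

(** Correspondingly the v p v^* have supremum v v^*. *)
Lemma compat_total_fin (v : gn c) (T : B) :
  (forall u p, compat v u p -> T * ((v : B) * p * adj v) = 0) -> T * ((v : B) * adj v) = 0.
Proof.
move=> hT; suff h : T * v * (adj v * v) = 0.
  by rewrite -[in LHS](gn_iniK v) mulrA mulrA h mul0r.
apply: compat_total => u p cp; have [_ pP pv _] := cp; have [Dp _ _] := pP.
have := congr1 (fun z => z * (v : B)) (hT u p cp).
by rewrite mul0r -!mulrA (DC c Dp (gn_ini v)) pv.
Qed.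

End Cover.

(** * The Munn relation on normalizers and on partial automorphisms *)

Section MunnGeneral.
Local Open Scope group_scope.
Variable S : invSemigroupType.

Lemma munn_pi_dag (v w : S) : munn_pi v = munn_pi w -> munn_pi (dag v) = munn_pi (dag w).
Proof.
have pd (x : S) : munn_pi (dag x) = dag (munn_pi x).
  have pM (a b : S) : munn_pi (a * b) = munn_pi a * munn_pi b by exact: munn_piM.
  apply: dag_uniq.
    by rewrite -(pM x) -pM mulg_dagK.
  by rewrite -(pM _ x) -pM dag_mulgK.
by move=> e; rewrite !pd e.
Qed.
End MunnGeneral.

Section MunnNormalizers.
Variables (R : realType) (H : hilbertType R).
Local Notation B := (bop H).
Variables (M N D : set B) (c : cartan_triple M N D).
Local Notation vD := (ct_vND c).
Local Notation cc := (cartan_central c).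
Implicit Types (v w : gn c) (a b : pAut cc).

Lemma munn_gn_conj v w p : munn_pi v = munn_pi w -> projections D p ->
  (v : B) * p * adj v = (w : B) * p * adj w.
Proof.
move=> /munn_piP h pP; have [_ pp _] := pP.
have ee : (projgn c pP * projgn c pP = projgn c pP)%g by apply: val_inj.
by have := congr1 (@gn_val _ _ _ _ _ c) (h _ ee).
Qed.

Lemma munn_gn_fin v w : munn_pi v = munn_pi w -> (v : B) * adj v = (w : B) * adj w.
Proof. by move=> /munn_gn_conj /(_ (projections1 vD)); rewrite !mulr1. Qed.

Lemma munn_gn_ini v w : munn_pi v = munn_pi w -> adj v * (v : B) = adj w * (w : B).
Proof. by move=> /munn_pi_dag /munn_gn_fin; rewrite /= !adjK. Qed.

Lemma pa_idem_ex p : projections D p -> exists2 e : pAut cc, (e * e)%g = e & pa_f e = p.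
Proof.
move=> pP; have [Dp pp sp] := pP; exists (ad (projgn c pP)); last by rewrite /= sp pp.
apply/pa_idemP => x xp; rewrite adE //=.
have [Nx px] : N x /\ p * x = x.
  by move: xp; rewrite /= sp pp => /(cornerP cc x pP).
by rewrite sp px (N_comm c Nx Dp) px.
Qed.

(** Conjugation by a in the inverse monoid maps the idempotent of a projection g to the
idempotent of a (f g), f being the initial projection of a.  This is why the Munn
relation compares partial automorphisms on the projections of D only. *)
Lemma pa_conj_f a (e : pAut cc) : (e * e)%g = e ->
  pa_f (a * e * dag a)%g = a (pa_f a * pa_f e).
Proof.
move=> /pa_idemP ee; have fP := pa_fP a; have gP := pa_fP e; have eP := pa_eP a.
have fgP : projections D (pa_f a * pa_f e) by exact: (projM cc).
set g := pa_f e in ee gP fgP *; set f := pa_f a in fP fgP *.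
have [Df ff sf] := fP; have [Dg gg sg] := gP; have [Dfg fgfg sfg] := fgP.
have fgc : corner f N (f * g) by exists g => //; exact: (DN c).
have fgD : corner f D (f * g) by exists g.
pose t := a (f * g).
have tP : projections D t.
  split; last by rewrite -(si_adj (pa_iso a)) // sfg.
    by have /(cornerDP cc _ eP)[] := pa_D_in fgD.
  by rewrite -pa_mul // fgfg.
apply: (corner_inj cc); [exact: pa_fP|exact: tP|].
have gy y : corner f N y -> f * g * y = g * y.
  by move=> /(cornerP cc y fP)[Ny fy]; rewrite (DC c Df Dg) -mulrA fy.
apply/seteqP; split=> x.
  move=> /pa_compP[xe /pa_compP[ye _]]; have [Nx _] := (cornerP cc x eP).1 xe.
  have yf : corner f N (dag a x) by exact: (pa_in (a := dag a)).
  have yx : a (dag a x) = x by exact: (pa_dagE (a := a)).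
  apply/(cornerP cc x tP); split=> //.
  have [_ gyy] := (cornerP cc _ gP).1 ye.
  by rewrite -[in LHS]yx -pa_mul // gy // gyy.
move=> /(cornerP cc x tP)[Nx tx].
have te : corner (pa_e a) N t by exact: pa_in.
have xe : corner (pa_e a) N x.
  have [_ et] := (cornerP cc t eP).1 te.
  by apply/(cornerP cc x eP); split=> //; rewrite -tx mulrA et.
have [y yf yx] := pa_surj xe.
have [Ny _] := (cornerP cc y fP).1 yf.
have dyx : dag a x = y by rewrite -yx; exact: pa_invK.
have yg : corner g N y.
  apply/(cornerP cc y gP); split=> //; rewrite -gy //.
  apply: (pa_inj (a := a)) => //; first by apply: (saM (corner_star cc fP)).
  by rewrite pa_mul // -/t yx tx.
apply/pa_compP; split=> //; rewrite dyx.
by apply/pa_compP; split=> //; rewrite ee.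
Qed.

Lemma pa_munn_intro a b : pa_f a = pa_f b ->
  (forall p, projections D p -> a (pa_f a * p) = b (pa_f b * p)) -> munn_pi a = munn_pi b.
Proof.
move=> ef h; apply/munn_piP => e ee.
have ia := (pa_idemP _).1 (idem_conj a ee); have ib := (pa_idemP _).1 (idem_conj b ee).
have fab : pa_f (a * e * dag a)%g = pa_f (b * e * dag b)%g.
  by rewrite !pa_conj_f // h //; exact: pa_fP.
by apply: pAutP => x; rewrite fab // => xb; rewrite ib // ia // fab.
Qed.

Lemma pa_munn_proj a b p : munn_pi a = munn_pi b -> projections D p ->
  a (pa_f a * p) = b (pa_f b * p).
Proof.
move=> /munn_piP h pP; have [e ee <-] := pa_idem_ex pP.
by rewrite -!pa_conj_f // h.
Qed.

Lemma pa_munn_e a b : munn_pi a = munn_pi b -> pa_e a = pa_e b.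
Proof. by move=> /pa_munn_proj /(_ (projections1 vD)); rewrite !mulr1 !pa_unit. Qed.

Lemma pa_munn_f a b : munn_pi a = munn_pi b -> pa_f a = pa_f b.
Proof. by move=> /munn_pi_dag /pa_munn_e. Qed.

End MunnNormalizers.

(** * Partial automorphisms glued from the action of a regularizer *)

Section Gluing.
Variables (R : realType) (H : hilbertType R).
Local Notation B := (bop H).
Variables (M N D : set B) (c : cartan_triple M N D) (G : set B).
Hypothesis rg : regularizer M N D G.
Variable al : B -> B -> B.
Hypotheses (al_iso : forall u, G u -> star_iso N N (al u))
  (al_mul : forall u v x, G u -> G v -> N x -> al (u * v) x = al u (al v x))
  (al_fix : forall u p, G u -> projections D p ->
     (forall x, corner p D x -> al u x = x) -> forall x, corner p N x -> al u x = x)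
  (al_D : forall u d, G u -> D d -> al u d = u * d * adj u).
Local Notation vD := (ct_vND c).
Local Notation vN := (ct_vNN c).
Local Notation cc := (cartan_central c).
Local Notation compat := (compat D G).

Lemma al_N u x : G u -> N x -> N (al u x).
Proof. by move=> /al_iso iso Nx; exact: (star_iso_bij iso Nx). Qed.

Lemma al_M u x y : G u -> N x -> N y -> al u (x * y) = al u x * al u y.
Proof. by move=> /al_iso iso; exact: (si_mul iso). Qed.

Lemma al_1 x : N x -> al 1 x = x.
Proof.
move=> Nx; have G1 := rg1 rg; have N1x := al_N G1 Nx.
apply: (star_iso_inj (al_iso G1)) => //.
by rewrite -al_mul // mulr1.
Qed.

Lemma al_K u x : G u -> N x -> al u (al (adj u) x) = x.
Proof.
move=> Gu Nx; have [_ uu'] := rg_uu rg Gu.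
by rewrite -al_mul ?uu' ?al_1 //; exact: (rgV rg).
Qed.

Lemma compat_N (v : gn c) u p : compat v u p -> N p.
Proof. by move=> [_ [Dp _ _] _ _]; exact: (DN c). Qed.

Lemma compat_fin (v : gn c) u p : compat v u p -> (v : B) * p * adj v = al u p.
Proof.
move=> [Gu pP _ h]; have [Dp pp _] := pP.
by rewrite al_D // -[in LHS]pp h // pp.
Qed.

(** On p p' the element w = u'^* u of G commutes with D, so by (i) the action of w is
trivial on N p p'. *)
Lemma compat_agree (v : gn c) u p u' p' x : compat v u p -> compat v u' p' ->
  N x -> al u (x * (p * p')) = al u' (x * (p * p')).
Proof.
move=> [Gu pP _ h] [Gu' p'P _ h'] Nx.
have [Dp pp _] := pP; have [Dp' pp' _] := p'P.
have [uu1 uu2] := rg_uu rg Gu; have [uu1' uu2'] := rg_uu rg Gu'.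
pose r := p * p'; have rP : projections D r by exact: (projD_mul c).
have [Dr rr _] := rP.
have Gu'' := rgV rg Gu'; pose w := adj u' * u; have Gw : G w by exact: (rgM rg).
have Nr := DN c Dr.
have key d : projections D d -> u * (d * r) * adj u = u' * (d * r) * adj u'.
  move=> dP; have dp'P := projD_mul c dP p'P; have dpP := projD_mul c dP pP.
  have e1 : d * r = (d * p') * p by rewrite /r (DC c Dp Dp') mulrA.
  have e2 : d * r = (d * p) * p' by rewrite /r mulrA.
  by rewrite {1}e1 -h // -e1 e2 h'.
have wr d : projections D d -> w * (d * r) = (d * r) * w.
  move=> /key e; have := congr1 (fun z => adj u' * z * u) e.
  by rewrite !mulrA -[_ * adj u * u]mulrA uu1 mulr1 uu1' mul1r.
have ww' : w * adj w = 1.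
  by rewrite /w adjM adjK -mulrA [u * _]mulrA uu2 mul1r uu1'.
have u'w : u' * w = u by rewrite /w mulrA uu2' mul1r.
clearbody w.
have wr1 : w * r = r * w by have := wr 1 (projections1 vD); rewrite mul1r.
have wrD : commutant D (w * r).
  apply: (commutant_projections vD) => d dP; have [Dd _ _] := dP.
  by rewrite -mulrA (DC c Dr Dd) wr // -mulrA -wr1.
have fixD d : corner r D d -> al w d = d.
  move=> [d' Dd' <-]; have Drd : D (r * d') by exact: (vNM vD).
  rewrite al_D // [w * (r * d')]mulrA (wrD _ Dd') wr1.
  by rewrite -[d' * (r * w) * _]mulrA -[r * w * _]mulrA ww' mulr1 (DC c Dd' Dr).
have xr : corner r N (x * r).
  by exists x; [exact: Nx|exact/esym/(N_comm c Nx Dr)].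
have Nxr : N (x * r) by exact: (vNM vN).
by rewrite -/r -[in LHS]u'w al_mul // (al_fix Gw rP fixD xr).
Qed.

(** Both sides are the common value at x p p' in compat_agree. *)
Lemma compat_cross (v : gn c) u p u' p' x : compat v u p -> compat v u' p' -> N x ->
  al u (x * p) * ((v : B) * p' * adj v) = al u' (x * p') * ((v : B) * p * adj v).
Proof.
have half u1 p1 u2 p2 : compat v u1 p1 -> compat v u2 p2 -> N x ->
    al u1 (x * p1) * ((v : B) * p2 * adj v) = al u1 (x * (p1 * p2)).
  move=> c1 c2 Nx; have [Gu1 p1P pv1 h1] := c1; have [_ p2P pv2 _] := c2.
  have [D1 pp1 _] := p1P; have [D2 pp2 _] := p2P.
  have N1 := DN c D1; have N2 := DN c D2.
  have N12 : N (p1 * p2) by exact: (vNM vN).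
  have Nx1 : N (x * p1) by exact: (vNM vN).
  have -> : al u1 (x * p1) = al u1 (x * p1) * al u1 p1.
    by rewrite -al_M // -mulrA pp1.
  rewrite -(compat_fin c1) -mulrA.
  have -> : (v : B) * p1 * adj v * ((v : B) * p2 * adj v) = al u1 (p1 * p2).
    have -> : (v : B) * p1 * adj v * ((v : B) * p2 * adj v) = (v : B) * (p2 * p1) * adj v.
      have -> : (v : B) * p1 * adj v * ((v : B) * p2 * adj v) =
        (v : B) * (p1 * (adj v * v) * p2) * adj v by rewrite !mulrA.
      by rewrite (DC c D1 (gn_ini v)) pv1 (DC c D1 D2).
    by rewrite h1 // (DC c D1 D2) al_D //; exact: (vNM vD).
  by rewrite -al_M // mulrA -[x * p1 * p1]mulrA pp1 mulrA.
move=> c1 c2 Nx; rewrite (half _ _ _ _ c1 c2) // (half _ _ _ _ c2 c1) //.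
have [_ [D1 _ _] _ _] := c1; have [_ [D2 _ _] _ _] := c2.
by rewrite (compat_agree c1 c2 Nx) (DC c D1 D2).
Qed.

(** y is the image of x under the isomorphism wanted for v: on the piece v p v^* it is
given by the action of u. *)
Definition glued (v : gn c) x y := [/\ N y, y * ((v : B) * adj v) = y &
  forall u p, compat v u p -> y * ((v : B) * p * adj v) = al u (x * p)].

Lemma glued_uniq (v : gn c) x y y' : glued v x y -> glued v x y' -> y = y'.
Proof.
move=> [Ny yv hy] [Ny' yv' hy']; apply/eqP; rewrite -subr_eq0 -{1}yv -{1}yv' -mulrBl; apply/eqP.
apply: (compat_total_fin rg) => u p cp.
by rewrite mulrBl (hy _ _ cp) (hy' _ _ cp) subrr.
Qed.

Lemma fin_ple (v : gn c) p : ple ((v : B) * p * adj v) ((v : B) * adj v).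
Proof. by rewrite /ple !mulrA gn_pi. Qed.

(** Adding a piece with orthogonal support keeps the bound k, so the partial solutions
below are uniformly bounded. *)
Lemma opb_orth_add f g S T k : 0 <= k -> projections D f -> projections D g -> f * g = 0 ->
  N S -> N T -> opb k S -> opb k T -> opb k (S * f + T * g).
Proof.
move=> k0 fP gP fg NS NT kS kT x.
have [Df ff sf] := fP; have [Dg gg sg] := gP.
have o : ip ((S * f) x) ((T * g) x) = 0.
  rewrite (N_comm c NS Df) (N_comm c NT Dg) !bopME adjP sf -bopME -[(f * g) _]/(_ _) fg.
  exact: ip0r.
have n2 (u w : H) : ip u w = 0 -> nrm (u + w) ^+ 2 = nrm u ^+ 2 + nrm w ^+ 2.
  move=> uw; apply: complexI; rewrite rmorphD /= -!ipxx ipDl !ipDr uw.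
  by rewrite [ip w u]ipC uw conjC0 add0r addr0.
apply: nrm_sqr_le; first by rewrite mulr_ge0 // nrm_ge0.
rewrite bopDE (n2 _ _ o).
have fgP := projections_add vD fP gP fg.
have ofg : ip (f x) (g x) = 0 by rewrite adjP sf -bopME fg ip0r.
have h3 : nrm (f x) ^+ 2 + nrm (g x) ^+ 2 <= nrm x ^+ 2.
  rewrite -(n2 _ _ ofg) -bopDE ler_pXn2r ?nnegrE ?nrm_ge0 //; exact: (contr_projections fgP).
have h1 : nrm ((S * f) x) ^+ 2 <= k ^+ 2 * nrm (f x) ^+ 2.
  rewrite -exprMn ler_pXn2r ?nnegrE ?mulr_ge0 ?nrm_ge0 //; exact: (kS (f x)).
have h2 : nrm ((T * g) x) ^+ 2 <= k ^+ 2 * nrm (g x) ^+ 2.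
  rewrite -exprMn ler_pXn2r ?nnegrE ?mulr_ge0 ?nrm_ge0 //; exact: (kT (g x)).
rewrite exprMn; have := sqr_ge0 k; nra.
Qed.

Section Glue.
Variables (v : gn c) (x : B) (k : R).
Hypotheses (Nx : N x) (k0 : 0 < k) (kx : opb k x).
Let e := (v : B) * adj v.
Let eP : projections D e := gn_finP v.

(** A solution of the gluing problem for x on the part f of v v^*. *)
Let part f y := [/\ N y, opb k y, y * f = y &
  forall u p, compat v u p -> y * ((v : B) * p * adj v) = al u (x * p) * f].

Let part_uniq f f' y y' : projections D f -> projections D f' -> ple f e ->
  f' * f = f -> part f y -> part f' y' -> y' * f = y.
Proof.
move=> fP f'P fe ff' [Ny _ yf hy] [Ny' _ yf' hy'].
have [Df _ _] := fP; have [Df' _ _] := f'P.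
apply/eqP; rewrite -subr_eq0.
have fee : f * e = f by exact: (ple_r fP eP fe).
have : (y' * f - y) * e = 0.
  apply: (compat_total_fin rg) => u p cp.
  have [_ pP _ _] := cp; have [Dq _ _] := proj_gn_r v pP.
  by rewrite mulrBl -[y' * f * _]mulrA (DC c Df Dq) [y' * (_ * f)]mulrA (hy' _ _ cp) (hy _ _ cp) -mulrA ff' subrr.
by rewrite mulrBl -mulrA fee -[y in y * e]yf -mulrA fee yf => ->.
Qed.

(** By uniqueness the partial solutions restrict to each other, so they converge strongly. *)
Let part_sup (X : set B) P (y : B -> B) : X `<=` projections D -> directed X ple ->
  projections D P -> (forall p, X p -> ple p P) -> slim X ple id P -> (forall p, X p -> ple p e) ->
  (forall p, X p -> part p (y p)) -> exists Y, part P Y.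
Proof.
move=> XD dX PP Xub PX Xe Xy.
have yq p q : X p -> X q -> ple p q -> y q * p = y p.
  move=> Xp Xq pq; apply: (part_uniq (XD _ Xp) (XD _ Xq) (Xe _ Xp) pq); exact: Xy.
have [p Xp|z p Xp|z p q Xp Xq pq|Y kY hY] := @monotone_net _ H B X ple y k
  (fun z p => k ^+ 2 * nrm (p z) ^+ 2) (fun z => k ^+ 2 * nrm z ^+ 2) dX (ltW k0).
- by case: (Xy p Xp).
- apply: ler_wpM2l; first exact: sqr_ge0.
  rewrite ler_pXn2r ?nnegrE ?nrm_ge0 //; exact: (contr_projections (XD _ Xp)).
- rewrite -mulrBr -(ple_nrm z vD (XD _ Xp) (XD _ Xq) pq) -exprMn.
  have [_ kq yqq _] := Xy _ Xq.
  have -> : y q z - y p z = y q (q z - p z).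
    by rewrite [y q (_ - _)]linearB /= -[y q (q z)]bopME -[y q (p z)]bopME yqq yq.
  rewrite ler_pXn2r ?nnegrE ?mulr_ge0 ?nrm_ge0 ?(ltW k0) //; exact: kq.
have cl := slim_closure dX hY (S := y @` X) (fun p Xp => imageP y Xp).
have [DP PPP sP] := PP.
exists Y; split=> //.
- by apply: (vN_sclosure vN _ cl) => _ [p Xp <-]; case: (Xy _ Xp).
- apply/eqP; rewrite eq_sym -subr_eq0 -{1}[Y]mulr1 -mulrBr; apply/eqP.
  apply: (sclosure_0mul cl) => _ [p Xp <-]; have [_ _ ypp _] := Xy _ Xp.
  by rewrite -ypp -mulrA mulrBr mulr1 (ple_r (XD _ Xp) PP (Xub _ Xp)) subrr mulr0.
move=> u p cp; set q := (v : B) * p * adj v; set a := al u (x * p).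
apply/subr0_eq; apply: bop_small => z d d0.
have [d' d'0 d'P] := @nrm_op_small _ _ a (d / 2) ltac:(lra).
have [i [Xi hi]] := hY [:: q z] (d / 2) ltac:(lra).
have [j [Xj hj]] := PX [:: z] d' d'0.
have [l [Xl il jl]] := dir_ub dX Xi Xj.
have h1 := hi l Xl il _ (mem_head _ _).
have h2 := d'P _ (hj l Xl jl _ (mem_head _ _)).
have [_ _ _ yl] := Xy _ Xl.
have -> : (Y * q - a * P) z = (Y (q z) - y l (q z)) - a (P z - l z).
  rewrite bopBE !bopME linearB /= -[y l (q z)]bopME -[a (l z)]bopME (yl _ _ cp).
  by rewrite opprB subrKA.
apply: le_trans (nrmD _ _) _; rewrite nrmN.
move: h1 h2; rewrite /=; set s := nrm _; set t := nrm _; lra.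
Qed.

(** Let f be a maximal projection below v v^* with a partial solution.  If f is not v v^*,
some piece v p v^* is not below f, and al u (x p) extends the solution to f + g with g
the part of this piece outside f. *)
Lemma glue_exk : exists y, glued v x y.
Proof.
have [De ee se] := eP.
have [f [fP [fe [y yP]] fmax]] : exists f, [/\ projections D f, ple f e /\ (exists y, part f y) &
    forall q, projections D q -> ple q e /\ (exists y, part q y) -> ple f q -> q = f].
  apply: (max_projection vD (projections0 vD)) => [|X P XD XPhi dX PP Xub PX].
    split; first by rewrite /ple mulr0.
    exists 0; split; rewrite ?mul0r //; first exact: (vN0 vN).
      by move=> z; rewrite nrm0 mulr_ge0 ?nrm_ge0 // ltW.
    by move=> u p _; rewrite mul0r mulr0.
  have cl := slim_closure dX PX (S := X) (fun p Xp => Xp).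
  split; first by apply: (sclosure_ple cl) => p /XPhi[].
  have ex p : exists y, X p -> part p y.
    have [Xp|nX] := pselect (X p); last by exists 0.
    by have [_ [y hy]] := XPhi _ Xp; exists y.
  have [y hy] := choice ex.
  by apply: (part_sup XD dX PP Xub PX _ hy) => p /XPhi[].
have [Ny ky yf hy] := yP.
suff ef : e = f.
  exists y; split=> //; first by rewrite -/e ef.
  move=> u p cp; rewrite (hy _ _ cp) -ef.
  have Np := compat_N cp; have [Gu pP _ _] := cp; have [_ pp _] := pP.
  have Nxp : N (x * p) by exact: (vNM vN).
  have -> : al u (x * p) = al u (x * p) * al u p by rewrite -al_M // -mulrA pp.
  have qP := proj_gn_r v pP; have qe := ple_r qP eP (fin_ple v p).
  by rewrite -mulrA -(compat_fin cp) qe.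
apply: contrapT => enf.
have hP := projections_sub_ple vD fP eP fe.
have [Df ff sf] := fP; have [Dh hh sh] := hP.
have [u [p [cp qn]]] : exists u p, compat v u p /\ (e - f) * ((v : B) * p * adj v) <> 0.
  apply: contrapT => h; apply: enf; apply/subr0_eq.
  have -> : e - f = (e - f) * e by rewrite mulrBl ee (ple_r fP eP fe).
  apply: (compat_total_fin rg) => u p cp; apply: contrapT => hn; apply: h.
  by exists u, p.
have [Gu pP pv _] := cp; have [Dp pp _] := pP.
have Np := compat_N cp.
set q := (v : B) * p * adj v in qn.
have qP : projections D q := proj_gn_r v pP.
have [Dq qq sq] := qP.
pose g := (e - f) * q; have gP : projections D g by exact: (projD_mul c).
have [Dg gg sg] := gP.
have fg : f * g = 0 by rewrite /g mulrA mulrBr ff (ple_r fP eP fe) subrr mul0r.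
have eg : e * g = g by rewrite /g mulrA mulrBr ee fe.
have qg : q * g = g by rewrite /g mulrA (DC c Dq Dh) -mulrA qq.
pose z := al u (x * p).
have Nxp : N (x * p) by exact: (vNM vN).
have Nz : N z by exact: al_N.
have kz : opb k z.
  apply: (star_iso_opb vN (al_iso Gu) k0 Nxp).
  have := opbM (ltW k0) kx (iffLR (contrP p) (contr_projections pP)).
  by rewrite mulr1.
have fgP := projections_add vD fP gP fg.
have gE : (e - f) * q = g by [].
clearbody g.
apply: qn; rewrite gE; apply: (@addr_fix _ f).
apply: fmax => //; last by rewrite /ple mulrDl ff (DC c Dg Df) fg addr0.
split; first by rewrite /ple mulrDr fe eg.
have [_ _ _ hyf] := yP.
exists (y * f + z * g); split.
- by apply: (vND vN); apply: (vNM vN) => //; exact: (DN c).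
- exact: (opb_orth_add (ltW k0) fP gP fg).
- by rewrite mulrDl !mulrDr -!mulrA ff fg gg (DC c Dg Df) fg !mulr0 addr0 add0r.
move=> u' p' cp'; have [Gu' p'P _ _] := cp'; have [Dq' _ _] := proj_gn_r v p'P.
rewrite mulrDl yf (hy _ _ cp') mulrDr; congr (_ + _).
rewrite -[z * g * _]mulrA (DC c Dg Dq') [z * (_ * g)]mulrA (compat_cross cp cp' Nx) -/q.
by rewrite -[_ * q * g]mulrA qg.
Qed.
End Glue.

Lemma glue_ex (v : gn c) x : N x -> exists y, glued v x y.
Proof. by move=> Nx; have [k k0 kx] := opb_ex1 x; exact: (@glue_exk v x k). Qed.

Implicit Types (v w : gn c).

(** The hypothesis on projections says that u^* v p commutes with the projections of D,
hence with D. *)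
Lemma compat_D (v : gn c) u p d : compat v u p -> D d ->
  (v : B) * (d * p) * adj v = u * (d * p) * adj u.
Proof.
move=> [Gu pP pv h] Dd; have [Dp pp sp] := pP; have [uu uu'] := rg_uu rg Gu.
pose T := adj u * (v : B) * p.
have e d' : projections D d' -> T * d' = d' * p * T.
  move=> d'P; have [Dd' _ _] := d'P.
  have := congr1 (fun z => adj u * z * ((v : B) * p)) (h d' d'P).
  rewrite !mulrA uu mul1r -[_ * adj v * v]mulrA.
  have -> : adj u * (v : B) * d' * p * (adj v * v) * p = T * d'.
    rewrite /T -[_ * p * (adj v * v)]mulrA (DC c Dp (gn_ini v)) pv.
    by rewrite -[_ * p * p]mulrA pp -!mulrA (DC c Dd' Dp).
  by move=> ->.
have T1 : T = p * T by have := e 1 (projections1 vD); rewrite mulr1 mul1r.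
have TD : commutant D T.
  by apply: (commutant_projections vD) => d' d'P; rewrite e // -mulrA -T1.
have Tv : T * adj v = p * adj u.
  have h1 := h 1 (projections1 vD); rewrite mul1r in h1.
  by rewrite /T -!mulrA [(v : B) * _]mulrA h1 !mulrA uu mul1r.
have vT : (v : B) * p = u * T by rewrite /T !mulrA uu' mul1r.
clearbody T.
have -> : (v : B) * (d * p) = u * (d * T) by rewrite (DC c Dd Dp) mulrA vT -mulrA (TD _ Dd).
by rewrite -!mulrA Tv.
Qed.

Definition induced_map (v : gn c) : B -> B :=
  patch (fun=> 0) (corner (adj v * v) N) (fun x => xget 0 [set y | glued v x y]).

Lemma induced_mapP v x : corner (adj v * v) N x -> glued v x (induced_map v x).
Proof.
move=> xv; rewrite /induced_map /patch mem_set //.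
have [Nx _] := (cornerP cc x (gn_iniP v)).1 xv.
have ex := glue_ex v Nx.
exact: (xgetPex 0 ex).
Qed.

Lemma induced_mapE v x y : corner (adj v * v) N x -> glued v x y -> induced_map v x = y.
Proof. by move=> xv hy; exact: glued_uniq (induced_mapP xv) hy. Qed.

Lemma corner_vv v x : corner (adj v * (v : B)) N x -> N x /\ x * (adj v * v) = x.
Proof.
move=> /(cornerP cc x (gn_iniP v))[Nx vx]; split=> //.
by rewrite (N_comm c Nx (gn_ini v)).
Qed.

Lemma glued_corner (v : gn c) x y : glued v x y -> corner ((v : B) * adj v) N y.
Proof.
move=> [Ny yv _]; apply/(cornerP cc y (gn_finP v)); split=> //.
by rewrite -(N_comm c Ny (gn_fin v)).
Qed.

Lemma induced_map_inj v x y : corner (adj v * v) N x -> corner (adj v * v) N y -> induced_map v x = induced_map v y -> x = y.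
Proof.
move=> xv yv e; have [Nx xvv] := corner_vv xv; have [Ny yvv] := corner_vv yv.
apply/eqP; rewrite -subr_eq0 -{1}xvv -{1}yvv -mulrBl; apply/eqP.
apply: (compat_total rg) => u p cp; have [Gu pP _ _] := cp.
have Np := compat_N cp.
have [_ _ /(_ u p cp) hx] := induced_mapP xv; have [_ _ /(_ u p cp) hy] := induced_mapP yv.
rewrite mulrBl; apply/eqP; rewrite subr_eq0; apply/eqP.
apply: (star_iso_inj (al_iso Gu)); [exact: (vNM vN)|exact: (vNM vN)|].
by rewrite -hx -hy e.
Qed.

Lemma compat_dag (v : gn c) u p : compat v u p -> compat (gn_dag v) (adj u) ((v : B) * p * adj v).
Proof.
move=> cp; have [Gu pP pv h] := cp; have [Dp pp sp] := pP; have [uu uu'] := rg_uu rg Gu.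
have qP := proj_gn_r v pP; have [Dq _ _] := qP.
split=> //; first exact: (rgV rg).
  by rewrite /ple /= adjK; exact: fin_ple.
move=> d dP; have [Dd _ _] := dP; rewrite /= !adjK.
have d'P := proj_gn_l v dP; set d' := adj v * d * v in d'P.
have e1 : d * ((v : B) * p * adj v) = (v : B) * (d' * p) * adj v.
  by rewrite !mulrA (gn_pull v Dd) -/d' !mulrA.
have [Dd' _ _] := d'P.
have vd' : (adj v * v) * d' = d' by rewrite /d' !mulrA gn_ipi.
have l : adj v * ((v : B) * (d' * p) * adj v) * v = d' * p.
  transitivity ((adj v * v) * d' * (p * (adj v * v))); first by rewrite !mulrA.
  by rewrite vd' (DC c Dp (gn_ini v)) pv.
have r : adj u * (u * (d' * p) * adj u) * u = d' * p.
  by rewrite -[u * _ * _]mulrA [adj u * (u * _)]mulrA uu mul1r -mulrA uu mulr1.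
by rewrite e1 l h // r.
Qed.

Lemma induced_map_surj v y : corner ((v : B) * adj v) N y -> exists2 x, corner (adj v * v) N x & induced_map v x = y.
Proof.
move=> yv; have [Ny vy] := (cornerP cc y (gn_finP v)).1 yv.
have ydag : corner (adj (gn_dag v) * (gn_dag v : B)) N y by rewrite /= adjK.
have hx := induced_mapP ydag; set x := induced_map (gn_dag v) y in hx.
have xv : corner (adj v * v) N x by have := glued_corner hx; rewrite /= adjK.
have [Nx _ hx'] := hx.
exists x => //; apply: induced_mapE => //; split=> //.
  by rewrite (N_comm c Ny (gn_fin v)).
move=> u p cp; have [Gu pP pv _] := cp; have [Dp _ _] := pP; have [uu uu'] := rg_uu rg Gu.
have := hx' _ _ (compat_dag cp); rewrite /= adjK.
have -> : adj v * ((v : B) * p * adj v) * v = p.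
  by rewrite !mulrA -[_ * adj v * v]mulrA -mulrA (DC c Dp (gn_ini v)) pv pv.
have [Dq _ _] := proj_gn_r v pP.
by move=> ->; rewrite al_K //; apply: (vNM vN) => //; exact: (DN c).
Qed.

Lemma glued_mul (v : gn c) x x' y y' : N x -> N x' -> glued v x y -> glued v x' y' -> glued v (x * x') (y * y').
Proof.
move=> Nx Nx' [Ny yv hy] [Ny' yv' hy']; split; first exact: (vNM vN).
  by rewrite -mulrA yv'.
move=> u p cp; have [Gu pP _ _] := cp; have [Dp pp _] := pP; have Np := compat_N cp.
have [Dq qq _] := proj_gn_r v pP; set q := (v : B) * p * adj v in Dq qq.
have e1 : y * y' * q = (y * q) * (y' * q).
  by rewrite -[y * q * _]mulrA [q * _]mulrA -(N_comm c Ny' Dq) -[y' * q * q]mulrA qq mulrA.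
rewrite e1 (hy _ _ cp) (hy' _ _ cp) -(al_M Gu); try exact: (vNM vN).
by rewrite -[x * p * _]mulrA [p * _]mulrA -(N_comm c Nx' Dp) -[x' * p * p]mulrA pp mulrA.
Qed.

Lemma glued_lin (v : gn c) k x x' y y' : N x -> N x' -> glued v x y -> glued v x' y' ->
  glued v (k *: x + x') (k *: y + y').
Proof.
move=> Nx Nx' [Ny yv hy] [Ny' yv' hy']; split; first by apply: (vND vN) => //; exact: (vNZ vN).
  by rewrite mulrDl -bop_scalerAl yv yv'.
move=> u p cp; have [Gu _ _ _] := cp; have Np := compat_N cp.
have Nxp : N (x * p) by exact: (vNM vN).
have Nxp' : N (x' * p) by exact: (vNM vN).
rewrite !mulrDl -!bop_scalerAl (hy _ _ cp) (hy' _ _ cp).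
by rewrite (si_add (al_iso Gu)) ?(si_scale (al_iso Gu)) //; exact: (vNZ vN).
Qed.

Lemma glued_adj (v : gn c) x y : N x -> glued v x y -> glued v (adj x) (adj y).
Proof.
move=> Nx [Ny yv hy]; have Nx' := vN_adj vN Nx; have Ny' := vN_adj vN Ny.
split=> //.
  rewrite (N_comm c Ny' (gn_fin v)).
  have [_ _ se] := gn_finP v.
  by rewrite -{1}se -adjM yv.
move=> u p cp; have [Gu pP _ _] := cp; have [Dp _ sp] := pP; have Np := compat_N cp.
have [Dq _ sq] := proj_gn_r v pP.
rewrite (N_comm c Ny' Dq) -{1}sq -adjM (hy _ _ cp) -(si_adj (al_iso Gu)); last exact: (vNM vN).
by rewrite adjM sp (N_comm c Nx' Dp).
Qed.

Lemma glued_D (v : gn c) d : corner (adj v * v) D d -> glued v d ((v : B) * d * adj v).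
Proof.
move=> /(cornerDP cc d (gn_iniP v))[Dd vd]; split.
- by apply: (DN c); exact: gn_r.
- by rewrite -!mulrA [adj v * ((v : B) * adj v)]mulrA gn_ipi.
move=> u p cp; have [Gu pP _ _] := cp; have [Dp _ _] := pP.
have -> : (v : B) * d * adj v * ((v : B) * p * adj v) = (v : B) * (d * p) * adj v.
  rewrite !mulrA -[_ * adj v * v]mulrA -[(v : B) * d * _]mulrA (DC c Dd (gn_ini v)) vd //.
by rewrite (compat_D cp Dd) al_D //; exact: (vNM vD).
Qed.

Lemma induced_map_iso v : star_iso (corner (adj v * v) N) (corner ((v : B) * adj v) N) (induced_map v).
Proof.
have sa := corner_star cc (gn_iniP v).
have cN x : corner (adj v * v) N x -> N x by move=> /corner_vv[].
have cZ k x : corner (adj v * v) N x -> corner (adj v * v) N (k *: x).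
  by move=> [z Nz <-]; exists (k *: z); [exact: (vNZ vN)|rewrite -bop_scalerAr].
have lin k x y : corner (adj v * v) N x -> corner (adj v * v) N y ->
    induced_map v (k *: x + y) = k *: induced_map v x + induced_map v y.
  move=> xv yv; apply: induced_mapE; first by apply: (saD sa) => //; exact: cZ.
  by apply: glued_lin; [exact: cN|exact: cN|exact: induced_mapP|exact: induced_mapP].
split.
- split.
  + by move=> x /induced_mapP; exact: glued_corner.
  + by move=> x y; rewrite !inE; exact: induced_map_inj.
  + by move=> y /induced_map_surj[x xv <-]; exists x.
- by move=> x y xv yv; rewrite -[x in LHS]scale1r lin // scale1r.
- move=> k x xv; have x0 : corner (adj v * v) N 0 by exists 0; [exact: (vN0 vN)|rewrite mulr0].
  have z0 : induced_map v 0 = 0.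
    by have := lin (-1) 0 0 x0 x0; rewrite scaler0 addr0 scaleN1r addNr.
  by rewrite -[_ *: x]addr0 lin // z0 addr0.
- move=> x y xv yv; apply: induced_mapE; first exact: (saM sa).
  by apply: glued_mul; [exact: cN|exact: cN|exact: induced_mapP|exact: induced_mapP].
- move=> x xv; apply: induced_mapE; first exact: (saA sa).
  by apply: glued_adj; [exact: cN|exact: induced_mapP].
Qed.

Lemma induced_map_D v : induced_map v @` corner (adj v * v) D = corner ((v : B) * adj v) D.
Proof.
rewrite -(ad_D v); apply: eq_imagel => d dv.
have dN := corner_D cc dv.
by rewrite ad_mapE // (induced_mapE dN (glued_D dv)).
Qed.

Lemma induced_map_normal v :
  normal_map (corner (adj v * v) N) (corner ((v : B) * adj v) N) (induced_map v).
Proof. exact: (star_iso_normal (corner_star cc (gn_iniP v)) (induced_map_iso v)). Qed.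

Lemma induced_map_out v x : ~ corner (adj v * v) N x -> induced_map v x = 0.
Proof. by move=> h; rewrite /induced_map /patch memNset. Qed.

Definition induced v : pAut cc := PAut cc (gn_finP v) (gn_iniP v) (induced_map_iso v)
  (@induced_map_normal v) (induced_map_D v) (@induced_map_out v).

Lemma inducedE v x y : corner (adj v * v) N x -> glued v x y -> induced v x = y.
Proof. exact: induced_mapE. Qed.

Lemma inducedP v x : corner (adj v * v) N x -> glued v x (induced v x).
Proof. exact: induced_mapP. Qed.

Lemma induced_D v d : corner (adj v * v) D d -> induced v d = (v : B) * d * adj v.
Proof. by move=> dv; apply: inducedE (glued_D dv); exact: (corner_D cc). Qed.

(** The piece for v w is the part of p' that w moves into p. *)
Lemma compat_mul (v w : gn c) u p u' p' : compat v u p -> compat w u' p' ->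
  compat (gn_mul v w) (u * u') (p' * (adj w * p * w)).
Proof.
move=> c1 c2; have [Gu pP pv h] := c1; have [Gu' p'P pw h'] := c2.
have [Dp pp sp] := pP; have [Dp' pp' sp'] := p'P.
have rP := proj_gn_l w pP; set r := adj w * p * w in rP.
have [Dr rr _] := rP.
split.
- exact: (rgM rg).
- exact: (projD_mul c).
- rewrite /ple /= adjM.
  have -> : adj w * adj v * ((v : B) * w) * (p' * r) = (adj w * (adj v * v) * w) * r * p'.
    by rewrite (DC c Dp' Dr) !mulrA.
  have -> : adj w * (adj v * v) * w * r = r.
    transitivity (adj w * ((adj v * v) * (((w : B) * adj w) * p)) * w).
      by rewrite /r !mulrA.
    by rewrite (DC c (gn_fin w) Dp) [adj v * v * (p * _)]mulrA pv (DC c Dp (gn_fin w)) /r !mulrA gn_ipi.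
  exact: (DC c Dr Dp').
move=> d dP; have [Dd _ _] := dP; rewrite /= !adjM.
have -> : (v : B) * w * (d * (p' * r)) * (adj w * adj v) =
  (v : B) * ((w : B) * ((d * r) * p') * adj w) * adj v.
  by rewrite (DC c Dp' Dr) !mulrA.
have drP := projD_mul c dP rP.
have wdP := proj_gn_r w (projD_mul c drP p'P).
have Dwd : D ((w : B) * (d * r * p') * adj w) by case: wdP.
have rw : r * adj w = adj w * p.
  transitivity (adj w * (p * ((w : B) * adj w))); first by rewrite /r !mulrA.
  by rewrite (DC c Dp (gn_fin w)) !mulrA gn_ipi.
have e1 : (w : B) * (d * r * p') * adj w = (w : B) * (d * r * p') * adj w * p.
  have -> : (w : B) * (d * r * p') * adj w = (w : B) * (d * p') * (r * adj w).
    by rewrite -[d * r * _]mulrA (DC c Dr Dp') [d * (p' * r)]mulrA [(w : B) * (d * p' * r)]mulrA -mulrA.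
  by rewrite rw [(w : B) * _ * (adj w * p)]mulrA -[_ * p * p]mulrA pp.
rewrite e1 h // -e1 h' //.
by rewrite (DC c Dp' Dr) !mulrA.
Qed.

(** v and w have the same compatible pairs. *)
Lemma induced_munn v w : munn_pi v = munn_pi w -> induced v = induced w.
Proof.
move=> vw; have ini := munn_gn_ini vw; have fin := munn_gn_fin vw.
apply: pAutP => x; first by rewrite /= ini.
move=> xv; have xw : corner (adj w * w) N x by rewrite -ini.
apply/esym/inducedE => //; have [Ny yv hy] := inducedP xv.
split=> //; first by rewrite -fin.
move=> u p [Gu pP pw h]; rewrite -(munn_gn_conj vw pP); apply: hy.
split=> //; first by rewrite ini.
by move=> d dP; rewrite -h //; apply: munn_gn_conj vw _; exact: (projD_mul c).
Qed.

(** Let T be the difference of the two values at x.  For compatible pairs of v and w, both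
values are al (u u') of the same element on the piece of v w given by compat_mul, so
T v vanishes on p w p' w^*.  Exhausting first w w^* and then v^* v gives T = 0. *)
Lemma induced_mul v w : induced (v * w)%g = (induced v * induced w)%g.
Proof.
have wP := gn_iniP w; have vP := gn_iniP v; have wfP := gn_finP w.
have [Dv vv sv] := vP; have [Dwf wfwf swf] := wfP; have [Dw ww sw] := wP.
pose d := adj w * (adj v * v) * w; have dP : projections D d := proj_gn_l w vP.
have [Dd dd sd] := dP.
have vwE : adj (gn_mul v w) * (gn_mul v w : B) = d by rewrite /= adjM /d !mulrA.
have dw : corner (adj w * w) D d.
  apply/(cornerDP cc d wP); split=> //.
  by rewrite /d !mulrA gn_ipi.
have wd : induced w d = (adj v * v) * ((w : B) * adj w).
  rewrite induced_D // /d.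
  transitivity (((w : B) * adj w) * (adj v * v) * ((w : B) * adj w)); first by rewrite !mulrA.
  by rewrite (DC c Dwf Dv) -mulrA wfwf.
have dom x : corner d N x <-> corner (adj w * w) N x /\ corner (adj v * v) N (induced w x).
  split.
    move=> /(cornerP cc x dP)[Nx dx].
    have xw : corner (adj w * w) N x.
      apply/(cornerP cc x wP); split=> //.
      have [_ wdd] := (cornerDP cc d wP).1 dw.
      by rewrite -dx mulrA wdd.
    split=> //; have yw : corner ((w : B) * adj w) N (induced w x) by exact: (pa_in (a := induced w)).
    have [Ny wy] := (cornerP cc _ wfP).1 yw.
    apply/(cornerP cc _ vP); split=> //.
    have yE : induced w x = (adj v * v) * ((w : B) * adj w) * induced w x.
      by rewrite -wd -(pa_mul (a := induced w)) ?dx //; exact: (corner_D cc).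
    have absorb (e W y : B) : e * e = e -> e * (e * W * y) = e * W * y.
      by move=> ee; rewrite !mulrA ee.
    by rewrite yE absorb.
  move=> [xw yv]; have [Nx wx] := (cornerP cc x wP).1 xw.
  apply/(cornerP cc x dP); split=> //.
  have yw : corner ((w : B) * adj w) N (induced w x) by exact: (pa_in (a := induced w)).
  have [Ny wy] := (cornerP cc _ wfP).1 yw; have [_ vy] := (cornerP cc _ vP).1 yv.
  have dN := corner_D cc dw.
  apply: (pa_inj (a := induced w)) => //; first exact: (saM (corner_star cc wP)).
  by rewrite (pa_mul (a := induced w)) // wd -mulrA wy vy.
apply: pAutP => x.
  rewrite [pa_f (induced (v * w)%g)]vwE; split=> [/dom[xw yv]|/pa_compP xx]; last exact/dom.
  exact/pa_compP.
rewrite [pa_f (induced (v * w)%g)]vwE => xd; have [xw yv] := (dom x).1 xd.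
have xvw : corner (pa_f (induced v * induced w)%g) N x by exact/pa_compP.
rewrite [RHS](pa_compE xvw).
set y1 := induced w x in yv *; set y2 := induced v y1.
have gx : glued (gn_mul v w) x (induced (gn_mul v w) x) by apply: inducedP; rewrite vwE.
have [Nz zvw hz] := gx; set z := induced (gn_mul v w) x in Nz zvw hz *.
have [Ny1 y1w hy1] : glued w x y1 by exact: inducedP.
have [Ny2 y2v hy2] : glued v y1 y2 by exact: inducedP.
have [Nx _] := (cornerP cc x wP).1 xw.
pose h := (v : B) * ((w : B) * adj w) * adj v.
have hE : (gn_mul v w : B) * adj (gn_mul v w) = h by rewrite /= adjM /h !mulrA.
rewrite hE in zvw.
have y2h : y2 * h = y2.
  have dv : corner (adj v * v) D ((adj v * v) * ((w : B) * adj w)) by exists ((w : B) * adj w).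
  have e1 : y1 * ((adj v * v) * ((w : B) * adj w)) = y1.
    have [_ vy] := (cornerP cc _ vP).1 yv.
    by rewrite mulrA (N_comm c Ny1 Dv) vy.
  have -> : h = induced v ((adj v * v) * ((w : B) * adj w)).
    by rewrite induced_D // /h [(v : B) * (_ * _ * _)]mulrA gn_iniK.
  rewrite -(pa_mul (a := induced v)) //; last exact: (corner_D cc).
  by rewrite e1.
apply/eqP; rewrite eq_sym -subr_eq0 -{1}y2h -zvw -mulrBl.
pose T := y2 - z.
have key u p u' p' : compat v u p -> compat w u' p' -> T * (v : B) * p * ((w : B) * p' * adj w) = 0.
  move=> c1 c2; have c3 := compat_mul c1 c2.
  have [Gu pP pv h1] := c1; have [Gu' p'P pw h2] := c2.
  have [Dp pp sp] := pP; have [Dp' pp' sp'] := p'P.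
  have Np := DN c Dp; have Np' := DN c Dp'.
  have qP := proj_gn_r w p'P; set q := (w : B) * p' * adj w in qP *.
  have rP := proj_gn_l w pP; set r := adj w * p * w in rP c3.
  have [Dq qq sq] := qP; have [Dr rr sr] := rP; have Nr := DN c Dr; have Nq := DN c Dq.
  have rw : r * adj w = adj w * p.
    transitivity (adj w * (p * ((w : B) * adj w))); first by rewrite /r !mulrA.
    by rewrite (DC c Dp Dwf) !mulrA gn_ipi.
  have wr : (w : B) * (p' * r) * adj w = q * p.
    by rewrite mulrA -[(w : B) * p' * r * _]mulrA rw mulrA.
  have Nxp' : N (x * p') by exact: (vNM vN).
  have Nqp : N (q * p) by exact: (vNM vN).
  have Npr : N (p' * r) by exact: (vNM vN).
  have Dqp : D (q * p) by exact: (vNM vD).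
  have Dpr : D (p' * r) by exact: (vNM vD).
  have vqp : (v : B) * (q * p) * adj v = al u (q * p) by rewrite (compat_D c1 Dq) al_D.
  (* z and y2 both restrict to al (u u') (x p' r) on the projection v q p v^*. *)
  have zE : z * ((v : B) * (q * p) * adj v) = al u (al u' (x * (p' * r))).
    rewrite -al_mul //; last exact: (vNM vN).
    rewrite -(hz _ _ c3); congr (_ * _).
    by rewrite -wr /= adjM !mulrA.
  have yE : y2 * ((v : B) * (q * p) * adj v) = al u (y1 * (q * p)).
    have -> : (v : B) * (q * p) * adj v = ((v : B) * p * adj v) * ((v : B) * (q * p) * adj v).
      have gen (X : B) : (v : B) * p * adj v * ((v : B) * X * adj v) =
        (v : B) * (p * (adj v * v) * X) * adj v by rewrite !mulrA.
      by rewrite gen (DC c Dp Dv) pv (DC c Dp Dqp) -[q * p * p]mulrA pp.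
    rewrite mulrA (hy2 _ _ c1) vqp -(al_M Gu) //; last exact: (vNM vN).
    by rewrite -mulrA (DC c Dp Dqp) -[q * p * p]mulrA pp.
  have e : al u' (x * (p' * r)) = y1 * (q * p).
    have -> : x * (p' * r) = (x * p') * (p' * r) by rewrite -mulrA [p' * (p' * r)]mulrA pp'.
    rewrite (al_M Gu') // -(hy1 _ _ c2) -/q.
    have -> : al u' (p' * r) = q * p.
      by rewrite al_D // -wr (DC c Dp' Dr) -(compat_D c2 Dr).
    by rewrite -mulrA [q * (q * p)]mulrA qq.
  have T0 : T * ((v : B) * (q * p) * adj v) = 0 by rewrite /T mulrBl zE yE e subrr.
  have := congr1 (fun t => t * (v : B)) T0; rewrite mul0r.
  have -> : T * ((v : B) * (q * p) * adj v) * v = T * (v : B) * q * (p * (adj v * v)).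
    by rewrite !mulrA.
  rewrite (DC c Dp Dv) pv -mulrA (DC c Dq Dp) mulrA //.
have k1 u p : compat v u p -> T * (v : B) * ((w : B) * adj w) * p = 0.
  move=> c1; have [_ [Dp _ _] _ _] := c1.
  rewrite -mulrA (DC c Dwf Dp) mulrA.
  by apply: (compat_total_fin rg) => u' p' c2; exact: key c1 c2.
have k2 : T * (v : B) * ((w : B) * adj w) = 0.
  have := compat_total rg k1; rewrite -mulrA (DC c Dwf Dv) mulrA.
  by rewrite -[T * (v : B) * (_ * _)]mulrA gn_iniK.
have Th : T * h = T * (v : B) * ((w : B) * adj w) * adj v by rewrite /h !mulrA.
by rewrite -/T Th k2 mul0r.
Qed.

Lemma induced_pi v : munn_pi (induced v) = munn_pi (ad v).
Proof.
apply: pa_munn_intro => // p pP.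
have [Dp _ _] := pP.
have pv : corner (adj v * v) D ((adj v * v) * p) by exists p.
by rewrite [LHS](induced_D pv) adE //; exact: (corner_D cc).
Qed.

End Gluing.

(** * The equivalence *)

Section Splitting.
Variables (R : realType) (H : hilbertType R).
Local Notation B := (bop H).
Variables (M N D : set B) (c : cartan_triple M N D).
Local Notation vD := (ct_vND c).
Local Notation vN := (ct_vNN c).
Local Notation cc := (cartan_central c).
Local Notation U := (unitary_normalizers M D).

Lemma fulman_lift : fulman_condition M N D ->
  exists alpha : {multiplicative munn_quot (gn c) -> pAut cc},
    forall s : munn_quot (gn c), munn_pi (alpha s) = theta s.
Proof.
move=> [G rg]; have [al [al_iso al_mul al_fix al_D]] := rg_action rg.
pose f (s : munn_quot (gn c)) : pAut cc := induced rg al_iso al_mul al_fix al_D (repr s).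
have fM : {morph f : s t / (s * t)%g}.
  move=> s t; rewrite /f -induced_mul; apply: induced_munn.
  by rewrite munn_repr.
exists (HB.pack_for {multiplicative munn_quot (gn c) -> pAut cc} f
  (isMultiplicative.Build _ _ f fM)) => s.
exact: induced_pi.
Qed.

Section Regularizer.
Variable alpha : {multiplicative munn_quot (gn c) -> pAut cc}.
Hypothesis alpha_theta : forall s, munn_pi (alpha s) = theta s.

Lemma alpha_ad (v : gn c) : munn_pi (alpha (munn_pi v)) = munn_pi (ad v).
Proof. by rewrite alpha_theta theta_pi. Qed.

Lemma alpha_f (v : gn c) : pa_f (alpha (munn_pi v)) = adj v * (v : B).
Proof. by rewrite (pa_munn_f (alpha_ad v)). Qed.

Lemma alpha_e (v : gn c) : pa_e (alpha (munn_pi v)) = (v : B) * adj v.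
Proof. by rewrite (pa_munn_e (alpha_ad v)). Qed.

Lemma alpha_proj (v : gn c) p : projections D p -> ple p (adj v * v) ->
  alpha (munn_pi v) p = (v : B) * p * adj v.
Proof.
move=> pP pv; have := pa_munn_proj (alpha_ad v) pP.
rewrite alpha_f pv adE //; last by exists p => //; exact: (proj_N cc pP).
Qed.

Lemma alphaM (v w : gn c) : alpha (munn_pi (gn_mul v w)) = (alpha (munn_pi v) * alpha (munn_pi w))%g.
Proof. by rewrite -gmulfM; congr (alpha _); exact: munn_piM. Qed.

(** The class of a projection is idempotent, so alpha maps it to an idempotent of
pAut(N, D), a restriction of the identity. *)
Lemma alpha_proj_id p (pP : projections D p) x : corner p N x ->
  alpha (munn_pi (projgn c pP)) x = x.
Proof.
move=> xp; have [_ pp sp] := pP.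
have ff : pa_f (alpha (munn_pi (projgn c pP))) = p by rewrite alpha_f /= sp pp.
have ee : (alpha (munn_pi (projgn c pP)) * alpha (munn_pi (projgn c pP)))%g =
    alpha (munn_pi (projgn c pP)).
  by rewrite -alphaM; congr (alpha (munn_pi _)); apply: val_inj.
by have /pa_idemP := ee; apply; rewrite ff.
Qed.

Lemma corner1 x : corner 1 N x <-> N x.
Proof. by split=> [[y Ny <-]|Nx]; [rewrite mul1r|exists x; rewrite ?mul1r]. Qed.

(** The action of a regularizer is a function on all operators, hence the default value
outside the normalizers. *)
Definition alpha_of (u : B) : B -> B :=
  if pselect (GN M D u) is left h then alpha (munn_pi (Gn c (mem_set h))) else id.

Lemma alpha_ofE (v : gn c) : alpha_of v = alpha (munn_pi v).
Proof.
rewrite /alpha_of; case: pselect => [h|[]]; last exact: gnP.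
by congr (pa_map (alpha (munn_pi _))); exact: val_inj.
Qed.

Lemma alpha_of_iso u : U u -> star_iso N N (alpha_of u).
Proof.
move=> [[Mu [uu uu']] gu]; pose v := Gn c (mem_set gu).
have -> : alpha_of u = alpha (munn_pi v) by exact: (alpha_ofE v).
have := pa_iso (alpha (munn_pi v)); rewrite alpha_f alpha_e uu uu'.
by rewrite (_ : corner 1 N = N) //; apply/seteqP; split=> x /corner1.
Qed.

Lemma ad_star_iso u : U u -> star_iso N N (fun x => u * x * adj u).
Proof.
move=> Uu; have [[Mu [uu uu']] gu] := Uu; pose v := Gn c (mem_set gu).
have Nad x : N x -> N (u * x * adj u) by exact: (ad_in v).
have Nad' x : N x -> N (adj u * x * u) by move=> Nx; have := ad_in (gn_dag v) Nx; rewrite /= adjK.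
have KK x : adj u * (u * x * adj u) * u = x.
  by rewrite !mulrA uu mul1r -mulrA uu mulr1.
split.
- split=> [x /Nad //|x y _ _ e|y Ny]; first by rewrite -(KK x) e KK.
  by exists (adj u * y * u); [exact: Nad'|rewrite !mulrA uu' mul1r -mulrA uu' mulr1].
- by move=> x y _ _; rewrite mulrDr mulrDl.
- by move=> k x _; rewrite -bop_scalerAr -bop_scalerAl.
- by move=> x y _ _; rewrite !mulrA -[_ * adj u * u]mulrA uu mulr1.
- by move=> x _; rewrite !adjM adjK mulrA.
Qed.

Lemma alpha_of_D u d : U u -> D d -> alpha_of u d = u * d * adj u.
Proof.
move=> Uu; move: d.
apply: (star_iso_eq_on_projections vN vD (DN c) (alpha_of_iso Uu) (ad_star_iso Uu)) => p pP.
have [[Mu [uu uu']] gu] := Uu; pose v := Gn c (mem_set gu).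
rewrite [alpha_of u](alpha_ofE v) alpha_proj // /ple /= uu mul1r //.
Qed.

Lemma alpha_of_mul u v x : U u -> U v -> N x -> alpha_of (u * v) x = alpha_of u (alpha_of v x).
Proof.
move=> Uu Uv Nx; have [[_ [uu _]] gu] := Uu; have [[_ [vv vv']] gv] := Uv.
pose u' := Gn c (mem_set gu); pose v' := Gn c (mem_set gv).
rewrite [alpha_of (u * v)](alpha_ofE (gn_mul u' v')) [alpha_of u](alpha_ofE u') [alpha_of v](alpha_ofE v').
rewrite alphaM pa_compE //; apply/pa_compP.
rewrite !alpha_f /= uu vv !corner1; split=> //.
rewrite -[alpha _ x]/(alpha (munn_pi v') x) -(alpha_ofE v').
exact: (star_iso_bij (alpha_of_iso Uv)).
Qed.

(** If ad_u is trivial on D p, then u p and p have the same Munn class. *)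
Lemma alpha_of_fix u p : U u -> projections D p ->
  (forall x, corner p D x -> alpha_of u x = x) -> forall x, corner p N x -> alpha_of u x = x.
Proof.
move=> Uu pP hfix x xp; have [[_ [uu _]] gu] := Uu.
pose u' := Gn c (mem_set gu); pose p' := projgn c pP.
have [Dp pp sp] := pP; have [Nx px] := (cornerP cc x pP).1 xp.
have up : munn_pi (gn_mul u' p') = munn_pi p'.
  apply/munn_piP => e /gn_idemP[De _ _]; apply: val_inj => /=.
  have Dpe : D (p * e * adj p) by rewrite sp; do 2!apply: (vNM vD) => //.
  have -> : u * p * gn_val e * adj (u * p) = u * (p * gn_val e * adj p) * adj u.
    by rewrite adjM !mulrA.
  rewrite -(alpha_of_D Uu Dpe) hfix //; exists (gn_val e * adj p); last by rewrite mulrA.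
  by rewrite sp; exact: (vNM vD).
have x' : corner (pa_f (alpha (munn_pi u') * alpha (munn_pi p'))%g) N x.
  apply/pa_compP; rewrite !alpha_f /= uu sp pp; split=> //.
  by rewrite alpha_proj_id //; exact/corner1.
rewrite [alpha_of u](alpha_ofE u') -[x in LHS](alpha_proj_id pP xp) -pa_compE //.
by rewrite -[pa_comp _ _]/(alpha (munn_pi u') * alpha (munn_pi p'))%g -alphaM up alpha_proj_id.
Qed.

Lemma lift_fulman : fulman_condition M N D.
Proof.
exists U; split.
- by move=> u [].
- by apply: (unorm_unitN c); split; [exact: (vN1 vN)|split; rewrite adj1 mulr1].
- by move=> u v; exact: (unormM c).
- by move=> u; exact: (unormV c).
- exact: (unorm_unitN c).
- by move=> u [].
- exact: (unorm_dense c).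
exists alpha_of; split.
- exact: alpha_of_iso.
- exact: alpha_of_mul.
- exact: alpha_of_fix.
- exact: alpha_of_D.
Qed.

End Regularizer.
End Splitting.

Theorem theoremA8 (R : realType) (H : hilbertType R) (M N D : set (bop H))
    (c : cartan_triple M N D) :
  fulman_condition M N D <->
  exists alpha : {multiplicative munn_quot (gn c) -> pAut (cartan_central c)},
    forall s : munn_quot (gn c), munn_pi (alpha s) = theta s.
Proof.
split=> [|[alpha h]]; first exact: fulman_lift.
exact: (lift_fulman h).
Qed.
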